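(* Let $n\ge 0$. The category of Deligne systems of $n$ variables over a field $E$ of characteristic $0$ is an abelian category. The category of Deligne-Hodge systems of $n$ variables is an abelian category. In each of these categories, for a morphism $A\to B$, the underlying vector space of the kernel (resp. cokernel) is the kernel (resp. cokernel) of the map between underlying vector spaces, and the structures $W$, $N_1,\dots,N_n$, and $\alpha$ (resp. $F$ in the Deligne-Hodge case) of the kernel (resp. cokernel) are those induced from the structures of $A$ (resp. $B$).
   Context: Mixed Hodge structures are mixed $\mathbb{R}$-Hodge structures. Relative monodromy filtration. Let $V$ be a vector space, $W=(W_w)_{w\in\mathbb{Z}}$ a finite increasing filtration, $N:V\to V$ nilpotent with $NW_w\subset W_w$ for all $w$. A finite increasing filtration $W'$ on $V$ is the relative monodromy filtration of $N$ with respect to $W$ if (i) $NW'_w\subset W'_{w-2}$ for all $w$, and (ii) for all $w\in\mathbb{Z}$, $m\ge 0$, $N^m$ induces an isomorphism $\mathrm{gr}^{W'}_{w+m}\mathrm{gr}^W_w\to \mathrm{gr}^{W'}_{w-m}\mathrm{gr}^W_w$. It need not exist; if it exists it is unique. A Deligne system of $n$ variables over a field $E$ of characteristic $0$ (resp. a Deligne-Hodge system of $n$ variables) is $(V,W,N_1,\dots,N_n,\alpha)$ (resp. $(V,W,N_1,\dots,N_n,F)$) where $V$ is a finite dimensional vector space over $E$ (resp. $\mathbb{R}$), $W$ is a finite increasing filtration on $V$, $N_j:V\to V$ are linear operators, $\alpha$ is an (algebraic) action of $\mathbb{G}_m$ on $V$ (resp. $F$ is a finite decreasing filtration on $V_{\mathbb{C}}=\mathbb{C}\otimes_{\mathbb{R}}V$),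 satisfying (a)–(e) (resp. (a)–(d), (f1), (f2)): (a) $N_1,\dots,N_n$ are nilpotent, mutually commute, and respect $W$ ($N_jW_w\subset W_w$). (b) There are finite increasing filtrations $W^{(j)}$ ($0\le j\le n$) with $W^{(0)}=W$ and, for $1\le j\le n$, $W^{(j)}$ is the relative monodromy filtration of $N_j$ with respect to $W^{(j-1)}$. (c) For $1\le j\le n$, $0\le k<j-1$, $w\in\mathbb{Z}$ and $U=W^{(k)}_w$, $W^{(j)}|_U$ is the relative monodromy filtration of $N_j|_U$ with respect to $W^{(j-1)}|_U$. (d) $N_j(W^{(k)}_w)\subset W^{(k)}_w$ for all $j,k,w$, and $N_j(W^{(k)}_w)\subset W^{(k)}_{w-2}$ if $k\ge j$. (e) $\alpha$ splits $W^{(n)}$ (i.e. $W^{(n)}_w$ is the sum of the weight $k$ parts of $\alpha$ for $k\le w$); each $W^{(j)}_w$ ($0\le j<n$) is stable under $\alpha$; and $\alpha(a)N_j\alpha(a)^{-1}=a^{-2}N_j$ for all $a$ and $1\le j\le n$. (f1) $N_jF^p\subset F^{p-1}$ for all $j,p$. (f2) $(W^{(n)},F)$ is a mixed Hodge structure; and for $0\le k<n$, $w\in\mathbb{Z}$, $U=W^{(k)}_w$, $(W^{(n)}|_U,F|_U)$ is a mixed Hodge structure. Morphisms in these categories are linear maps of the underlying vector spaces which respect $W$, commute with each $N_j$, and commute with $\alpha$ (resp. respect $F$ after tensoring with $\mathbb{C}$). *)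

(* Defs.v *)
From HB Require Import structures.
From mathcomp Require Import all_boot all_order all_algebra.
From mathcomp Require Import complex.
From mathcomp Require Import boolp reals.

Set Implicit Arguments.
Unset Strict Implicit.
Unset Printing Implicit Defensive.

Import Order.TTheory GRing.Theory Num.Theory.

Local Open Scope ring_scope.

Record preaddCat := PreaddCat {
  ob :> Type;
  mor : ob -> ob -> zmodType;
  idm : forall A, mor A A;
  comp : forall A B C, mor B C -> mor A B -> mor A C;
  comp1m : forall A B (f : mor A B), comp (idm B) f = f;
  compm1 : forall A B (f : mor A B), comp f (idm A) = f;
  compA : forall A B C D (h : mor C D) (g : mor B C) (f : mor A B),
    comp h (comp g f) = comp (comp h g) f;
  compDl : forall A B C (g g' : mor B C) (f : mor A B),
    comp (g + g') f = comp g f + comp g' f;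
  compDr : forall A B C (g : mor B C) (f f' : mor A B),
    comp g (f + f') = comp g f + comp g f'
}.

Section Abelian.
Context (C : preaddCat).
Implicit Types A B K Q T X Y Z : C.

Definition is_zero_object Z : Prop :=
  forall A, (forall f g : mor A Z, f = g) /\ (forall f g : mor Z A, f = g).

Definition is_biproduct A B T (i1 : mor A T) (i2 : mor B T)
    (p1 : mor T A) (p2 : mor T B) : Prop :=
  [/\ comp p1 i1 = idm A, comp p2 i2 = idm B, comp p1 i2 = 0, comp p2 i1 = 0
    & comp i1 p1 + comp i2 p2 = idm T].

Definition is_kernel A B (f : mor A B) K (i : mor K A) : Prop :=
  comp f i = 0 /\
  forall T (g : mor T A), comp f g = 0 -> exists! h : mor T K, comp i h = g.

Definition is_cokernel A B (f : mor A B) Q (p : mor B Q) : Prop :=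
  comp p f = 0 /\
  forall T (g : mor B T), comp g f = 0 -> exists! h : mor Q T, comp h p = g.

Definition is_mono A B (f : mor A B) : Prop :=
  forall T (g h : mor T A), comp f g = comp f h -> g = h.

Definition is_epi A B (f : mor A B) : Prop :=
  forall T (g h : mor B T), comp g f = comp h f -> g = h.

Record is_abelian : Prop := IsAbelian {
  abelian_zero : exists Z, is_zero_object Z;
  abelian_biproduct : forall A B, exists T
    (i1 : mor A T) (i2 : mor B T) (p1 : mor T A) (p2 : mor T B),
    is_biproduct i1 i2 p1 p2;
  abelian_kernel : forall A B (f : mor A B),
    exists K (i : mor K A), is_kernel f i;
  abelian_cokernel : forall A B (f : mor A B),
    exists Q (p : mor B Q), is_cokernel f p;
  abelian_mono : forall A B (f : mor A B), is_mono f ->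
    exists X (g : mor B X), is_kernel g f;
  abelian_epi : forall A B (f : mor A B), is_epi f ->
    exists X (g : mor X A), is_cokernel g f
}.

End Abelian.

(* Objects carry an underlying finite dimensional vector space, and morphisms
   are the linear maps satisfying [lmor]. *)
Record linCat (K : fieldType) := LinCat {
  lobj : Type;
  lcar : lobj -> vectType K;
  lmor : forall A B, 'Hom(lcar A, lcar B) -> Prop;
  lmor_id : forall A, lmor (\1%VF : 'Hom(lcar A, lcar A));
  lmor_comp : forall A B C (g : 'Hom(lcar B, lcar C)) (f : 'Hom(lcar A, lcar B)),
    lmor g -> lmor f -> lmor (g \o f)%VF;
  lmor0 : forall A B, lmor (0 : 'Hom(lcar A, lcar B));
  lmorB : forall A B (f g : 'Hom(lcar A, lcar B)),
    lmor f -> lmor g -> lmor (f - g)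
}.

Section LinCat.
Context (K : fieldType) (C : linCat K).

Section Hom.
Context (A B : lobj C).

Definition lmor_pred : {pred 'Hom(lcar A, lcar B)} := fun f => `[< lmor f >].

Lemma lmor_zmod_closed : zmod_closed lmor_pred.
Proof.
split=> [|f g /asboolP Hf /asboolP Hg]; apply/asboolP; first exact: lmor0.
exact: lmorB.
Qed.

HB.instance Definition _ :=
  GRing.isZmodClosed.Build 'Hom(lcar A, lcar B) lmor_pred lmor_zmod_closed.

Record lhom := LHom { lhom_fun :> 'Hom(lcar A, lcar B); _ : lhom_fun \in lmor_pred }.

HB.instance Definition _ := [isSub for lhom_fun].
HB.instance Definition _ := [Choice of lhom by <:].
HB.instance Definition _ := [SubChoice_isSubZmodule of lhom by <:].

Lemma lhomP (f : lhom) : lmor f.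
Proof. exact/asboolP/(valP f). Qed.

End Hom.

Definition lhom_id A : lhom A A := LHom (asboolT (lmor_id A)).

Definition lhom_comp A1 A2 A3 (g : lhom A2 A3) (f : lhom A1 A2) : lhom A1 A3 :=
  LHom (asboolT (lmor_comp (lhomP g) (lhomP f))).

Fact lhom_comp1m A B (f : lhom A B) : lhom_comp (lhom_id B) f = f.
Proof. by apply/val_inj; rewrite /= comp_lfun1l. Qed.

Fact lhom_compm1 A B (f : lhom A B) : lhom_comp f (lhom_id A) = f.
Proof. by apply/val_inj; rewrite /= comp_lfun1r. Qed.

Fact lhom_compA A1 A2 A3 A4 (h : lhom A3 A4) (g : lhom A2 A3) (f : lhom A1 A2) :
  lhom_comp h (lhom_comp g f) = lhom_comp (lhom_comp h g) f.
Proof. by apply/val_inj; rewrite /= comp_lfunA. Qed.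

Fact lhom_compDl A1 A2 A3 (g g' : lhom A2 A3) (f : lhom A1 A2) :
  lhom_comp (g + g') f = lhom_comp g f + lhom_comp g' f.
Proof. by apply/val_inj; rewrite /= comp_lfunDl. Qed.

Fact lhom_compDr A1 A2 A3 (g : lhom A2 A3) (f f' : lhom A1 A2) :
  lhom_comp g (f + f') = lhom_comp g f + lhom_comp g f'.
Proof. by apply/val_inj; rewrite /= comp_lfunDr. Qed.

Definition linCat_preaddCat : preaddCat :=
  PreaddCat lhom_comp1m lhom_compm1 lhom_compA lhom_compDl lhom_compDr.

End LinCat.

Section Filtrations.
Context (K : fieldType).
Implicit Types U V : vectType K.

Definition finite_increasing V (W : int -> {vspace V}) : Prop :=
  [/\ forall i j : int, i <= j -> (W i <= W j)%VS,
      exists i, W i = 0%VS & exists i, W i = fullv].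

Definition finite_decreasing V (F : int -> {vspace V}) : Prop :=
  [/\ forall i j : int, i <= j -> (F j <= F i)%VS,
      exists i, F i = fullv & exists i, F i = 0%VS].

Definition lfun_iter V (N : 'End(V)) (m : nat) : 'End(V) :=
  iter m (fun f => N \o f)%VF \1%VF.

Definition nilpotent_lfun V (N : 'End(V)) : Prop :=
  exists m, lfun_iter N m = 0.

Definition preserves V V' (W : int -> {vspace V}) (W' : int -> {vspace V'})
    (f : 'Hom(V, V')) : Prop :=
  forall w, (f @: W w <= W' w)%VS.

(* [f] maps [A] to [B] and [A'] to [B'], and the induced map A/A' -> B/B' is
   injective and surjective. *)
Definition induces_iso V V' (f : 'Hom(V, V'))
    (A A' : {vspace V}) (B B' : {vspace V'}) : Prop :=
  [/\ (f @: A <= B)%VS, (f @: A' <= B')%VS,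
      forall x, x \in A -> f x \in B' -> x \in A'
    & forall y, y \in B -> exists2 x, x \in A & y - f x \in B'].

(* The preimage in W_w of the k-th step of the filtration induced by W' on
   gr^W_w = W_w / W_{w-1}.  Hence
   gr^{W'}_k gr^W_w = gr_fil W' W w k / gr_fil W' W w (k - 1). *)
Definition gr_fil V (W' W : int -> {vspace V}) (w k : int) : {vspace V} :=
  (W' k :&: W w + W (w - 1))%VS.

Definition is_relative_monodromy V (N : 'End(V)) (W W' : int -> {vspace V}) :
    Prop :=
  [/\ finite_increasing W',
      forall w, (N @: W' w <= W' (w - 2))%VS
    & forall (w : int) (m : nat),
        induces_iso (lfun_iter N m)
          (gr_fil W' W w (w + m%:Z)) (gr_fil W' W w (w + m%:Z - 1))
          (gr_fil W' W w (w - m%:Z)) (gr_fil W' W w (w - m%:Z - 1))].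

Definition sub_incl V (U : {vspace V}) : 'Hom(subvs_of U, V) := linfun vsval.

Definition restr_fil V (U : {vspace V}) (W : int -> {vspace V}) :
    int -> {vspace subvs_of U} :=
  fun w => (sub_incl U @^-1: W w)%VS.

(* Meaningful only when N maps U into U. *)
Definition restr_end V (U : {vspace V}) (N : 'End(V)) : 'End(subvs_of U) :=
  (linfun (vsproj U) \o N \o sub_incl U)%VF.

(* The operators N_1, ..., N_n are indexed from 0: N_j is [N (j - 1)]. *)
Definition admissible_operators V n (W : int -> {vspace V})
    (N : 'I_n -> 'End(V)) : Prop :=
  [/\ forall j, nilpotent_lfun (N j),
      forall i j, (N i \o N j = N j \o N i)%VF
    & forall j, preserves W W (N j)].

(* [Wj j] is W^(j); only its values for j <= n matter.  Because of the shift in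
   the indices of N, the operator [N j] relates [Wj j] to [Wj j.+1]. *)
Definition monodromy_tower V n (W : int -> {vspace V}) (N : 'I_n -> 'End(V))
    (Wj : nat -> int -> {vspace V}) : Prop :=
  [/\ finite_increasing W /\ (forall w, Wj 0 w = W w),
      forall j : 'I_n, is_relative_monodromy (N j) (Wj j) (Wj j.+1),
      forall (j : 'I_n) (k : nat) (w : int), (k < j)%N ->
        is_relative_monodromy (restr_end (Wj k w) (N j))
          (restr_fil (Wj k w) (Wj j)) (restr_fil (Wj k w) (Wj j.+1)),
      forall (j : 'I_n) (k : nat) (w : int), (k <= n)%N ->
        (N j @: Wj k w <= Wj k w)%VS
    & forall (j : 'I_n) (k : nat) (w : int), (j < k <= n)%N ->
        (N j @: Wj k w <= Wj k (w - 2))%VS].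

End Filtrations.

Section DeligneSystems.
Context (E : fieldType).
Implicit Types V : vectType E.

(* An algebraic action of G_m, given on E-points: a group homomorphism
   E^* -> GL(V) which is a Laurent polynomial with coefficients in End(V).
   The value at 0 is irrelevant.  For infinite E this is the same as a
   homomorphism of algebraic groups G_m -> GL(V). *)
Definition is_Gm_action V (alpha : E -> 'End(V)) : Prop :=
  [/\ alpha 1 = \1%VF,
      forall a b : E, a != 0 -> b != 0 -> alpha (a * b) = (alpha a \o alpha b)%VF
    & exists s : seq (int * 'End(V)),
        forall a : E, a != 0 -> alpha a = \sum_(t <- s) a ^ t.1 *: t.2].

Definition has_weight V (alpha : E -> 'End(V)) (k : int) (v : V) : Prop :=
  forall a : E, a != 0 -> alpha a v = a ^ k *: v.

Definition splits V (alpha : E -> 'End(V)) (W : int -> {vspace V}) : Prop :=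
  forall (w : int) (v : V), v \in W w <->
    exists s : seq (int * V),
      (forall t, t \in s -> t.1 <= w /\ has_weight alpha t.1 t.2) /\
      v = \sum_(t <- s) t.2.

Definition is_deligne_system n V (W : int -> {vspace V})
    (N : 'I_n -> 'End(V)) (alpha : E -> 'End(V)) : Prop :=
  [/\ admissible_operators W N, is_Gm_action alpha
    & exists Wj : nat -> int -> {vspace V},
      [/\ monodromy_tower W N Wj,
          splits alpha (Wj n),
          forall (j : nat) (w : int) (a : E), (j < n)%N -> a != 0 ->
            (alpha a @: Wj j w <= Wj j w)%VS
        & forall (a : E) (j : 'I_n), a != 0 ->
            (alpha a \o N j \o (alpha a)^-1)%VF = a ^- 2 *: N j]].

Record deligneSystem (n : nat) := DeligneSystem {
  ds_car :> vectType E;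
  ds_W : int -> {vspace ds_car};
  ds_N : 'I_n -> 'End(ds_car);
  ds_alpha : E -> 'End(ds_car);
  ds_axioms : is_deligne_system ds_W ds_N ds_alpha
}.

Context (n : nat).

Definition ds_mor (A B : deligneSystem n) (f : 'Hom(A, B)) : Prop :=
  [/\ preserves (ds_W A) (ds_W B) f,
      forall j, (f \o ds_N A j = ds_N B j \o f)%VF
    & forall a : E, a != 0 -> (f \o ds_alpha A a = ds_alpha B a \o f)%VF].

Fact ds_mor_id (A : deligneSystem n) : ds_mor (\1%VF : 'Hom(A, A)).
Proof.
split=> [w|j|a _]; rewrite ?comp_lfun1l ?comp_lfun1r //.
by rewrite lim1g.
Qed.

Fact ds_mor_comp (A B C : deligneSystem n) (g : 'Hom(B, C)) (f : 'Hom(A, B)) :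
  ds_mor g -> ds_mor f -> ds_mor (g \o f)%VF.
Proof.
move=> [gW gN ga] [fW fN fa]; split=> [w|j|a a0].
- by rewrite limg_comp (subv_trans (limgS g (fW w))).
- by rewrite -comp_lfunA fN comp_lfunA gN comp_lfunA.
- by rewrite -comp_lfunA fa // comp_lfunA ga // comp_lfunA.
Qed.

Fact ds_mor0 (A B : deligneSystem n) : ds_mor (0 : 'Hom(A, B)).
Proof.
split=> [w|j|a _]; rewrite ?comp_lfun0l ?comp_lfun0r //.
by apply/subvP=> _ /memv_imgP[v _ ->]; rewrite lfunE /= mem0v.
Qed.

Fact ds_morB (A B : deligneSystem n) (f g : 'Hom(A, B)) :
  ds_mor f -> ds_mor g -> ds_mor (f - g).
Proof.
move=> [fW fN fa] [gW gN ga]; split=> [w|j|a a0].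
- apply/subvP=> _ /memv_imgP[v vW ->]; rewrite !lfun_simp.
  by apply: memvB; [apply: (subvP (fW w)) | apply: (subvP (gW w))];
    apply: memv_img.
- by rewrite comp_lfunDl comp_lfunDr comp_lfunNl comp_lfunNr fN gN.
- by rewrite comp_lfunDl comp_lfunDr comp_lfunNl comp_lfunNr fa ?ga.
Qed.

Definition deligne_linCat : linCat E :=
  LinCat ds_mor_id ds_mor_comp ds_mor0 ds_morB.

Definition deligneCat : preaddCat := linCat_preaddCat deligne_linCat.

End DeligneSystems.

(* The complexification of V: the pair (x, y) stands for 1 (x) x + i (x) y. *)
Definition cplx (R : rcfType) (V : vectType R) : Type := (V * V)%type.

Section Complexification.
Context (R : rcfType).

Section Structure.
Import VectorInternalTheory.
Context (V : vectType R).

HB.instance Definition _ := GRing.Zmodule.on (cplx V).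

Definition cplx_scale (z : R[i]) (u : cplx V) : cplx V :=
  (complex.Re z *: u.1 - complex.Im z *: u.2,
   complex.Re z *: u.2 + complex.Im z *: u.1).

Fact cplx_scaleA a b u : cplx_scale a (cplx_scale b u) = cplx_scale (a * b) u.
Proof.
case: a b u => [a a'] [b b'] [x y]; rewrite /cplx_scale /=.
rewrite !(scalerBr, scalerDr, scalerA, scalerDl, scalerBl) !scaleNr.
congr (_, _); last by rewrite [X in _ + X = _]addrC addrACA.
by rewrite !opprD [X in _ + X = _]addrC addrACA.
Qed.

Fact cplx_scale1 : left_id 1 cplx_scale.
Proof.
by case=> x y; rewrite /cplx_scale /= !scale1r !scale0r subr0 addr0.
Qed.

Fact cplx_scaleDr : right_distributive cplx_scale +%R.
Proof.
move=> [a b] [x y] [x' y']; rewrite /cplx_scale /=.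
by rewrite !scalerDr opprD [in LHS]addrACA [X in (_, X)]addrACA.
Qed.

Fact cplx_scaleDl u : {morph cplx_scale^~ u : a b / a + b}.
Proof.
case: u => x y [a a'] [b b']; rewrite /cplx_scale /=.
by rewrite !scalerDl opprD [in LHS]addrACA [X in (_, X)]addrACA.
Qed.

HB.instance Definition _ := GRing.Zmodule_isLmodule.Build R[i] (cplx V)
  cplx_scaleA cplx_scale1 cplx_scaleDr cplx_scaleDl.

Definition cplx_v2r (u : cplx V) : 'rV[R[i]]_(dim V) :=
  \row_j Complex (v2r u.1 0 j) (v2r u.2 0 j).

Definition cplx_r2v (r : 'rV[R[i]]_(dim V)) : cplx V :=
  (r2v (\row_j complex.Re (r 0 j)), r2v (\row_j complex.Im (r 0 j))).

Fact cplx_vect_iso : Vector.axiom (dim V) (cplx V).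
Proof.
exists cplx_v2r.
  move=> [a b] [x y] [x' y']; apply/rowP=> j.
  rewrite !mxE /=; congr Complex.
    by rewrite linearD linearB !linearZ !mxE mulrN.
  by rewrite !linearD !linearZ !mxE.
exists cplx_r2v => [[x y]|r].
  rewrite /cplx_r2v; congr (_, _); apply: (can_inj v2rK); rewrite r2vK.
    by apply/rowP=> j; rewrite !mxE.
  by apply/rowP=> j; rewrite !mxE.
by apply/rowP=> j; rewrite !mxE /= !r2vK !mxE; case: (r 0 j).
Qed.

HB.instance Definition _ := Lmodule_hasFinDim.Build R[i] (cplx V) cplx_vect_iso.

Definition cplx_conj (u : cplx V) : cplx V := (u.1, - u.2).

Definition conjv (U : {vspace cplx V}) : {vspace cplx V} :=
  <<[seq cplx_conj u | u <- vbasis U]>>%VS.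

End Structure.

Definition cplx_map_fun (V V' : vectType R) (f : 'Hom(V, V')) (u : cplx V) :
  cplx V' := (f u.1, f u.2).

Fact cplx_map_is_linear (V V' : vectType R) (f : 'Hom(V, V')) :
  linear (cplx_map_fun f).
Proof.
move=> [a b] [x y] [x' y']; rewrite /cplx_map_fun /=; congr (_, _);
by rewrite /= !(linearD, linearN, linearZ, linearB).
Qed.

HB.instance Definition _ (V V' : vectType R) (f : 'Hom(V, V')) :=
  GRing.isLinear.Build R[i] (cplx V) (cplx V') _ (cplx_map_fun f)
    (cplx_map_is_linear f).

Definition cplx_map (V V' : vectType R) (f : 'Hom(V, V')) :
  'Hom(cplx V, cplx V') := linfun (cplx_map_fun f).

Lemma cplx_mapE (V V' : vectType R) (f : 'Hom(V, V')) (u : cplx V) :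
  cplx_map f u = (f u.1, f u.2).
Proof. exact: lfunE. Qed.

Definition cplx_sub (V : vectType R) (U : {vspace V}) : {vspace cplx V} :=
  limg (cplx_map (sub_incl U)).

Lemma memv_cplx_sub (V : vectType R) (U : {vspace V}) (u : cplx V) :
  (u \in cplx_sub U) = (u.1 \in U) && (u.2 \in U).
Proof.
apply/memv_imgP/andP=> [[[x y] _ ->]|[u1 u2]].
  by rewrite cplx_mapE /= !lfunE /= !subvsP.
exists (vsproj U u.1, vsproj U u.2); first exact: memvf.
by rewrite cplx_mapE /= !lfunE /= !vsprojK //; case: u {u1 u2}.
Qed.

Lemma cplx_conjK (V : vectType R) : involutive (@cplx_conj V).
Proof. by case=> x y; rewrite /cplx_conj /= opprK. Qed.

Lemma cplx_conjD (V : vectType R) : {morph @cplx_conj V : u v / u + v}.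
Proof. by move=> [x y] [x' y']; congr (_, _); rewrite /= opprD. Qed.

Lemma cplx_conjZ (V : vectType R) (z : R[i]) (u : cplx V) :
  cplx_conj (z *: u) = conjc z *: cplx_conj u.
Proof.
case: z u => [a b] [x y]; congr (_, _).
  by rewrite /= scalerN !scaleNr opprK.
by rewrite /= scalerN scaleNr opprD.
Qed.

Lemma memv_conjv (V : vectType R) (U : {vspace cplx V}) (u : cplx V) :
  (u \in conjv U) = (cplx_conj u \in U).
Proof.
have conj_sum (I : Type) (r : seq I) (G : I -> cplx V) :
    cplx_conj (\sum_(i <- r) G i) = \sum_(i <- r) cplx_conj (G i).
  apply: (big_morph _ (@cplx_conjD V)).
  by congr (_, _); rewrite /= oppr0.
apply/idP/idP=> [uU|uU].
  rewrite (congr1 (@cplx_conj V) (coord_span uU)) conj_sum memv_suml // => i _.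
  rewrite cplx_conjZ memvZ //.
  have: [seq cplx_conj u | u <- vbasis U]`_i \in
        [seq cplx_conj u | u <- vbasis U].
    by apply: mem_nth; rewrite size_map size_tuple.
  by case/mapP=> v /vbasis_mem vU ->; rewrite cplx_conjK.
rewrite -[u]cplx_conjK (congr1 (@cplx_conj V) (coord_vbasis uU)) conj_sum memv_suml // => i _.
rewrite cplx_conjZ memvZ // memv_span //; apply: map_f.
by apply: mem_nth; rewrite size_tuple.
Qed.

(* The preimage in (W_w)_C of the p-th step of the filtration induced by F on
   gr^W_w (x) C. *)
Definition hodge_gr_fil (V : vectType R) (W : int -> {vspace V})
    (F : int -> {vspace cplx V}) (w p : int) : {vspace cplx V} :=
  (F p :&: cplx_sub (W w) + cplx_sub (W (w - 1)))%VS.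

(* The filtration F(gr^W_w) is a pure Hodge structure of weight w:
   gr^W_w (x) C is the direct sum of F^p and of the complex conjugate of
   F^{w+1-p} for all p. *)
Definition is_mixed_hodge (V : vectType R) (W : int -> {vspace V})
    (F : int -> {vspace cplx V}) : Prop :=
  [/\ finite_increasing W, finite_decreasing F
    & forall w p : int,
        (hodge_gr_fil W F w p + conjv (hodge_gr_fil W F w (w + 1 - p)))%VS
          = cplx_sub (W w) /\
        (hodge_gr_fil W F w p :&: conjv (hodge_gr_fil W F w (w + 1 - p)))%VS
          = cplx_sub (W (w - 1))].

Definition restr_hodge (V : vectType R) (U : {vspace V})
    (F : int -> {vspace cplx V}) : int -> {vspace cplx (subvs_of U)} :=
  fun p => (cplx_map (sub_incl U) @^-1: F p)%VS.

Definition is_deligne_hodge_system n (V : vectType R) (W : int -> {vspace V})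
    (N : 'I_n -> 'End(V)) (F : int -> {vspace cplx V}) : Prop :=
  [/\ admissible_operators W N,
      finite_decreasing F,
      forall (j : 'I_n) (p : int), (cplx_map (N j) @: F p <= F (p - 1))%VS
    & exists Wj : nat -> int -> {vspace V},
      [/\ monodromy_tower W N Wj,
          is_mixed_hodge (Wj n) F
        & forall (k : nat) (w : int), (k < n)%N ->
            is_mixed_hodge (restr_fil (Wj k w) (Wj n)) (restr_hodge (Wj k w) F)]].

Record deligneHodgeSystem (n : nat) := DeligneHodgeSystem {
  dh_car :> vectType R;
  dh_W : int -> {vspace dh_car};
  dh_N : 'I_n -> 'End(dh_car);
  dh_F : int -> {vspace cplx dh_car};
  dh_axioms : is_deligne_hodge_system dh_W dh_N dh_F
}.

Context (n : nat).

Definition dh_mor (A B : deligneHodgeSystem n) (f : 'Hom(A, B)) : Prop :=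
  [/\ preserves (dh_W A) (dh_W B) f,
      forall j, (f \o dh_N A j = dh_N B j \o f)%VF
    & preserves (dh_F A) (dh_F B) (cplx_map f)].

Fact dh_mor_id (A : deligneHodgeSystem n) : dh_mor (\1%VF : 'Hom(A, A)).
Proof.
split=> [w|j|p]; rewrite ?comp_lfun1l ?comp_lfun1r ?lim1g //.
apply/subvP=> _ /memv_imgP[[x y] vF ->].
by rewrite cplx_mapE /= !lfunE.
Qed.

Fact dh_mor_comp (A B C : deligneHodgeSystem n)
    (g : 'Hom(B, C)) (f : 'Hom(A, B)) :
  dh_mor g -> dh_mor f -> dh_mor (g \o f)%VF.
Proof.
move=> [gW gN gF] [fW fN fF]; split=> [w|j|p].
- by rewrite limg_comp (subv_trans (limgS g (fW w))).
- by rewrite -comp_lfunA fN comp_lfunA gN comp_lfunA.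
apply/subvP=> _ /memv_imgP[v vF ->].
have -> : cplx_map (g \o f)%VF v = cplx_map g (cplx_map f v).
  by rewrite !cplx_mapE /= !lfunE.
by apply/(subvP (gF p))/memv_img/(subvP (fF p))/memv_img.
Qed.

Fact dh_mor0 (A B : deligneHodgeSystem n) : dh_mor (0 : 'Hom(A, B)).
Proof.
split=> [w|j|p]; rewrite ?comp_lfun0l ?comp_lfun0r //;
  apply/subvP=> _ /memv_imgP[v _ ->].
  by rewrite lfunE /= mem0v.
by rewrite cplx_mapE !lfunE /= (mem0v (dh_F B p)).
Qed.

Fact dh_morB (A B : deligneHodgeSystem n) (f g : 'Hom(A, B)) :
  dh_mor f -> dh_mor g -> dh_mor (f - g).
Proof.
move=> [fW fN fF] [gW gN gF]; split=> [w|j|p].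
- apply/subvP=> _ /memv_imgP[v vW ->]; rewrite !lfun_simp.
  by apply: memvB; [apply: (subvP (fW w)) | apply: (subvP (gW w))];
    apply: memv_img.
- by rewrite comp_lfunDl comp_lfunDr comp_lfunNl comp_lfunNr fN gN.
apply/subvP=> _ /memv_imgP[v vF ->].
have -> : cplx_map (f - g) v = cplx_map f v - cplx_map g v.
  by rewrite !cplx_mapE /= !lfun_simp.
by apply: memvB; [apply: (subvP (fF p)) | apply: (subvP (gF p))];
  apply: memv_img.
Qed.

Definition deligneHodge_linCat : linCat R :=
  LinCat dh_mor_id dh_mor_comp dh_mor0 dh_morB.

Definition deligneHodgeCat : preaddCat := linCat_preaddCat deligneHodge_linCat.

End Complexification.

Section InducedStructures.
Context (K : fieldType).

Definition is_lin_kernel (V V' U : vectType K) (f : 'Hom(V, V'))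
    (i : 'Hom(U, V)) : Prop :=
  lker i = 0%VS /\ limg i = lker f.

Definition is_lin_cokernel (V V' U : vectType K) (f : 'Hom(V, V'))
    (p : 'Hom(V', U)) : Prop :=
  limg p = fullv /\ lker p = limg f.

End InducedStructures.

Definition ds_kernel (E : fieldType) (n : nat) (A B X : deligneSystem E n)
    (f : 'Hom(A, B)) (i : 'Hom(X, A)) : Prop :=
  [/\ is_lin_kernel f i,
      forall w, ds_W X w = (i @^-1: ds_W A w)%VS,
      forall j, (i \o ds_N X j = ds_N A j \o i)%VF
    & forall a : E, a != 0 -> (i \o ds_alpha X a = ds_alpha A a \o i)%VF].

Definition ds_cokernel (E : fieldType) (n : nat) (A B X : deligneSystem E n)
    (f : 'Hom(A, B)) (p : 'Hom(B, X)) : Prop :=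
  [/\ is_lin_cokernel f p,
      forall w, ds_W X w = (p @: ds_W B w)%VS,
      forall j, (ds_N X j \o p = p \o ds_N B j)%VF
    & forall a : E, a != 0 -> (ds_alpha X a \o p = p \o ds_alpha B a)%VF].

Definition dh_kernel (R : rcfType) (n : nat) (A B X : deligneHodgeSystem R n)
    (f : 'Hom(A, B)) (i : 'Hom(X, A)) : Prop :=
  [/\ is_lin_kernel f i,
      forall w, dh_W X w = (i @^-1: dh_W A w)%VS,
      forall j, (i \o dh_N X j = dh_N A j \o i)%VF
    & forall q, dh_F X q = (cplx_map i @^-1: dh_F A q)%VS].

Definition dh_cokernel (R : rcfType) (n : nat) (A B X : deligneHodgeSystem R n)
    (f : 'Hom(A, B)) (p : 'Hom(B, X)) : Prop :=
  [/\ is_lin_cokernel f p,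
      forall w, dh_W X w = (p @: dh_W B w)%VS,
      forall j, (dh_N X j \o p = p \o dh_N B j)%VF
    & forall q, dh_F X q = (cplx_map p @: dh_F B q)%VS].

(* Main.v *)
From HB Require Import structures.
Require Import Defs.
From mathcomp Require Import all_boot all_order all_algebra.
From mathcomp Require Import complex boolp reals.
From mathcomp Require Import zify ring.

Set Implicit Arguments.
Unset Strict Implicit.
Unset Printing Implicit Defensive.

Import Order.TTheory GRing.Theory Num.Theory.

Local Open Scope ring_scope.

(** All assertions come down to strictness: a morphism [f : A -> B] should
    satisfy [f (W_w A) = f A] intersected with [W_w B], likewise for the other
    filtrations, and its kernel and cokernel should inherit all structures.
    In the direct sum of [A] and [B], the kernel of [f] is the intersection of
    the graphs of [f] and [0], the cokernel is the quotient by the sum of these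
    graphs, and strictness for a filtration [M] says that each [M k] is
    distributive with respect to the two graphs ([graph_kernel],
    [graph_cokernel], [graph_strict]). So the object to study is one space [V]
    with lattices of subspaces for which a filtration is distributive
    ([strict_lattice]).

    There is one such lattice for each filtration [W^(j)] of the tower. For
    [W^(n)] it consists of the subspaces stable under [alpha], and
    distributivity holds since these are sums of weight vectors
    ([gm_strict_lattice]); in the Hodge case it consists of the subspaces on
    which a mixed Hodge structure is induced ([hodge_strict_lattice]).

    To descend from [M = W^(j+1)] to [W = W^(j)], keep the subspaces stable
    under [N_j] on which [M] still induces the relative monodromy filtration.
    For two such subspaces [S], [T], the obstruction to distributivity of [W]
    at level [u] is a connecting map from a space pure of weight [u] to the
    quotient of [W_(u-1)] by the traces of [S] and [T], which has weights below
    [u]. The map commutes with [N_j], and the representation theory of sl_2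
    forbids a nonzero one on the graded pieces of [M] ([lefschetz_vanishing]).
    As the map is strict for [M], by the distributivity already known, it is
    zero itself ([strict_lattice_step]). The same scheme, with types [(p, q)]
    in place of the operator, gives strictness for mixed Hodge structures
    ([opposed_dist_step]).

    Iterating the descent ([tower_strict_lattice]) is possible because
    the compatibility of the tower with restriction to its own steps puts
    [W^(k)_w] into the lattices with [j >= k].
    A subspace in all of the lattices inherits the structure of its ambient
    space, and so does the quotient by it ([tower_sub], [tower_quotient]).
    The graph of a morphism is such a subspace, since relative monodromy
    filtrations are functorial ([relative_monodromy_functorial]). A concrete
    linear category with these properties is abelian ([lin_abelian]). *)

(** * Preliminaries *)

(** Identities between vectors are checked on coordinates, where [ring] applies. *)
Lemma vec_ext (K : fieldType) (V : vectType K) (x y : V) :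
  (forall i, coord (vbasis fullv) i x = coord (vbasis fullv) i y) -> x = y.
Proof.
move=> H; rewrite (coord_vbasis (memvf x)) (coord_vbasis (memvf y)).
by apply: eq_bigr => i _; rewrite H.
Qed.

Ltac zmod := apply: vec_ext => ?; ring.

Ltac lzmod := rewrite ?(linearD, linearN, linear0) /=; zmod.

Ltac memv :=
  repeat match goal with
  | _ => assumption
  | |- is_true (@in_mem _ _ (@mem _ _ (pred_of_vspace (addv _ _)))) => fail 1
  | |- is_true (@in_mem _ _ (@mem _ _ (pred_of_vspace (gr_fil _ _ _ _)))) => fail 1
  | |- is_true (0 \in _) => exact: mem0v
  | |- is_true (- _ \in _) => rewrite memvN
  | |- is_true (_ + _ \in _) => apply: memvD
  | |- is_true (@in_mem _ _ (@mem _ _ (pred_of_vspace (capv _ _)))) => apply/memv_capP; split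
  end; try done.

(* Unlike [memv], this leaves alone the goals that it cannot close. *)
Ltac memv_solve :=
  match goal with
  | _ => assumption
  | |- is_true (0 \in _) => exact: mem0v
  | |- is_true (- _ \in _) => rewrite memvN; memv_solve
  | |- is_true (_ + _ \in _) => apply: memvD; memv_solve
  | |- is_true (@in_mem _ _ (@mem _ _ (pred_of_vspace (capv _ _)))) =>
    apply/memv_capP; split; memv_solve
  end.

Ltac memvs := try solve [memv_solve].

(* In the presence of the other hypotheses, [lia] is very slow. *)
Ltac ilia :=
  repeat match goal with
  | H : ?T |- _ =>
    lazymatch T with
    | @eq ?A _ _ => tryif (first [unify A int | unify A nat]) then fail else clear H
    | is_true (Order.le _ _) => fail
    | is_true (Order.lt _ _) => fail
    | is_true (leq _ _) => fail
    | _ => clear H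
    end
  end; lia.

Lemma int_ind_up (P : int -> Prop) (k0 : int) :
  (forall k, k <= k0 -> P k) -> (forall k, P (k - 1) -> P k) -> forall k, P k.
Proof.
move=> P0 PS k; case: (leP k k0) => [/P0 //|k0k].
have [m ->] : exists m : nat, k = k0 + m%:Z by exists (absz (k - k0)); ilia.
elim: m {k k0k} => [|m IH]; first by apply: P0; ilia.
by apply: PS; have -> : k0 + m.+1%:Z - 1 = k0 + m%:Z by ilia.
Qed.

Lemma int_ind_down (P : int -> Prop) (k0 : int) :
  (forall k, k0 <= k -> P k) -> (forall k, P (k + 1) -> P k) -> forall k, P k.
Proof.
move=> P0 PS k; case: (leP k0 k) => [/P0 //|kk0].
have [m ->] : exists m : nat, k = k0 - m%:Z by exists (absz (k0 - k)); ilia.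
elim: m {k kk0} => [|m IH]; first by apply: P0; ilia.
by apply: PS; have -> : k0 - m.+1%:Z + 1 = k0 - m%:Z by ilia.
Qed.

Section Filtrations.
Context (K : fieldType) (V : vectType K).
Implicit Types (M W F G : int -> {vspace V}) (S T : {vspace V}) (N : 'End(V)).

Lemma fil_incr W (i j : int) x :
  finite_increasing W -> i <= j -> x \in W i -> x \in W j.
Proof. by case=> H _ _ ij; apply: (subvP (H _ _ ij)). Qed.

Lemma fil_decr F (i j : int) x :
  finite_decreasing F -> i <= j -> x \in F j -> x \in F i.
Proof. by case=> H _ _ ij; apply: (subvP (H _ _ ij)). Qed.

Lemma fil_zero W :
  finite_increasing W -> exists i, forall k x, k <= i -> x \in W k -> x = 0.
Proof.
move=> Wf; have [_ [i Wi] _] := Wf; exists i => k x ki /(fil_incr Wf ki).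
by rewrite Wi memv0 => /eqP.
Qed.

Lemma fil_full W :
  finite_increasing W -> exists i, forall k x, i <= k -> x \in W k.
Proof.
move=> Wf; have [_ _ [i Wi]] := Wf; exists i => k x ik.
by apply: (fil_incr Wf ik); rewrite Wi memvf.
Qed.

Definition stable N S := forall x, x \in S -> N x \in S.

Definition lowers N M := forall k x, x \in M k -> N x \in M (k - 2).

Lemma stableP N S : stable N S <-> (N @: S <= S)%VS.
Proof.
split=> [H|/subvP H x xS]; last exact/H/memv_img.
by apply/subvP=> _ /memv_imgP[x xS ->]; apply: H.
Qed.

Lemma lowersP N M : lowers N M <-> forall w, (N @: M w <= M (w - 2))%VS.
Proof.
split=> [H w|H k x xM]; last exact/(subvP (H k))/memv_img.
by apply/subvP=> _ /memv_imgP[x xS ->]; apply: H.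
Qed.

Lemma lfun_iterS N m x : lfun_iter N m.+1 x = N (lfun_iter N m x).
Proof. by rewrite /= comp_lfunE. Qed.

Lemma lfun_iterD N m p x :
  lfun_iter N (m + p) x = lfun_iter N m (lfun_iter N p x).
Proof. by elim: m => [|m IH]; rewrite ?addSn ?lfun_iterS ?IH //= id_lfunE. Qed.

Lemma iter_stable N S m : stable N S -> stable (lfun_iter N m) S.
Proof.
move=> NS x xS; elim: m => [|m IH]; first by rewrite id_lfunE.
by rewrite lfun_iterS NS.
Qed.

Lemma iter_lowers N M m k j x : lowers N M ->
  x \in M k -> j = k - m%:Z - m%:Z -> lfun_iter N m x \in M j.
Proof.
move=> NM xM ->; elim: m => [|m IH]; first by rewrite id_lfunE !subr0.
have -> : k - m.+1%:Z - m.+1%:Z = k - m%:Z - m%:Z - 2 by ilia.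
by rewrite lfun_iterS NM.
Qed.

(** In a representation of sl_2 centred at [u], a primitive vector of weight
    [u + m] is killed by [N ^ m.+1]. This power is injective on the weight
    [u + m] part of a representation with weights below [u], so primitive
    vectors, hence all vectors, map to zero in the latter. A descending
    induction on the weight replaces the primitive decomposition here. [D k]
    stands for the image of the vectors of degree [k], and [Q k] for the
    representatives of zero in that degree. *)
Lemma lefschetz_vanishing N (u : int) (D Q : int -> {vspace V}) :
  (exists k0, forall k x, k0 <= k -> x \in D k -> x \in Q k) ->
  lowers N D -> lowers N Q ->
  (forall (m : nat) y, y \in D (u - m%:Z) ->
     exists2 x, x \in D (u + m%:Z) & y - lfun_iter N m x \in Q (u - m%:Z)) ->
  (forall (m : nat) x, x \in D (u + m%:Z) ->
     lfun_iter N m.+1 x \in Q (u - m%:Z - 2) -> x \in Q (u + m%:Z)) ->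
  forall k x, x \in D k -> x \in Q k.
Proof.
move=> [k0 DQ0] ND NQ sur inj.
have up k : forall j, k <= j -> u <= j -> forall x, x \in D j -> x \in Q j.
  move: k; apply: (@int_ind_down _ k0) => k; first by move=> kk j kj _ x; apply: DQ0; ilia.
  move=> IH j; rewrite le_eqVlt => /orP[/eqP <- uj x xD|kj uj]; last by apply: IH; ilia.
  have [m Ek] : exists m : nat, k = u + m%:Z by exists (absz (k - u)); ilia.
  subst k; apply: inj => //.
  have Nx : lfun_iter N m.+1 x \in D (u - m.+2%:Z) by apply: (iter_lowers ND xD); ilia.
  have [z zD zQ] := sur _ _ Nx.
  have {}zD : z \in Q (u + m.+2%:Z) by apply: IH => //; ilia.
  rewrite -[lfun_iter _ _ _](subrK (lfun_iter N m.+2 z)); apply: memvD.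
    by have -> : u - m%:Z - 2 = u - m.+2%:Z by ilia.
  by apply: (iter_lowers NQ zD); ilia.
move=> k x xD; case: (leP u k) => [uk|ku]; first exact: (up k).
have [m Ek] : exists m : nat, k = u - m%:Z by exists (absz (k - u)); ilia.
subst k; have [z zD zQ] := sur _ _ xD.
rewrite -[x](subrK (lfun_iter N m z)); apply: memvD => //.
by apply: (iter_lowers NQ (k := u + m%:Z)); [apply: (up u) => //|]; ilia.
Qed.

(** The isomorphisms between graded pieces of a relative monodromy filtration
    are split into their two halves, since a subspace of [V] inherits
    injectivity but not surjectivity. *)
Definition lefschetz_inj N W M := forall (w : int) (m : nat) x,
  x \in M (w + m%:Z) -> x \in W w ->
  lfun_iter N m x \in gr_fil M W w (w - m%:Z - 1) ->
  x \in gr_fil M W w (w + m%:Z - 1).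

Definition lefschetz_sur N W M S := forall (w : int) (m : nat) y,
  y \in S -> y \in M (w - m%:Z) -> y \in W w ->
  exists x, [/\ x \in S, x \in M (w + m%:Z), x \in W w
              & y - lfun_iter N m x \in gr_fil M W w (w - m%:Z - 1)].

Lemma gr_filP M W w k x :
  reflect (exists a b, [/\ a \in M k, a \in W w, b \in W (w - 1) & x = a + b])
          (x \in gr_fil M W w k).
Proof.
apply: (iffP memv_addP) => [[a /memv_capP[aM aW] [b bW ->]]|[a [b [aM aW bW ->]]]].
  by exists a, b.
by exists a; [apply/memv_capP|exists b].
Qed.

End Filtrations.

(** * Distributive filtrations *)

Section Distributivity.
Context (K : fieldType) (V : vectType K) (W : int -> {vspace V}).
Context (Wf : finite_increasing W).
Implicit Types S T : {vspace V}.

(** The connecting map at level [u], for the sum map of [S] and [T], is zero. *)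
Definition dist_at S T (u : int) := forall x y,
  x \in S -> y \in T -> x \in W u -> y \in W u ->
  x + y \in W (u - 1) -> x + y \in (S :&: W (u - 1) + T :&: W (u - 1))%VS.

Lemma cap_addP S T v x :
  reflect (exists s t, [/\ s \in S, s \in W v, t \in T, t \in W v & x = s + t])
          (x \in (S :&: W v + T :&: W v)%VS).
Proof.
apply: (iffP memv_addP) => [[s /memv_capP[sS sW] [t /memv_capP[tT tW] ->]]|].
  by exists s, t.
by move=> [s [t [? ? ? ? ->]]]; exists s; [memv|exists t; memv].
Qed.

Lemma dist_below S T (u : int) : (forall v, v <= u -> dist_at S T v) ->
  forall v x y, x \in S -> y \in T -> x \in W u -> y \in W u -> x + y \in W v ->
    x + y \in (S :&: W v + T :&: W v)%VS.
Proof.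
move=> H v x y xS yT xW yW xyW.
case: (leP u v) => [uv|vu].
  by apply/cap_addP; exists x, y; split=> //; apply: (fil_incr Wf uv).
have [m Eu] : exists m : nat, u = v + m%:Z by exists (absz (u - v)); ilia.
elim: m u Eu H x y xS yT xW yW xyW {vu} => [|m IH] u Eu H x y xS yT xW yW xyW.
  by apply/cap_addP; exists x, y; have <- : u = v by ilia.
have := H _ (lexx u) x y xS yT xW yW.
have uE : u - 1 = v + m%:Z by ilia.
case/(_ _)/cap_addP; first by apply: (fil_incr Wf _ xyW); ilia.
move=> s [t [sS sW tT tW E]].
by rewrite E in xyW *; apply: (IH (u - 1)) => // w wu; apply: H; ilia.
Qed.

Lemma dist_all S T : (forall u, dist_at S T u) ->
  forall k x y, x \in S -> y \in T -> x + y \in W k ->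
  exists x' y', [/\ x' \in S, y' \in T, x' \in W k, y' \in W k & x' + y' = x + y].
Proof.
move=> H k x y xS yT xyW; have [u Wfull] := fil_full Wf.
have := @dist_below S T u (fun v _ => @H v) k x y xS yT
  (Wfull _ _ (lexx u)) (Wfull _ _ (lexx u)) xyW.
by case/cap_addP=> s [t [? ? ? ? ->]]; exists s, t.
Qed.

Lemma dist_ind S T : (forall u, (forall v, v <= u - 1 -> dist_at S T v) -> dist_at S T u) ->
  forall u, dist_at S T u.
Proof.
move=> step u; suff H w v : v <= w -> dist_at S T v by apply: (H u).
have [i0 W0] := fil_zero Wf.
move: w v; apply: (@int_ind_up _ i0) => [k ki v vk x y _ _ xW yW _|w IH v].
  by rewrite (W0 _ _ _ xW) ?(W0 _ _ _ yW) ?addr0 ?mem0v //; ilia.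
rewrite le_eqVlt => /orP[/eqP ->|vw]; last by apply: IH; ilia.
exact: step.
Qed.

End Distributivity.

Section StrictLattices.
Context (K : fieldType) (V : vectType K).
Implicit Types (M W : int -> {vspace V}) (S T : {vspace V}) (N : 'End(V)).
Implicit Types L : {vspace V} -> Prop.

(** [L] is thought of as the subspaces that carry an induced structure; then
    [sl_dist] is strictness for [M] of the sum map [S x T -> V]. *)
Record strict_lattice L M : Prop := StrictLattice {
  sl_cap : forall S T, L S -> L T -> L (S :&: T)%VS;
  sl_add : forall S T, L S -> L T -> L (S + T)%VS;
  sl_dist : forall k S T x y, L S -> L T -> x \in S -> y \in T ->
    x + y \in M k ->
    exists x' y', [/\ x' \in S, y' \in T, x' \in M k, y' \in M k & x' + y' = x + y]
}.

(** In a modular lattice, one form of distributivity for a triple of elements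
    implies the others. *)
Lemma sl_mod L M k S T x a t : strict_lattice L M -> L S -> L T ->
  x \in S -> a \in M k -> t \in T -> x = a + t ->
  exists a' t', [/\ a' \in M k, a' \in S, t' \in T, t' \in S & x = a' + t'].
Proof.
move=> sl LS LT xS aM tT E.
have aE : x + - t = a by rewrite E; zmod.
have [||x' [y' [x'S y'T x'M y'M E']]] := sl_dist (k := k) sl LS LT xS (y := - t).
- by rewrite memvN.
- by rewrite aE.
have ytS : y' + t \in S.
  have -> : y' + t = x - x' by apply: (@addrI _ x'); rewrite addrA E' aE E; zmod.
  by memv.
exists x', (y' + t); split; memv.
by rewrite addrA E' aE.
Qed.

(** The subspaces on which [M] induces the relative monodromy filtration of the
    restriction of [N] with respect to the one induced by [W] *)
Definition restrict_lattice N W M L S :=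
  [/\ L S, stable N S & lefschetz_sur N W M S].

Section Step.
Context (L : {vspace V} -> Prop) (M W : int -> {vspace V}) (N : 'End(V)).
Context (sl : strict_lattice L M).
Context (Mf : finite_increasing M) (Wf : finite_increasing W).
Context (LW : forall w, L (W w)) (NW : forall w, stable N (W w)).
Context (NM : lowers N M) (injN : lefschetz_inj N W M).

Local Notation LN := (restrict_lattice N W M L).

Section Pair.
Context (S T : {vspace V}) (LS : LN S) (LT : LN T).

Let LSW u : L (S :&: W u). Proof. by case: LS => LS' _ _; apply: (sl_cap sl). Qed.
Let LTW u : L (T :&: W u). Proof. by case: LT => LT' _ _; apply: (sl_cap sl). Qed.

Section Level.
Context (u : int) (IHu : forall v, v <= u - 1 -> dist_at W S T v).

Let Q := (S :&: W (u - 1) + T :&: W (u - 1))%VS.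
Let Q' k := (M (k - 1) :&: W (u - 1) + Q)%VS.
Let D k := ((S :&: W u :&: M k + T :&: W u :&: M k) :&: W (u - 1))%VS.

Let LQ : L Q. Proof. exact: (sl_add sl). Qed.

Let NQ : stable N Q.
Proof.
case: LS LT => [_ NS _] [_ NT _] _ /cap_addP[s [t [sS sW tT tW ->]]].
by rewrite linearD; apply/cap_addP; exists (N s), (N t); split; rewrite ?NW ?NS ?NT.
Qed.

Let MQ' k x : x \in M (k - 1) -> x \in W (u - 1) -> x \in Q' k.
Proof. by move=> xM xW; apply: (subvP (addvSl _ _)); memv. Qed.

Let QQ' k x : x \in Q -> x \in Q' k.
Proof. exact: (subvP (addvSr _ _)). Qed.

Let NQ' : lowers N Q'.
Proof.
move=> k _ /memv_addP[a /memv_capP[aM aW] [q qQ ->]]; rewrite linearD; apply: memvD.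
  apply: MQ'; last exact: NW.
  have -> : k - 2 - 1 = k - 1 - 2 by ilia.
  exact: NM.
exact/QQ'/NQ.
Qed.

(* Modulo [Q], the space [W (u - 1)] only has the weights [v < u], and for them
   [N ^ m.+1] is injective in degree [u + m >= v + m.+1]. *)
Let quotient_injective (m : nat) v x : v <= u - 1 -> x \in W v -> x \in M (u + m%:Z) ->
  lfun_iter N m.+1 x \in Q' (u - m%:Z - 2) -> x \in Q' (u + m%:Z).
Proof.
have [NS surS] : stable N S /\ lefschetz_sur N W M S by case: LS.
have [NT surT] : stable N T /\ lefschetz_sur N W M T by case: LT.
move: v x; have [i0 W0] := fil_zero Wf.
apply: (@int_ind_up _ i0) => [k ki x _ /(W0 _ _ ki) -> _ _|v IH x vu xW xM Nx].
  exact: mem0v.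
have [r vr] : exists r : nat, v + (r + m.+1)%N%:Z = u + m%:Z.
  by exists (absz (u + m%:Z - v - m.+1%:Z)%R); ilia.
have W_le y : y \in W v -> y \in W (u - 1) by apply: fil_incr.
have Nx_W : lfun_iter N m.+1 x \in W v by apply: iter_stable.
have Nx_M : lfun_iter N m.+1 x \in M (u - m%:Z - 2) by apply: (iter_lowers NM xM); ilia.
have [a /memv_capP[aM _] [q qQ Ex]] := memv_addP Nx.
have {a q qQ aM Ex}[a [q [aM aW qQ qW Ex]]] := sl_mod sl (LW v) LQ Nx_W aM qQ Ex.
have aM' : a \in M (u - m%:Z - 2) by apply: (fil_incr Mf _ aM); ilia.
have qM : q \in M (u - m%:Z - 2).
  have -> : q = lfun_iter N m.+1 x - a by rewrite Ex; zmod.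
  by memv.
have {qQ} : q \in (S :&: W v + T :&: W v)%VS.
  case/cap_addP: qQ qW => s [t [sS sW tT tW ->]] qW.
  by apply: (dist_below Wf IHu).
case/memv_addP=> s0 s0S [t0 t0T Eq].
rewrite Eq in qM.
have [s [t [/memv_capP[sS sW] /memv_capP[tT tW] sM tM Est]]] :=
  sl_dist sl (LSW v) (LTW v) s0S t0T qM.
pose n := (r + m.+1)%N.
have iterM z : z \in M (u - m%:Z - 2) -> lfun_iter N r z \in M (v - n%:Z).
  by move=> zM; apply: (iter_lowers NM zM); rewrite /n; ilia.
have [s1 [s1S s1M s1W Es1]] :=
  surS v n _ (iter_stable r NS sS) (iterM _ sM) (iter_stable r (@NW v) sW).
have [t1 [t1T t1M t1W Et1]] :=
  surT v n _ (iter_stable r NT tT) (iterM _ tM) (iter_stable r (@NW v) tW).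
have /gr_filP[b [x' [bM bW x'W Ex']]] : x - s1 - t1 \in gr_fil M W v (v + n%:Z - 1).
  apply: injN; memv; first by rewrite vr.
  have -> : lfun_iter N n (x - s1 - t1) = lfun_iter N r a
      + (lfun_iter N r s - lfun_iter N n s1) + (lfun_iter N r t - lfun_iter N n t1).
    have NxE : lfun_iter N n x = lfun_iter N r a + (lfun_iter N r s + lfun_iter N r t).
      by rewrite /n lfun_iterD Ex Eq -Est !linearD.
    rewrite !linearB /= NxE; zmod.
  apply: memvD => //; apply: memvD => //.
  apply/gr_filP; exists (lfun_iter N r a), 0; split; rewrite ?addr0 ?mem0v //.
    by apply: (iter_lowers NM aM); ilia.
  exact: iter_stable.
rewrite vr in s1M t1M bM.
have s1t1Q : s1 + t1 \in Q.
  by apply/cap_addP; exists s1, t1; split=> //; apply: W_le.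
have bQ' : b \in Q' (u + m%:Z) by apply: MQ' => //; apply: W_le.
have -> : x = x' + b + (s1 + t1).
  by have -> : x = (x - s1 - t1) + (s1 + t1); [zmod|rewrite Ex'; zmod].
apply: memvD; last exact: QQ'.
apply: memvD => //.
have x'E : x' = x - s1 - t1 - b by rewrite Ex'; zmod.
apply: IH => //; first by ilia.
  rewrite x'E; memv.
  by apply: (fil_incr Mf _ bM); ilia.
have -> : lfun_iter N m.+1 x' = lfun_iter N m.+1 x - lfun_iter N m.+1 (s1 + t1)
    - lfun_iter N m.+1 b by rewrite x'E; lzmod.
apply: memvB; first apply: memvB => //.
  by apply: QQ'; apply: iter_stable.
by apply: (iter_lowers NQ' bQ'); ilia.
Qed.

(* [D] represents the intersection of the images of [S] and [T] in the graded
   piece of weight [u]; surjectivity passes to the intersection because [N ^ m]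
   is injective on the graded piece. *)
Let source_surjective (m : nat) y : y \in D (u - m%:Z) ->
  exists2 x, x \in D (u + m%:Z) & y - lfun_iter N m x \in Q' (u - m%:Z).
Proof.
have [LS' NS surS] := LS; have [LT' NT surT] := LT.
case/memv_capP=> /memv_addP[s /memv_capP[/memv_capP[sS sW] sM]].
move=> [t /memv_capP[/memv_capP[tT tW] tM] ->] stW.
have split_sur X z x : L X -> stable N X ->
    z \in X -> z \in W u -> x \in X -> x \in M (u + m%:Z) -> x \in W u ->
    z - lfun_iter N m x \in gr_fil M W u (u - m%:Z - 1) ->
    exists b c, [/\ b \in M (u - m%:Z - 1), b \in X, c \in X, c \in W (u - 1)
                  & z = lfun_iter N m x + b + c].
  move=> LX NX zX zW xX xM xW /gr_filP[b0 [c0 [b0M b0W c0W E]]].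
  have zxX : z - lfun_iter N m x \in X by memv; apply: iter_stable.
  have [b [c [bM bX cT cX E']]] := sl_mod sl LX (LW (u - 1)) zxX b0M c0W E.
  by exists b, c; split=> //; rewrite -addrA -E'; zmod.
have [s1 [s1S s1M s1W /(split_sur _ _ _ LS' NS sS sW s1S s1M s1W)]] := surS _ _ _ sS sM sW.
move=> [b1 [c1 [b1M b1S c1S c1W Es]]].
have [t1 [t1T t1M t1W /(split_sur _ _ _ LT' NT tT tW t1T t1M t1W)]] := surT _ _ _ tT tM tW.
move=> [b2 [c2 [b2M b2T c2T c2W Et]]].
have W_le z : z \in W (u - 1) -> z \in W u by apply: fil_incr Wf _; ilia.
have b12W : b1 + b2 \in W u.
  have -> : b1 + b2 = s + t - lfun_iter N m (s1 + t1) - (c1 + c2).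
    by rewrite Es Et; lzmod.
  memv; try exact: W_le.
  by apply: iter_stable; memv.
have /gr_filP[a [c [aM aW cW E]]] : s1 + t1 \in gr_fil M W u (u + m%:Z - 1).
  apply: injN; memv.
  apply/gr_filP; exists (- (b1 + b2)), (s + t - (c1 + c2)); split; memv.
  by rewrite Es Et; lzmod.
(* [a] lies in [S_u + T_u + W_(u-1)], a sum of three elements of the lattice,
   so it is distributed over them within [M]. *)
have LST : L (S :&: W u + T :&: W u)%VS by apply: (sl_add sl).
have s1t1 : s1 + t1 \in (S :&: W u + T :&: W u)%VS.
  by apply/cap_addP; exists s1, t1.
have Ea : (s1 + t1) + - c = a by rewrite E; zmod.
have [|| q [c' [qST c'W qM c'M Eqc]]] :=
  sl_dist (k := u + m%:Z - 1) sl LST (LW (u - 1)) s1t1 (y := - c).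
- by rewrite memvN.
- by rewrite Ea.
have [s0 s0S [t0 t0T Eq]] := memv_addP qST; rewrite Eq in qM.
have {s0 s0S t0 t0T Eq qM}[a1 [a2 [/memv_capP[a1S a1W] /memv_capP[a2T a2W] a1M a2M Eq]]] :
  exists s t, [/\ s \in (S :&: W u)%VS, t \in (T :&: W u)%VS,
    s \in M (u + m%:Z - 1), t \in M (u + m%:Z - 1) & q = s + t].
  have [s' [t' [? ? ? ? E']]] := sl_dist sl (LSW u) (LTW u) s0S t0T qM.
  by exists s', t'; rewrite E'.
have M_le z : z \in M (u + m%:Z - 1) -> z \in M (u + m%:Z) by apply: fil_incr Mf _; ilia.
have dW : (s1 - a1) + (t1 - a2) \in W (u - 1).
  have -> : (s1 - a1) + (t1 - a2) = c + c'.
    have -> : c' = a - q by rewrite -Ea -Eqc; zmod.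
    by rewrite Eq; apply: (addIr (a1 + a2)); rewrite -[RHS]addrA subrK addrC -E; zmod.
  by memv.
exists ((s1 - a1) + (t1 - a2)).
  apply/memv_capP; split=> //; apply: memv_add; memv; exact: M_le.
pose e := b1 + b2 + lfun_iter N m (a1 + a2).
have -> : s + t - lfun_iter N m (s1 - a1 + (t1 - a2)) = e + (c1 + c2).
  by rewrite /e Es Et; lzmod.
have cQ : c1 + c2 \in Q by apply/cap_addP; exists c1, c2.
apply: memvD; last exact: QQ'.
apply: MQ'.
  rewrite /e; memv; apply: (iter_lowers (k := u + m%:Z - 1) NM); memv; ilia.
have -> : e = s + t - lfun_iter N m (s1 - a1 + (t1 - a2)) - (c1 + c2).
  by rewrite /e Es Et; lzmod.
by memv; apply: iter_stable.
Qed.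

Let D_lowers : lowers N D.
Proof.
have [LS' NS surS] := LS; have [LT' NT surT] := LT.
move=> k _ /memv_capP[/memv_addP[s /memv_capP[/memv_capP[sS sW] sM]
  [t /memv_capP[/memv_capP[tT tW] tM] ->]] stW].
apply/memv_capP; split; last exact: NW.
rewrite linearD; apply: memv_add; memv; do ?[exact: NS|exact: NT|exact: NW|exact: NM].
Qed.

Lemma restrict_dist_step : dist_at W S T u.
Proof.
have [LS' _ _] := LS; have [LT' _ _] := LT.
have D_Q' : forall k x, x \in D k -> x \in Q' k.
  have [k0 Mfull] := fil_full Mf.
  apply: (lefschetz_vanishing (u := u) (N := N)) => //.
    by exists (k0 + 1) => k x kk /memv_capP[_ xW]; apply: MQ' => //; apply: Mfull; ilia.
  move=> m x /memv_capP[/memv_addP[s /memv_capP[_ sM] [t /memv_capP[_ tM] ->]]] stW.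
  by apply: quotient_injective stW _ => //; memv.
(* [D k] lies in [D (k - 1) + Q]: the connecting map is strict for [M]. *)
have D_Q : forall k x, x \in D k -> x \in Q.
  have [i0 M0] := fil_zero Mf.
  apply: (@int_ind_up _ i0) => [k ki _ /memv_capP[/memv_addP[s sM [t tM ->]] _]|k IH x xD].
    have -> : s = 0 by case/memv_capP: sM => _; apply: M0.
    have -> : t = 0 by case/memv_capP: tM => _; apply: M0.
    by rewrite addr0 mem0v.
  have [a /memv_capP[aM aW] [q qQ E]] := memv_addP (D_Q' _ _ xD).
  rewrite E; apply: memvD => //; apply: (IH); apply/memv_capP; split=> //.
  have W_le z : z \in W (u - 1) -> z \in W u by apply: fil_incr Wf _; ilia.
  have : a \in (S :&: W u + T :&: W u)%VS.
    have -> : a = x - q by rewrite E; zmod.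
    apply: memvB.
      case/memv_capP: xD => /memv_addP[s /memv_capP[sS _] [t /memv_capP[tT _] ->]] _.
      exact: memv_add.
    by apply/cap_addP; case/cap_addP: qQ => s [t [? ? ? ? ->]]; exists s, t;
      split=> //; apply: W_le.
  case/memv_addP=> s sS [t tT Ea]; rewrite Ea in aM *.
  have [s' [t' [? ? ? ? <-]]] := sl_dist sl (LSW u) (LTW u) sS tT aM.
  by apply: memv_add; apply/memv_capP.
move=> x y xS yT xW yW xyW.
have [k0 Mfull] := fil_full Mf.
apply: (D_Q k0); apply/memv_capP; split=> //; apply: memv_add; memv; exact: Mfull.
Qed.

End Level.

Lemma restrict_dist_at u : dist_at W S T u.
Proof. by move: u; apply: (dist_ind Wf) => u; apply: restrict_dist_step. Qed.

Lemma restrict_dist k x y : x \in S -> y \in T -> x + y \in W k ->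
  exists x' y', [/\ x' \in S, y' \in T, x' \in W k, y' \in W k & x' + y' = x + y].
Proof. exact: (dist_all Wf restrict_dist_at). Qed.

Lemma restrict_add : LN (S + T)%VS.
Proof.
have [LS' NS surS] := LS; have [LT' NT surT] := LT.
split; first exact: (sl_add sl).
  by move=> _ /memv_addP[s sS [t tT ->]]; rewrite linearD; apply: memv_add; [exact: NS|exact: NT].
move=> w m _ /memv_addP[s0 s0S [t0 t0T ->]] yM yW.
have [s1 [t1 [s1S t1T s1W t1W E1]]] := restrict_dist s0S t0T yW.
rewrite -E1 in yM *.
have s1c : s1 \in (S :&: W w)%VS by memv.
have t1c : t1 \in (T :&: W w)%VS by memv.
have [s [t [/memv_capP[sS sW] /memv_capP[tT tW] sM tM <-]]] :=
  sl_dist sl (LSW w) (LTW w) s1c t1c yM.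
have [s' [s'S s'M s'W Es]] := surS _ _ _ sS sM sW.
have [t' [t'T t'M t'W Et]] := surT _ _ _ tT tM tW.
exists (s' + t'); split; memv; first exact: memv_add.
have -> : s + t - lfun_iter N m (s' + t')
  = (s - lfun_iter N m s') + (t - lfun_iter N m t') by lzmod.
exact: memvD.
Qed.

Lemma restrict_cap : LN (S :&: T)%VS.
Proof.
have [LS' NS surS] := LS; have [LT' NT surT] := LT.
split; first exact: (sl_cap sl).
  by move=> x /memv_capP[xS xT]; memv; [exact: NS|exact: NT].
move=> w m y /memv_capP[yS yT] yM yW.
have [s [sS sM sW Es]] := surS _ _ _ yS yM yW.
have [t [tT tM tW Et]] := surT _ _ _ yT yM yW.
have /gr_filP[a [b [aM aW bW E]]] : s - t \in gr_fil M W w (w + m%:Z - 1).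
  apply: injN; memv.
  have -> : lfun_iter N m (s - t) = (y - lfun_iter N m t) - (y - lfun_iter N m s).
    by lzmod.
  exact: memvB.
have M_le z : z \in M (w + m%:Z - 1) -> z \in M (w + m%:Z) by apply: fil_incr Mf _; ilia.
have bM : b \in M (w + m%:Z).
  by have -> : b = s - t - a; [rewrite E; zmod|memv; exact: M_le].
(* The error [a] in [M] is distributed over [S] and [T] first, then the
   remaining error in [W (w - 1)]. *)
have LST : L (S :&: W w + T :&: W w)%VS by apply: (sl_add sl).
have stST : s - t \in (S :&: W w + T :&: W w)%VS.
  by apply: memv_add; memv.
have Eba : (s - t) + - b = a by rewrite E; zmod.
have [|| q [b' [qST b'W qM b'M Eqb]]] :=
  sl_dist (k := w + m%:Z - 1) sl LST (LW (w - 1)) stST (y := - b).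
- by rewrite memvN.
- by rewrite Eba.
have [s0 s0S [t0 t0T Eq]] := memv_addP qST; rewrite Eq in qM.
have [a1 [a2 [/memv_capP[a1S a1W] /memv_capP[a2T a2W] a1M a2M Ea]]] :=
  sl_dist sl (LSW w) (LTW w) s0S t0T qM.
have dW : (s - a1) + (- t - a2) \in W (w - 1).
  have -> : (s - a1) + (- t - a2) = b + b'.
    have -> : b' = a - q by rewrite -Eba -Eqb; zmod.
    by rewrite Eq -Ea -[s - a1](subrK t) -addrA; apply: (addIr (a1 + a2));
      rewrite -[RHS]addrA subrK [RHS]addrC -E; zmod.
  by memv.
have /cap_addP[c1 [c2 [c1S c1W c2T c2W Ec]]] :
    (s - a1) + (- t - a2) \in (S :&: W (w - 1) + T :&: W (w - 1))%VS.
  by apply: (restrict_dist_at (u := w)) => //; memv.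
have cM : c1 + c2 \in M (w + m%:Z) by rewrite -Ec; memv; exact: M_le.
have c1c : c1 \in (S :&: W (w - 1))%VS by memv.
have c2c : c2 \in (T :&: W (w - 1))%VS by memv.
have [d1 [d2 [/memv_capP[d1S d1W] /memv_capP[d2T d2W] d1M d2M Ed]]] :=
  sl_dist sl (LSW (w - 1)) (LTW (w - 1)) c1c c2c cM.
have W_le z : z \in W (w - 1) -> z \in W w by apply: fil_incr Wf _; ilia.
have zE : s - a1 - d1 = t + a2 + d2.
  by apply: (addIr (d1 - t - a2)); transitivity (s - a1 + (- t - a2));
    [|rewrite Ec -Ed]; zmod.
exists (s - a1 - d1); split.
- by apply/memv_capP; split; [|rewrite zE]; memv.
- by memv; exact: M_le.
- by memv; exact: W_le.
have -> : y - lfun_iter N m (s - a1 - d1)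
  = (y - lfun_iter N m s) + lfun_iter N m (a1 + d1) by lzmod.
apply: memvD => //; rewrite linearD; apply/gr_filP.
exists (lfun_iter N m a1), (lfun_iter N m d1); split=> //.
- by apply: (iter_lowers NM a1M); ilia.
- exact: iter_stable.
- exact: iter_stable.
Qed.

End Pair.

(** For [x + y] in [W_(u - 1)] with [x] in [S_u] and [y] in [T_u], the class of
    [x + y] modulo [S_(u - 1) + T_(u - 1)] is the value of a connecting map from
    a space pure of weight [u] to one of weights below [u]. It vanishes on each
    graded piece of [M] by [lefschetz_vanishing], hence it vanishes, since it is
    strict for [M] by the distributivity of [M]. *)
Theorem strict_lattice_step : strict_lattice LN W.
Proof.
split=> [S T LS LT|S T LS LT|k S T x y LS LT].
- exact: restrict_cap.
- exact: restrict_add.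
- exact: restrict_dist.
Qed.

End Step.
End StrictLattices.

(** * Relative monodromy filtrations *)

Section RelativeMonodromy.
Context (K : fieldType).

Section OneSpace.
Context (V : vectType K).
Implicit Types (M W : int -> {vspace V}) (S : {vspace V}) (N : 'End(V)).

Lemma gr_fil_sub M W w k x :
  finite_increasing W -> x \in gr_fil M W w k -> x \in W w.
Proof.
move=> Wf /gr_filP[a [b [_ aW bW ->]]]; memv.
by apply: (fil_incr Wf _ bW); ilia.
Qed.

Lemma gr_fil_lowers N M W w k j m x :
  lowers N M -> (forall w, stable N (W w)) ->
  x \in gr_fil M W w k -> j = k - m%:Z - m%:Z ->
  lfun_iter N m x \in gr_fil M W w j.
Proof.
move=> NM NW /gr_filP[a [b [aM aW bW ->]]] Ej; rewrite linearD.
apply/gr_filP; exists (lfun_iter N m a), (lfun_iter N m b); split=> //.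
- exact: (iter_lowers NM aM).
- exact: iter_stable.
- exact: iter_stable.
Qed.

Lemma gr_filM M W w k x : x \in M k -> x \in W w -> x \in gr_fil M W w k.
Proof. by move=> xM xW; apply/gr_filP; exists x, 0; rewrite addr0 mem0v. Qed.

Lemma gr_filW M W w k x : x \in W (w - 1) -> x \in gr_fil M W w k.
Proof. exact: (subvP (addvSr _ _)). Qed.

(** Elements of [M k] and [W w] represent all classes in [gr_fil M W w k]. *)
Lemma relative_monodromyE N W M : (forall w, stable N (W w)) ->
  is_relative_monodromy N W M <->
  [/\ finite_increasing M, lowers N M, lefschetz_inj N W M & lefschetz_sur N W M fullv].
Proof.
move=> NW; split.
  case=> Mf /lowersP NM iso; split=> // w m x.
    move=> xM xW NxG; case: (iso w m) => _ _ inj _.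
    by apply: inj => //; apply: gr_filM.
  move=> _ xM xW; case: (iso w m) => _ _ _ /(_ x) [|z]; first exact: gr_filM.
  case/gr_filP=> a [b [aM aW bW ->]] xG; exists a; split=> //; first exact: memvf.
  have -> : x - lfun_iter N m a = (x - lfun_iter N m (a + b)) + lfun_iter N m b by lzmod.
  by apply: memvD => //; apply: gr_filW; apply: iter_stable.
case=> Mf NM inj sur; split=> //; first exact/lowersP.
move=> w m; split.
- apply/subvP=> _ /memv_imgP[x xG ->]; apply: (gr_fil_lowers NM NW xG); ilia.
- apply/subvP=> _ /memv_imgP[x xG ->]; apply: (gr_fil_lowers NM NW xG); ilia.
- move=> _ /gr_filP[a [b [aM aW bW ->]]] NabG.
  apply: memvD; last exact: gr_filW.
  apply: inj => //.
  have -> : lfun_iter N m a = lfun_iter N m (a + b) - lfun_iter N m b by lzmod.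
  by apply: memvB => //; apply: gr_filW; apply: iter_stable.
move=> _ /gr_filP[a [b [aM aW bW ->]]].
have [x [_ xM xW xG]] := sur w m a (memvf a) aM aW.
exists x; first exact: gr_filM.
have -> : a + b - lfun_iter N m x = (a - lfun_iter N m x) + b by lzmod.
by apply: memvD => //; apply: gr_filW.
Qed.

(** The bound on [p] makes [N ^ p] injective on all graded pieces of weight at
    most [v], by comparison with the power of [N] centred at each of them. *)
Lemma lefschetz_inj_below N W M p v k x :
  finite_increasing W -> finite_increasing M ->
  (forall w, stable N (W w)) -> lowers N M -> lefschetz_inj N W M ->
  v + p%:Z <= k -> x \in W v -> x \in M k ->
  lfun_iter N p x \in M (k - p%:Z - p%:Z - 1) -> x \in M (k - 1).
Proof.
move=> Wf Mf NW NM inj; have [i0 W0] := fil_zero Wf.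
move: v x; apply: (@int_ind_up _ i0) => [v vi x _ /(W0 _ _ vi) -> _ _|v IH x vk xW xM NxM].
  exact: mem0v.
have [r vr] : exists r : nat, v + (r + p)%N%:Z = k.
  by exists (absz (k - v - p%:Z)%R); ilia.
have /gr_filP[a [b [aM aW bW E]]] : x \in gr_fil M W v (v + (r + p)%N%:Z - 1).
  apply: inj; rewrite ?vr //; apply: gr_filM; last exact: iter_stable.
  by rewrite lfun_iterD; apply: (iter_lowers NM NxM); ilia.
rewrite vr in aM; rewrite E; apply: memvD => //.
have bE : b = x - a by rewrite E; zmod.
have aM' : a \in M k by apply: (fil_incr Mf _ aM); ilia.
apply: IH => //; [ilia|by rewrite bE; memv|].
have -> : lfun_iter N p b = lfun_iter N p x - lfun_iter N p a by rewrite bE; lzmod.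
by memv; apply: (iter_lowers NM aM); ilia.
Qed.

(** Here all remainders lie in [S]: this is the condition for the restrictions
    to [S], see [relative_monodromy_pullback]. *)
Definition gr_on S M W w k := (S :&: (M k :&: W w) + S :&: W (w - 1))%VS.

Definition relmon_on N W M S := forall (w : int) (m : nat),
  (forall x, x \in S -> x \in M (w + m%:Z) -> x \in W w ->
     lfun_iter N m x \in gr_on S M W w (w - m%:Z - 1) ->
     x \in gr_on S M W w (w + m%:Z - 1)) /\
  (forall y, y \in S -> y \in M (w - m%:Z) -> y \in W w ->
     exists x, [/\ x \in S, x \in M (w + m%:Z), x \in W w
                 & y - lfun_iter N m x \in gr_on S M W w (w - m%:Z - 1)]).

Lemma gr_on_sub S M W w k x : x \in gr_on S M W w k -> x \in gr_fil M W w k.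
Proof. by apply/subvP/addvS; apply: capvSr. Qed.

(** For [S] in the lattice, the filtrations that [M] induces on [S] and on the
    graded pieces of [W] agree, so that a remainder of an element of [S] can be
    taken in [S]. *)
Lemma gr_on_sl L S M W w k x : strict_lattice L M -> finite_increasing W ->
  L S -> L (W (w - 1)) ->
  x \in S -> x \in gr_fil M W w k -> x \in gr_on S M W w k.
Proof.
move=> sl Wf LS LW xS xG; have xW := gr_fil_sub Wf xG.
case/gr_filP: xG => a [b [aM _ bW /(sl_mod sl LS LW xS aM bW)]].
move=> [a' [b' [a'M a'S b'W b'S E]]].
have b'W' : b' \in W w by apply: (fil_incr Wf _ b'W); ilia.
have a'W : a' \in W w.
  have -> : a' = x - b' by rewrite E; zmod.
  by memv.
by rewrite E; apply: memv_add; memv.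
Qed.

Lemma lefschetz_sur_relmon_on L N W M S : strict_lattice L M -> finite_increasing W ->
  (forall w, L (W w)) -> (forall w, stable N (W w)) -> L S -> stable N S ->
  lefschetz_inj N W M -> lefschetz_sur N W M S -> relmon_on N W M S.
Proof.
move=> sl Wf LW NW LS NS inj sur w m; split.
  move=> x xS xM xW /gr_on_sub xG; apply: (gr_on_sl sl) => //; exact: inj.
move=> y yS yM yW; have [x [xS xM xW xG]] := sur _ _ _ yS yM yW.
exists x; split=> //; apply: (gr_on_sl sl) => //.
by memv; apply: iter_stable.
Qed.

Lemma relmon_on_lefschetz_sur N W M S : relmon_on N W M S -> lefschetz_sur N W M S.
Proof.
move=> H w m y yS yM yW; have [x [xS xM xW /gr_on_sub xG]] := (H w m).2 y yS yM yW.
by exists x.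
Qed.

End OneSpace.

Section Pullback.
Context (V X : vectType K) (j : 'Hom(X, V)) (j_inj : injective j).
Context (N : 'End(V)) (M W : int -> {vspace V}).
Context (NX : 'End(X)) (MX WX : int -> {vspace X}).
Context (jN : forall x, j (NX x) = N (j x)).
Context (jM : forall k x, (x \in MX k) = (j x \in M k)).
Context (jW : forall k x, (x \in WX k) = (j x \in W k)).

Lemma pullback_iter m x : j (lfun_iter NX m x) = lfun_iter N m (j x).
Proof.
elim: m => [|m IH]; first by rewrite !id_lfunE.
by rewrite !lfun_iterS jN IH.
Qed.

Lemma pullback_increasing : finite_increasing M -> finite_increasing MX.
Proof.
move=> Mf; split.
- by move=> a b ab; apply/subvP=> x; rewrite !jM; apply: fil_incr.
- have [i M0] := fil_zero Mf; exists i; apply/eqP; rewrite -subv0.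
  apply/subvP=> x; rewrite jM memv0 => /(M0 _ _ (lexx i)).
  by rewrite -(linear0 j) => /j_inj ->.
have [i M0] := fil_full Mf; exists i; apply/eqP.
by rewrite eqEsubv subvf; apply/subvP=> x _; rewrite jM M0.
Qed.

Lemma pullback_gr w k x :
  (x \in gr_fil MX WX w k) = (j x \in gr_on (limg j) M W w k).
Proof.
have memj z : j z \in limg j by apply/memv_img/memvf.
apply/gr_filP/memv_addP.
  move=> [a [b [aM aW bW ->]]]; rewrite linearD.
  by exists (j a); [|exists (j b) => //]; rewrite !memv_cap -?jM -?jW ?memj ?aM ?aW ?bW.
case=> a' /memv_capP[/memv_imgP[a _ ->] /memv_capP[aM aW]].
case=> b' /memv_capP[/memv_imgP[b _ ->] bW]; rewrite -linearD => /j_inj ->.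
by exists a, b; rewrite jM !jW.
Qed.

Lemma relative_monodromy_pullback :
  finite_increasing M -> lowers N M -> (forall w, stable N (W w)) ->
  is_relative_monodromy NX WX MX <-> relmon_on N W M (limg j).
Proof.
move=> Mf NM NW.
have memj z : j z \in limg j by apply/memv_img/memvf.
rewrite relative_monodromyE; last by move=> w x; rewrite !jW jN; apply: NW.
split.
  case=> _ _ inj sur w m; split.
    by move=> _ /memv_imgP[x _ ->]; rewrite -jM -jW -pullback_iter -!pullback_gr; apply: inj.
  move=> _ /memv_imgP[y _ ->]; rewrite -jM -jW => yM yW.
  have [x [_ xM xW xG]] := sur w m y (memvf y) yM yW.
  exists (j x); rewrite memj -jM -jW -pullback_iter -linearB -pullback_gr.
  by split.
move=> H; split; first exact: pullback_increasing.
- by move=> k x; rewrite !jM jN; apply: NM.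
- move=> w m x; rewrite jM jW !pullback_gr pullback_iter.
  by apply: (H w m).1.
move=> w m y _; rewrite jM jW => yM yW.
have [x' [/memv_imgP[x _ ->] xM xW xG]] := (H w m).2 (j y) (memj y) yM yW.
exists x; rewrite memvf jM jW pullback_gr linearB /= pullback_iter.
by split.
Qed.

End Pullback.

(** A map that raises the weights of [M] by at most [s.+1] raises them by at most
    [s], because the map that it induces from degree [k] to degree [k + s.+1]
    of the graded pieces vanishes by [lefschetz_vanishing]. In particular the
    relative monodromy filtration is unique. *)
Theorem relative_monodromy_functorial (A B : vectType K) (f : 'Hom(A, B))
    NA WA MA NB WB MB :
  (forall w, stable NA (WA w)) -> (forall w, stable NB (WB w)) ->
  finite_increasing WA -> finite_increasing WB ->
  is_relative_monodromy NA WA MA -> is_relative_monodromy NB WB MB ->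
  (forall x, f (NA x) = NB (f x)) ->
  (forall w x, x \in WA w -> f x \in WB w) ->
  forall k x, x \in MA k -> f x \in MB k.
Proof.
move=> NWA NWB WAf WBf /(relative_monodromyE _ NWA)[MAf NMA _ surA].
move=> /(relative_monodromyE _ NWB)[MBf NMB injB _] fN fW.
have fiter := pullback_iter fN.
have [i0 MA0] := fil_zero MAf; have [i1 MB1] := fil_full MBf.
have [r R0] : exists r : nat, forall k x, x \in MA k -> f x \in MB (k + r%:Z).
  exists (absz (i1 - i0)%R) => k x xM; case: (leP k i0) => [ki|ik].
    by rewrite (MA0 _ _ ki xM) linear0 mem0v.
  by apply: MB1; ilia.
suff step (s : nat) : (forall k x, x \in MA k -> f x \in MB (k + s.+1%:Z)) ->
    forall k x, x \in MA k -> f x \in MB (k + s%:Z).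
  elim: r R0 => [|r IH /step/IH //] R0 k x /R0.
  by rewrite addr0.
move=> {r R0} R.
suff H w k x : x \in WA w -> x \in MA k -> f x \in MB (k + s%:Z).
  by have [i WA1] := fil_full WAf => k x; apply: (H i); apply: WA1.
have [j0 WA0] := fil_zero WAf.
move: w k x; apply: (@int_ind_up _ j0) => [w wj k x /(WA0 _ _ wj) -> _|w IH k x xW xM].
  by rewrite linear0 mem0v.
pose D k := (f @: (MA k :&: WA w))%VS; pose Q k := MB (k + s%:Z).
apply: (@lefschetz_vanishing _ _ NB w D Q) => //.
- by exists (i1 - s%:Z) => l z il _; apply: MB1; ilia.
- move=> l _ /memv_imgP[z /memv_capP[zM zW] ->]; rewrite -fN.
  by apply: memv_img; memv; [apply: NMA|apply: NWA].
- move=> l z; rewrite /Q; have -> : l - 2 + s%:Z = l + s%:Z - 2 by ilia.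
  exact: NMB.
- move=> m _ /memv_imgP[z /memv_capP[zM zW] ->].
  have [y [_ yM yW /gr_filP[a [b [aM aW bW E]]]]] := surA _ _ _ (memvf z) zM zW.
  exists (f y); first by apply: memv_img; memv.
  rewrite -fiter -linearB E linearD; apply: memvD.
    rewrite /Q; have -> : w - m%:Z + s%:Z = w - m%:Z - 1 + s.+1%:Z by ilia.
    exact: R.
  apply: IH => //; have -> : b = z - lfun_iter NA m y - a by rewrite E; zmod.
  memv; first by apply: (iter_lowers NMA yM); ilia.
  by apply: (fil_incr MAf _ aM); ilia.
- move=> m _ /memv_imgP[z /memv_capP[zM zW] ->] NzQ; rewrite /Q.
  have -> : w + m%:Z + s%:Z = w + m%:Z + s.+1%:Z - 1 by ilia.
  apply: (lefschetz_inj_below (p := m.+1) (v := w) WBf MBf NWB NMB injB); first ilia.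
  + exact: fW.
  + exact: R.
  by move: NzQ; rewrite /Q; congr (_ \in MB _); ilia.
by apply: memv_img; memv.
Qed.

Section Quotient.
Context (V X : vectType K) (q : 'Hom(V, X)) (q_surj : limg q = fullv).
Context (L : {vspace V} -> Prop) (M : int -> {vspace V}) (MX : int -> {vspace X}).
Context (sl : strict_lattice L M) (qM : forall k, MX k = (q @: M k)%VS).

Lemma surj_preimage x : exists v, x = q v.
Proof.
have /memv_imgP[v _ ->] : x \in limg q by rewrite q_surj memvf.
by exists v.
Qed.

Lemma preim_add (S T : {vspace X}) : (q @^-1: (S + T) = q @^-1: S + q @^-1: T)%VS.
Proof.
apply/eqP; rewrite eqEsubv; apply/andP; split; apply/subvP=> v.
  rewrite -memv_preim => /memv_addP[s sS [t tT]].
  have [s' Es] := surj_preimage s; rewrite {}Es in sS * => E.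
  apply/memv_addP; exists s'; first by rewrite -memv_preim.
  exists (v - s'); last by zmod.
  by rewrite -memv_preim linearB /= E; have -> : q s' + t - q s' = t by zmod.
move=> /memv_addP[s sS [t tT ->]]; rewrite -memv_preim linearD.
by apply: memv_add; rewrite memv_preim.
Qed.

Lemma preim_cap (S T : {vspace X}) :
  (q @^-1: (S :&: T) = q @^-1: S :&: q @^-1: T)%VS.
Proof. by apply/vspaceP=> v; rewrite memv_cap -!memv_preim memv_cap. Qed.

Lemma preim_img (U : {vspace V}) : (q @^-1: (q @: U) = U + lker q)%VS.
Proof.
apply/eqP; rewrite eqEsubv; apply/andP; split; apply/subvP=> v.
  rewrite -memv_preim => /memv_imgP[u uU E].
  apply/memv_addP; exists u => //; exists (v - u); last by zmod.
  by rewrite memv_ker linearB /= E subrr.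
case/memv_addP=> u uU [k]; rewrite memv_ker => /eqP qk ->.
by rewrite -memv_preim linearD /= qk addr0 memv_img.
Qed.

Lemma quotient_strict_lattice : strict_lattice (fun S => L (q @^-1: S)%VS) MX.
Proof.
split=> [S T LS LT|S T LS LT|k S T x y LS LT xS yT].
- by rewrite preim_cap; apply: (sl_cap sl).
- by rewrite preim_add; apply: (sl_add sl).
rewrite qM => /memv_imgP[m mM E].
have [s' Es] := surj_preimage x; subst x.
have s'S : s' \in (q @^-1: S)%VS by rewrite -memv_preim.
have t'T : m - s' \in (q @^-1: T)%VS.
  rewrite -memv_preim linearB /= -E; have -> : q s' + y - q s' = y by zmod.
  by [].
have Em : s' + (m - s') = m by zmod.
have [|s [t [sS tT sM tM Est]]] := sl_dist (k := k) sl LS LT s'S t'T.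
  by rewrite Em.
exists (q s), (q t); split; rewrite -?memv_preim ?memv_img //;
  rewrite ?memv_preim //.
by rewrite E -linearD Est Em.
Qed.

Context (W : int -> {vspace V}) (WX : int -> {vspace X}).
Context (N : 'End(V)) (NX : 'End(X)).
Context (qW : forall k, WX k = (q @: W k)%VS) (qN : forall v, q (N v) = NX (q v)).
Context (Mf : finite_increasing M) (Wf : finite_increasing W).
Context (LW : forall w, L (W w)) (NW : forall w, stable N (W w)).
Context (NM : lowers N M) (injN : lefschetz_inj N W M).
Context (LJ : restrict_lattice N W M L (lker q)).

(** By distributivity, the lifts to [W w] and to [M k] may be taken equal. *)
Lemma quotient_lift w k x : x \in WX w -> x \in MX k ->
  exists v, [/\ v \in W w, v \in M k & x = q v].
Proof.
rewrite qW qM => /memv_imgP[v vW ->] /memv_imgP[m mM E].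
have LJ' : L (lker q) by case: LJ.
have dJ : v - m \in lker q by rewrite memv_ker linearB /= E subrr.
have Ev : v = m + (v - m) by zmod.
have [m' [j' [m'M m'W j'J _ Ev']]] := sl_mod sl (LW w) LJ' vW mM dJ Ev.
exists m'; split=> //; move: j'J; rewrite memv_ker => /eqP qj.
by rewrite Ev' linearD /= qj addr0.
Qed.

Lemma quotient_gr w k x : x \in gr_fil M W w k -> q x \in gr_fil MX WX w k.
Proof.
case/gr_filP=> a [b [aM aW bW ->]]; apply/gr_filP; exists (q a), (q b).
by rewrite qM !qW !memv_img ?linearD.
Qed.

(** The error in the kernel of [q] is itself in the image of [N ^ m], by
    [lefschetz_sur] for the kernel, and may be subtracted. *)
Lemma quotient_lefschetz_inj : lefschetz_inj NX WX MX.
Proof.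
have qiter := pullback_iter qN; have [LJ' NJ surJ] := LJ.
move=> w m x xM xW; have [v [vW vM E]] := quotient_lift xW xM; subst x.
rewrite -qiter => /gr_filP[a' [b' [a'M a'W b'W E]]].
have [a [aW aM Ea]] := quotient_lift a'W a'M; subst a'.
move: b'W; rewrite qW => /memv_imgP[b bW Eb]; subst b'.
have dJ : lfun_iter N m v - a - b \in lker q.
  by rewrite memv_ker !linearB /= E; apply/eqP; zmod.
have aM' : a \in M (w - m%:Z) by apply: (fil_incr Mf _ aM); ilia.
have vaM : b + (lfun_iter N m v - a - b) \in M (w - m%:Z).
  have -> : b + (lfun_iter N m v - a - b) = lfun_iter N m v - a by zmod.
  by memv; apply: (iter_lowers NM vM); ilia.
have [c [d [cW dJ' cM dM Ecd]]] := sl_dist sl (LW (w - 1)) LJ' bW dJ vaM.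
have cW' : c \in W w by apply: (fil_incr Wf _ cW); ilia.
have dE : d = lfun_iter N m v - a - c by apply: (addrI c); rewrite Ecd; zmod.
have dW : d \in W w by rewrite dE; memv; apply: iter_stable.
have [d1 [d1J d1M d1W dG]] := surJ _ _ _ dJ' dM dW.
have qd1 : q d1 = 0 by apply/eqP; rewrite -memv_ker.
have -> : q v = q (v - d1) by rewrite linearB /= qd1 subr0.
apply: quotient_gr; apply: injN; memv.
have -> : lfun_iter N m (v - d1) = (d - lfun_iter N m d1) + (a + c).
  by rewrite dE; lzmod.
by apply: memvD => //; apply/gr_filP; exists a, c.
Qed.

Lemma quotient_lefschetz_sur (S : {vspace X}) :
  restrict_lattice N W M L (q @^-1: S)%VS -> lefschetz_sur NX WX MX S.
Proof.
have qiter := pullback_iter qN.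
case=> _ _ surS w m x xS xM xW; have [v [vW vM E]] := quotient_lift xW xM; subst x.
rewrite memv_preim in xS; have [y [yS yM yW yG]] := surS _ _ _ xS vM vW.
exists (q y); rewrite memv_preim qM qW !memv_img // -qiter -linearB.
by split=> //; apply: quotient_gr.
Qed.

End Quotient.
End RelativeMonodromy.

(** * Towers of relative monodromy filtrations *)

Section Restriction.
Context (K : fieldType) (V : vectType K) (U : {vspace V}).

Lemma sub_inclE x : sub_incl U x = vsval x.
Proof. exact: lfunE. Qed.

Lemma sub_incl_inj : injective (sub_incl U).
Proof. by move=> x y; rewrite !sub_inclE => /subvs_inj. Qed.

Lemma limg_sub_incl : limg (sub_incl U) = U.
Proof.
apply/vspaceP=> x; apply/memv_imgP/idP=> [[y _ ->]|xU].
  by rewrite sub_inclE subvsP.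
by exists (vsproj U x); rewrite ?memvf // sub_inclE vsprojK.
Qed.

Lemma restr_filE (W : int -> {vspace V}) w x :
  (x \in restr_fil U W w) = (sub_incl U x \in W w).
Proof. by rewrite -memv_preim. Qed.

Lemma restr_endE (N : 'End(V)) x : stable N U ->
  sub_incl U (restr_end U N x) = N (sub_incl U x).
Proof.
move=> NU; rewrite !comp_lfunE !sub_inclE lfunE /= vsprojK //.
exact/NU/subvsP.
Qed.

Lemma restr_relative_monodromy N W M : stable N U ->
  finite_increasing M -> lowers N M -> (forall w, stable N (W w)) ->
  is_relative_monodromy (restr_end U N) (restr_fil U W) (restr_fil U M) <->
  relmon_on N W M U.
Proof.
move=> NU Mf NM NW; rewrite -[in X in _ <-> X]limg_sub_incl.
apply: relative_monodromy_pullback => //.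
- exact: sub_incl_inj.
- by move=> x; apply: restr_endE.
- exact: restr_filE.
- exact: restr_filE.
Qed.

End Restriction.

Lemma relative_monodromy_fullv (K : fieldType) (V : vectType K) (N : 'End(V)) W M :
  finite_increasing M -> lowers N M -> (forall w, stable N (W w)) ->
  is_relative_monodromy N W M <-> relmon_on N W M fullv.
Proof.
move=> Mf NM NW; rewrite -[fullv](lim1g fullv).
by apply: relative_monodromy_pullback => // [x y|x|k x|k x]; rewrite !id_lfunE.
Qed.

Section Towers.
Context (K : fieldType) (n : nat).

Section OneTower.
Context (V : vectType K) (W : int -> {vspace V}) (N : 'I_n -> 'End(V)).
Context (Wj : nat -> int -> {vspace V}) (tower : monodromy_tower W N Wj).
Implicit Types (S T : {vspace V}).

Lemma tower_stable (i : 'I_n) k w : (k <= n)%N -> stable (N i) (Wj k w).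
Proof. by case: tower => _ _ _ H _ /(H i k w)/stableP. Qed.

Lemma tower_lowers (i : 'I_n) k : (i < k <= n)%N -> lowers (N i) (Wj k).
Proof. by case: tower => _ _ _ _ H ik; apply/lowersP => w; apply: H. Qed.

Lemma tower_increasing k : (k <= n)%N -> finite_increasing (Wj k).
Proof.
case: tower => [[Wf W0] H _ _ _]; case: k => [_|k kn].
  case: Wf => [incr [i Wi] [i' Wi']]; split=> [a b ab||].
  - by rewrite !W0 incr.
  - by exists i; rewrite W0.
  - by exists i'; rewrite W0.
by have [] := H (Ordinal kn).
Qed.

Lemma tower_relmon (i : 'I_n) :
  lefschetz_inj (N i) (Wj i) (Wj i.+1) /\ lefschetz_sur (N i) (Wj i) (Wj i.+1) fullv.
Proof.
case: tower => _ /(_ i) H _ _ _; move: H.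
rewrite relative_monodromyE; first by case.
by move=> w; apply: tower_stable; apply: ltnW.
Qed.

(** For [k < i] this is part of the definition of a tower. For [k = i] it is
    automatic, since the steps of [Wj i] induce zero or everything on its
    graded pieces. *)
Lemma tower_lefschetz_sur (i : 'I_n) k w : (k <= i)%N ->
  lefschetz_sur (N i) (Wj i) (Wj i.+1) (Wj k w).
Proof.
have NWi v : stable (N i) (Wj i v) by apply: tower_stable; apply: ltnW.
rewrite leq_eqVlt => /orP[/eqP ->|ki].
  move=> v m y yw yM yv; case: (leP v w) => [vw|wv].
    have [x [_ xM xv xG]] := (tower_relmon i).2 v m y (memvf y) yM yv.
    exists x; split=> //; apply: (fil_incr _ vw xv).
    by apply: tower_increasing; apply: ltnW.
  exists 0; rewrite !mem0v linear0 subr0; split=> //.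
  apply: gr_filW; apply: (fil_incr _ _ yw); last by ilia.
  by apply: tower_increasing; apply: ltnW.
apply: relmon_on_lefschetz_sur; rewrite -restr_relative_monodromy //.
- by case: tower => _ _ H _ _; apply: H.
- by apply: tower_stable; apply: leq_trans (ltnW ki) (ltnW (ltn_ord i)).
- exact: tower_increasing.
- by apply: tower_lowers; rewrite ltnSn /=.
Qed.

(** Iterating [restrict_lattice] from a lattice [L] for [Wj n] down to [Wj j] *)
Definition tower_lattice (L : {vspace V} -> Prop) (j : nat) S :=
  L S /\ forall i : 'I_n, (j <= i)%N ->
    stable (N i) S /\ lefschetz_sur (N i) (Wj i) (Wj i.+1) S.

Context (L : {vspace V} -> Prop) (sl : strict_lattice L (Wj n)).
Context (LW : forall k w, (k < n)%N -> L (Wj k w)).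

Local Notation TL := (tower_lattice L).

Lemma tower_lattice_le j k S : (j <= k)%N -> TL j S -> TL k S.
Proof. by move=> jk [LS H]; split=> // i ki; apply: H; apply: leq_trans ki. Qed.

Lemma tower_lattice_fil j k w : (k < n)%N -> (k <= j)%N -> TL j (Wj k w).
Proof.
move=> kn kj; split=> [|i ji]; first exact: LW.
split; first by apply: tower_stable; apply: ltnW.
by apply: tower_lefschetz_sur; apply: leq_trans ji.
Qed.

Lemma tower_latticeS (i : 'I_n) S :
  TL i S <-> restrict_lattice (N i) (Wj i) (Wj i.+1) (TL i.+1) S.
Proof.
split=> [HS|[[LS H] NS surS]].
  have [LS H] := HS; have [NS surS] := H i (leqnn i).
  by split=> //; apply: tower_lattice_le HS.
split=> // i'; rewrite leq_eqVlt => /orP[/eqP/val_inj <- //|]; exact: H.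
Qed.

(** Descending induction on [j], by [strict_lattice_step] *)
Theorem tower_strict_lattice j : (j <= n)%N -> strict_lattice (TL j) (Wj j).
Proof.
have [d] := ubnPeq (n - j)%N; elim: d j => [|d IH] j Ed jn.
  have Ej : j = n by apply/eqP; rewrite eqn_leq jn -subn_eq0 Ed.
  rewrite Ej; case: sl => slI slA slD.
  have TLL S : TL n S <-> L S.
    by split=> [[]|LS] //; split=> // i; rewrite leqNgt ltn_ord.
  split=> [S T|S T|k S T x y]; rewrite !TLL; [exact: slI|exact: slA|exact: slD].
have {}jn : (j < n)%N by rewrite -subn_gt0 (eqP Ed).
pose i := Ordinal jn.
have slj : strict_lattice (TL i.+1) (Wj i.+1) by apply: IH => //=; lia.
have [slI slA slD] : strict_lattice (restrict_lattice (N i) (Wj i) (Wj i.+1) (TL i.+1)) (Wj i).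
  apply: strict_lattice_step => //.
  - exact: tower_increasing.
  - by apply: tower_increasing; apply: ltnW.
  - by move=> w; apply: tower_lattice_fil.
  - by move=> w; apply: tower_stable; apply: ltnW.
  - by apply: tower_lowers; rewrite ltnSn /=.
  - by case: (tower_relmon i).
have TLE S : TL j S <-> restrict_lattice (N i) (Wj i) (Wj i.+1) (TL i.+1) S.
  exact: (tower_latticeS i).
by split=> [S T|S T|k S T x y]; rewrite !TLE; [exact: slI|exact: slA|exact: slD].
Qed.

Lemma tower_lattice_relmon_on (i : 'I_n) S :
  TL i S -> relmon_on (N i) (Wj i) (Wj i.+1) S.
Proof.
case/tower_latticeS=> LS NS surS.
apply: (lefschetz_sur_relmon_on (L := TL i.+1)) => //.
- exact: tower_strict_lattice.
- by apply: tower_increasing; apply: ltnW.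
- by move=> w; apply: tower_lattice_fil.
- by move=> w; apply: tower_stable; apply: ltnW.
- by case: (tower_relmon i).
Qed.

(** The new tower restricts well to its own steps because the lattices are
    closed under intersection with the steps of the given one. *)
Lemma tower_sub (X : vectType K) (j : 'Hom(X, V)) (NX : 'I_n -> 'End(X))
    (WX : nat -> int -> {vspace X}) :
  injective j -> TL 0 (limg j) -> (forall i x, j (NX i x) = N i (j x)) ->
  (forall k w x, (x \in WX k w) = (j x \in Wj k w)) ->
  monodromy_tower (WX 0%N) NX WX.
Proof.
move=> jinj TLj jN jW; split.
- split=> //; apply: (pullback_increasing jinj (jW 0%N)).
  exact: tower_increasing.
- move=> i; rewrite (relative_monodromy_pullback jinj (jN i) (jW i.+1) (jW i)).
  + by apply: tower_lattice_relmon_on; apply: tower_lattice_le TLj.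
  + exact: tower_increasing.
  + by apply: tower_lowers; rewrite ltnSn /=.
  + by move=> w; apply: tower_stable; apply: ltnW.
- move=> i k w ki.
  have kn : (k < n)%N by apply: ltn_trans ki _.
  pose U := WX k w; pose jU := (j \o sub_incl U)%VF.
  have jUE x : jU x = j (sub_incl U x) by rewrite comp_lfunE.
  have NU : stable (NX i) U.
    by move=> x; rewrite !jW jN; apply: tower_stable; apply: ltnW.
  have jUinj : injective jU by move=> x y; rewrite !jUE => /jinj/sub_incl_inj.
  have jUimg : limg jU = (limg j :&: Wj k w)%VS.
    apply/vspaceP=> v; apply/memv_imgP/memv_capP.
      case=> x _ ->; rewrite jUE memv_img ?memvf // -jW sub_inclE.
      by split=> //; apply: subvsP.
    case=> /memv_imgP[x _ ->]; rewrite -jW => xU.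
    by exists (vsproj U x); rewrite ?memvf // jUE sub_inclE vsprojK.
  rewrite (relative_monodromy_pullback jUinj (N := N i) (W := Wj i) (M := Wj i.+1)).
  + rewrite jUimg; apply: tower_lattice_relmon_on.
    apply: (sl_cap (tower_strict_lattice _)); first exact: ltnW.
      exact: tower_lattice_le TLj.
    by apply: tower_lattice_fil => //; apply: ltnW.
  + by move=> x; rewrite !jUE restr_endE // jN.
  + by move=> v x; rewrite restr_filE jW jUE.
  + by move=> v x; rewrite restr_filE jW jUE.
  + exact: tower_increasing.
  + by apply: tower_lowers; rewrite ltnSn /=.
  + by move=> v; apply: tower_stable; apply: ltnW.
- by move=> i k w kn; apply/stableP=> x; rewrite !jW jN; apply: tower_stable.
- move=> i k w ikn; move: w; apply/lowersP=> w x; rewrite !jW jN.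
  exact: tower_lowers.
Qed.

(** The new tower restricts well to its own steps because the lattices contain
    the sums of the steps of the given one with the kernel. *)
Lemma tower_quotient (X : vectType K) (q : 'Hom(V, X)) (NX : 'I_n -> 'End(X)) :
  L fullv -> limg q = fullv -> TL 0 (lker q) ->
  (forall i x, q (N i x) = NX i (q x)) ->
  monodromy_tower (fun w => q @: Wj 0%N w)%VS NX (fun k w => q @: Wj k w)%VS.
Proof.
move=> Lf qsurj TLq qN.
have TLf k : TL k fullv.
  by split=> // i _; split=> [x _|]; [rewrite memvf|case: (tower_relmon i)].
have Wf k : (k <= n)%N -> finite_increasing (fun w => q @: Wj k w)%VS.
  move=> kn; have [incr [a Wa] [b Wb]] := tower_increasing kn; split.
  - by move=> c d cd; apply/limgS/incr.
  - by exists a; rewrite Wa limg0.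
  - by exists b; rewrite Wb qsurj.
have NXW i k w : (k <= n)%N -> stable (NX i) (q @: Wj k w)%VS.
  move=> kn _ /memv_imgP[x xW ->]; rewrite -qN memv_img //.
  exact: tower_stable.
have NXM (i : 'I_n) k : (i < k <= n)%N -> lowers (NX i) (fun w => q @: Wj k w)%VS.
  move=> ikn w _ /memv_imgP[x xW ->]; rewrite -qN memv_img //.
  exact: tower_lowers.
have slq (i : 'I_n) := quotient_strict_lattice qsurj
  (tower_strict_lattice (j := i.+1) (ltn_ord i)) (fun=> erefl).
have Jq (i : 'I_n) : restrict_lattice (N i) (Wj i) (Wj i.+1) (TL i.+1) (lker q).
  by apply/tower_latticeS; apply: tower_lattice_le TLq.
have TLW (i : 'I_n) w : TL i.+1 (Wj i w) by apply: tower_lattice_fil.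
have inj (i : 'I_n) : lefschetz_inj (NX i) (fun w => q @: Wj i w)%VS
    (fun w => q @: Wj i.+1 w)%VS.
  apply: (quotient_lefschetz_inj (tower_strict_lattice (j := i.+1) (ltn_ord i))
    (fun=> erefl) (fun=> erefl) (qN i) _ _ (TLW i)) (Jq i).
  - exact: tower_increasing.
  - by apply: tower_increasing; apply: ltnW.
  - by move=> w; apply: tower_stable; apply: ltnW.
  - by apply: tower_lowers; rewrite ltnSn /=.
  - by case: (tower_relmon i).
have sur (i : 'I_n) (S : {vspace X}) : TL i (q @^-1: S)%VS ->
    lefschetz_sur (NX i) (fun w => q @: Wj i w)%VS (fun w => q @: Wj i.+1 w)%VS S.
  move/tower_latticeS; apply: (quotient_lefschetz_sur
    (tower_strict_lattice (j := i.+1) (ltn_ord i)) (fun=> erefl) (fun=> erefl)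
    (qN i) (TLW i) (Jq i)).
split.
- by split=> //; apply: Wf.
- move=> i; apply/relative_monodromyE; first by move=> w; apply: NXW; apply: ltnW.
  split; [exact: Wf|by apply: NXM; rewrite ltnSn /=|exact: inj|].
  apply: sur; have -> : (q @^-1: fullv)%VS = fullv.
    by apply/vspaceP=> x; rewrite -memv_preim !memvf.
  exact: TLf.
- move=> i k w ki; have kn : (k < n)%N by apply: ltn_trans ki _.
  have ln : (i <= n)%N by apply: ltnW.
  apply/restr_relative_monodromy.
  + by apply: NXW; apply: ltnW.
  + exact: Wf.
  + by apply: NXM; rewrite ltnSn /=.
  + by move=> v; apply: NXW.
  have TLU : TL i (q @^-1: (q @: Wj k w))%VS.
    rewrite preim_img; apply: (sl_add (tower_strict_lattice ln)).
      by apply: tower_lattice_fil => //; apply: ltnW.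
    exact: tower_lattice_le TLq.
  apply: (lefschetz_sur_relmon_on (slq i)).
  + exact: Wf.
  + by move=> v; rewrite preim_img; apply: (sl_add (tower_strict_lattice (ltn_ord i)));
      [apply: TLW|case: (Jq i)].
  + by move=> v; apply: NXW.
  + exact: tower_lattice_le TLU.
  + by apply: NXW; apply: ltnW.
  + exact: inj.
  + exact: sur.
- by move=> i k w kn; apply/stableP; apply: NXW.
- by move=> i k w ikn; move: w; apply/lowersP; apply: NXM.
Qed.

End OneTower.

Lemma tower_functorial (A B : vectType K) (f : 'Hom(A, B)) WA NA WjA WB NB WjB :
  @monodromy_tower _ A n WA NA WjA -> @monodromy_tower _ B n WB NB WjB ->
  (forall i x, f (NA i x) = NB i (f x)) ->
  (forall w x, x \in WA w -> f x \in WB w) ->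
  forall j w x, (j <= n)%N -> x \in WjA j w -> f x \in WjB j w.
Proof.
move=> tA tB fN fW; elim=> [|j IH] w x jn.
  by case: tA => [[_ ->] _ _ _ _]; case: tB => [[_ ->] _ _ _ _]; apply: fW.
pose i := Ordinal jn; have jn' := ltnW jn.
apply: (relative_monodromy_functorial (NA := NA i) (NB := NB i) (WA := WjA j) (WB := WjB j)).
- by move=> v; apply: (tower_stable tA).
- by move=> v; apply: (tower_stable tB).
- exact: (tower_increasing tA).
- exact: (tower_increasing tB).
- by case: tA => _ /(_ i).
- by case: tB => _ /(_ i).
- exact: fN.
- by move=> v y; apply: IH.
Qed.

(** This puts graphs of morphisms into the lattices. *)
Lemma tower_lattice_limg (X V : vectType K) (j : 'Hom(X, V)) W N Wj WX NX WXj L :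
  @monodromy_tower _ V n W N Wj -> @monodromy_tower _ X n WX NX WXj ->
  (forall i x, j (NX i x) = N i (j x)) ->
  (forall k w x, (k <= n)%N -> (x \in WXj k w) = (j x \in Wj k w)) ->
  L (limg j) -> tower_lattice N Wj L 0 (limg j).
Proof.
move=> tV tX jN jW Lj; split=> // i _; split.
  by move=> _ /memv_imgP[x _ ->]; rewrite -jN memv_img ?memvf.
have ilen : (i <= n)%N by apply: ltnW.
move=> w m _ /memv_imgP[y _ ->]; rewrite -!jW // => yM yW.
have [x [_ xM xW /gr_filP[a [b [aM aW bW E]]]]] :=
  (tower_relmon tX i).2 w m y (memvf y) yM yW.
exists (j x); rewrite memv_img ?memvf // -!jW //; split=> //.
rewrite -(pullback_iter (jN i)) -linearB E linearD.
by apply/gr_filP; exists (j a), (j b); rewrite -!jW.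
Qed.

End Towers.

(** * Direct sums, graphs and quotients of vector spaces *)

Section LinearAlgebra.
Context (K : fieldType).
Implicit Types A B C V X : vectType K.

Definition pair_fun A B X (f : 'Hom(X, A)) (g : 'Hom(X, B)) (x : X) : (A * B)%type :=
  (f x, g x).

Fact pair_fun_is_linear A B X (f : 'Hom(X, A)) (g : 'Hom(X, B)) :
  linear (pair_fun f g).
Proof. by move=> a x y; rewrite /pair_fun !linearP. Qed.

HB.instance Definition _ A B X (f : 'Hom(X, A)) (g : 'Hom(X, B)) :=
  GRing.isLinear.Build K X (A * B)%type _ (pair_fun f g) (pair_fun_is_linear f g).

Definition pair_lfun A B X (f : 'Hom(X, A)) (g : 'Hom(X, B)) : 'Hom(X, (A * B)%type) :=
  linfun (pair_fun f g).

Definition fst_lfun A B : 'Hom((A * B)%type, A) := linfun fst.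
Definition snd_lfun A B : 'Hom((A * B)%type, B) := linfun snd.

Definition prod_lfun A B A' B' (f : 'Hom(A, A')) (g : 'Hom(B, B')) :
  'Hom((A * B)%type, (A' * B')%type) :=
  pair_lfun (f \o fst_lfun A B) (g \o snd_lfun A B).

Lemma pair_lfunE A B X (f : 'Hom(X, A)) (g : 'Hom(X, B)) x :
  pair_lfun f g x = (f x, g x).
Proof. exact: lfunE. Qed.

Lemma fst_lfunE A B (x : (A * B)%type) : fst_lfun A B x = x.1.
Proof. exact: lfunE. Qed.

Lemma snd_lfunE A B (x : (A * B)%type) : snd_lfun A B x = x.2.
Proof. exact: lfunE. Qed.

Lemma prod_lfunE A B A' B' (f : 'Hom(A, A')) (g : 'Hom(B, B')) x :
  prod_lfun f g x = (f x.1, g x.2).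
Proof. by rewrite pair_lfunE !comp_lfunE fst_lfunE snd_lfunE. Qed.

Definition prodv A B (U : {vspace A}) (U' : {vspace B}) : {vspace (A * B)%type} :=
  (fst_lfun A B @^-1: U :&: snd_lfun A B @^-1: U')%VS.

Lemma memv_prodv A B (U : {vspace A}) (U' : {vspace B}) x :
  (x \in prodv U U') = (x.1 \in U) && (x.2 \in U').
Proof. by rewrite memv_cap -!memv_preim fst_lfunE snd_lfunE. Qed.

Lemma prodvf A B : prodv (fullv : {vspace A}) (fullv : {vspace B}) = fullv.
Proof. by apply/vspaceP=> x; rewrite memv_prodv !memvf. Qed.

Definition graph A B (f : 'Hom(A, B)) : 'Hom(A, (A * B)%type) := pair_lfun \1 f.

Lemma graphE A B (f : 'Hom(A, B)) x : graph f x = (x, f x).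
Proof. by rewrite pair_lfunE id_lfunE. Qed.

Lemma memv_graph A B (f : 'Hom(A, B)) x : (x \in limg (graph f)) = (x.2 == f x.1).
Proof.
apply/memv_imgP/eqP=> [[a _ ->]|E]; first by rewrite graphE.
by exists x.1; rewrite ?memvf // graphE -E; case: x {E}.
Qed.

Lemma limg_all A B (f : 'Hom(A, B)) x : f x \in limg f.
Proof. exact/memv_img/memvf. Qed.

Lemma lift_injective V X (j : 'Hom(X, V)) (T : 'End(V)) x : injective j ->
  stable T (limg j) -> j ((j^-1 \o T \o j)%VF x) = T (j x).
Proof. by move=> jinj Tj; rewrite !comp_lfunE limg_lfunVK // Tj // limg_all. Qed.

Lemma lift_surjective V X (q : 'Hom(V, X)) (T : 'End(V)) x : limg q = fullv ->
  stable T (lker q) -> q (T x) = (q \o T \o q^-1)%VF (q x).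
Proof.
move=> qsurj Tq; rewrite !comp_lfunE; apply/eqP; rewrite -subr_eq0 -!linearB.
rewrite -memv_ker Tq // memv_ker linearB /= limg_lfunVK ?subrr //.
exact: limg_all.
Qed.

Lemma quotient_exists V (J : {vspace V}) :
  exists (X : vectType K) (q : 'Hom(V, X)), limg q = fullv /\ lker q = J.
Proof.
pose h := daddv_pi (J^C)%VS J; pose U := limg h.
have Uh x : h x \in U by exact: limg_all.
exists (subvs_of U), (linfun (vsproj U) \o h)%VF; split.
  apply/eqP; rewrite eqEsubv subvf; apply/subvP=> x _.
  have /memv_imgP[v _ E] := subvsP x.
  apply/memv_imgP; exists v; rewrite ?memvf //.
  by apply/subvs_inj; rewrite comp_lfunE lfunE /= vsprojK // E.
have E x : (x \in lker (linfun (vsproj U) \o h)) = (h x == 0).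
  rewrite memv_ker comp_lfunE lfunE /=; apply/eqP/eqP=> [H|->]; last by rewrite linear0.
  by rewrite -(vsprojK (Uh x)) H.
have capJ : (J^C :&: J = 0)%VS by rewrite capvC capv_compl.
apply/vspaceP=> x; rewrite E.
have dec : h x + daddv_pi J J^C x = x.
  by apply: daddv_pi_add => //; rewrite addvC addv_complf memvf.
apply/eqP/idP=> [h0|xJ].
  by rewrite -dec h0 add0r memv_pi.
have : h x \in (J^C :&: J)%VS.
  rewrite memv_cap memv_pi /=.
  have -> : h x = x - daddv_pi J J^C x by apply: (addIr (daddv_pi J J^C x)); rewrite dec subrK.
  by rewrite memvB // memv_pi.
by rewrite capJ memv0 => /eqP.
Qed.

Section TowerSum.
Context (n : nat) (A B : vectType K).
Context (WA : int -> {vspace A}) (NA : 'I_n -> 'End(A)) (WjA : nat -> int -> {vspace A}).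
Context (WB : int -> {vspace B}) (NB : 'I_n -> 'End(B)) (WjB : nat -> int -> {vspace B}).
Context (tA : monodromy_tower WA NA WjA) (tB : monodromy_tower WB NB WjB).

Lemma finite_increasing_prod MA MB :
  finite_increasing MA -> finite_increasing MB ->
  finite_increasing (fun w => prodv (MA w : {vspace A}) (MB w : {vspace B})).
Proof.
move=> MAf MBf; split.
- move=> a b ab; apply/subvP=> x; rewrite !memv_prodv => /andP[x1 x2].
  by rewrite (fil_incr MAf ab x1) (fil_incr MBf ab x2).
- have [i MA0] := fil_zero MAf; have [j MB0] := fil_zero MBf.
  exists (Num.min i j); apply/eqP; rewrite -subv0; apply/subvP=> -[a b].
  rewrite memv_prodv memv0 /= => /andP[aM bM].
  rewrite (MA0 _ _ _ aM) ?ge_min ?lexx // (MB0 _ _ _ bM) ?ge_min ?lexx ?orbT //.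
have [i MA1] := fil_full MAf; have [j MB1] := fil_full MBf.
exists (Num.max i j); apply/vspaceP=> x; rewrite memv_prodv memvf.
by rewrite MA1 ?MB1 // le_max lexx ?orbT.
Qed.

Lemma prod_lfun_iter (f : 'End(A)) (g : 'End(B)) m x :
  lfun_iter (prod_lfun f g) m x = (lfun_iter f m x.1, lfun_iter g m x.2).
Proof.
elim: m => [|m IH]; first by rewrite !id_lfunE; case: x.
by rewrite !lfun_iterS IH prod_lfunE.
Qed.

Lemma gr_on_prod (U : {vspace A}) (U' : {vspace B}) MA MB VA VB w k x :
  (x \in gr_on (prodv U U') (fun w => prodv (MA w) (MB w))
           (fun w => prodv (VA w) (VB w)) w k) =
  (x.1 \in gr_on U MA VA w k) && (x.2 \in gr_on U' MB VB w k).
Proof.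
apply/memv_addP/andP.
  case=> a; rewrite !(memv_prodv, memv_cap) => /andP[/andP[? ?] /andP[/andP[? ?] /andP[? ?]]].
  case=> b; rewrite !(memv_prodv, memv_cap) => /andP[/andP[? ?] /andP[? ?]] ->.
  by split; apply: memv_add; rewrite !memv_cap; do ?[apply/andP; split].
case=> /memv_addP[a /memv_capP[aU /memv_capP[aM aV]] [b /memv_capP[bU bV] E]].
case/memv_addP=> a' /memv_capP[aU' /memv_capP[aM' aV']] [b' /memv_capP[bU' bV'] E'].
exists (a, a'); first by rewrite !(memv_prodv, memv_cap) /= aU aM aV aU' aM' aV'.
exists (b, b'); first by rewrite !(memv_prodv, memv_cap) /= bU bU' bV bV'.
by rewrite [x]surjective_pairing E E'.
Qed.

Lemma relmon_on_prod (U : {vspace A}) (U' : {vspace B}) f g MA MB VA VB :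
  relmon_on f VA MA U -> relmon_on g VB MB U' ->
  relmon_on (prod_lfun f g) (fun w => prodv (VA w) (VB w))
    (fun w => prodv (MA w) (MB w)) (prodv U U').
Proof.
move=> HA HB w m; have [injA surA] := HA w m; have [injB surB] := HB w m; split.
  move=> x; rewrite !memv_prodv => /andP[x1U x2U] /andP[x1M x2M] /andP[x1V x2V].
  rewrite !gr_on_prod prod_lfun_iter => /andP[x1G x2G].
  by rewrite injA ?injB.
move=> y; rewrite !memv_prodv => /andP[x1U x2U] /andP[x1M x2M] /andP[x1V x2V].
have [a [aU aM aV aG]] := surA _ x1U x1M x1V.
have [b [bU bM bV bG]] := surB _ x2U x2M x2V.
exists (a, b); rewrite !memv_prodv aU aM aV bU bM bV; split=> //.
by rewrite gr_on_prod prod_lfun_iter /= aG bG.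
Qed.

Lemma tower_sum :
  monodromy_tower (fun w => prodv (WA w) (WB w)) (fun i => prod_lfun (NA i) (NB i))
    (fun j w => prodv (WjA j w) (WjB j w)).
Proof.
have Wf k : (k <= n)%N -> finite_increasing (fun w => prodv (WjA k w) (WjB k w)).
  by move=> kn; apply: finite_increasing_prod;
    [apply: (tower_increasing tA)|apply: (tower_increasing tB)].
have NW i k w : (k <= n)%N -> stable (prod_lfun (NA i) (NB i)) (prodv (WjA k w) (WjB k w)).
  move=> kn x; rewrite prod_lfunE !memv_prodv => /andP[x1 x2].
  by rewrite (tower_stable tA) ?(tower_stable tB).
have NM (i : 'I_n) k : (i < k <= n)%N ->
    lowers (prod_lfun (NA i) (NB i)) (fun w => prodv (WjA k w) (WjB k w)).
  move=> ik w x; rewrite prod_lfunE !memv_prodv => /andP[x1 x2].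
  by rewrite (tower_lowers tA) ?(tower_lowers tB).
split.
- case: tA tB => [[WAf WA0] _ _ _ _] [[WBf WB0] _ _ _ _]; split.
    exact: finite_increasing_prod.
  by move=> w; rewrite WA0 WB0.
- move=> i; have iln : (i <= n)%N by apply: ltnW.
  have relfull V W (N : 'I_n -> 'End(V)) Wj : monodromy_tower W N Wj ->
      relmon_on (N i) (Wj i) (Wj i.+1) fullv.
    move=> t; apply/relative_monodromy_fullv; last by case: t => _ /(_ i).
    + exact: (tower_increasing t).
    + by apply: (tower_lowers t); rewrite ltnSn /=.
    + by move=> w; apply: (tower_stable t).
  apply/relative_monodromy_fullv; [exact: Wf| |by move=> w; apply: NW|].
    by apply: NM; rewrite ltnSn /=.
  by rewrite -prodvf; apply: relmon_on_prod; [apply: relfull tA|apply: relfull tB].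
- move=> i k w ki; have iln : (i <= n)%N by apply: ltnW.
  have kn : (k <= n)%N by apply: ltnW; apply: ltn_trans ki _.
  have rel V W (N : 'I_n -> 'End(V)) Wj : monodromy_tower W N Wj ->
      relmon_on (N i) (Wj i) (Wj i.+1) (Wj k w).
    move=> t; apply/restr_relative_monodromy.
    + exact: (tower_stable t).
    + exact: (tower_increasing t).
    + by apply: (tower_lowers t); rewrite ltnSn /=.
    + by move=> v; apply: (tower_stable t).
    by case: t => _ _ /(_ i k w ki).
  apply/restr_relative_monodromy; [exact: NW|exact: Wf| |by move=> v; apply: NW|].
    by apply: NM; rewrite ltnSn /=.
  by apply: relmon_on_prod; [apply: rel tA|apply: rel tB].
- by move=> i k w kn; apply/stableP; apply: NW.
- by move=> i k w ikn; move: w; apply/lowersP; apply: NM.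
Qed.

End TowerSum.
End LinearAlgebra.

(** * Abelian categories of structured vector spaces *)

Section LinearCategory.
Context (K : fieldType) (C : linCat K).
Implicit Types A B T X : linCat_preaddCat C.

Lemma lhom_eqP A B (f g : mor A B) :
  (forall x, (f : lhom A B) x = (g : lhom A B) x) -> f = g.
Proof. by move=> H; apply/val_inj/lfunP. Qed.

Lemma lhom0E A B x : ((0 : mor A B) : lhom A B) x = 0.
Proof. by rewrite lfunE. Qed.

Lemma lcompE A B D (g : mor B D) (f : mor A B) x :
  (Defs.comp g f : lhom A D) x = (g : lhom B D) ((f : lhom A B) x).
Proof. by rewrite /= comp_lfunE. Qed.

Definition initial_mor (A B : lobj C) (f : 'Hom(lcar A, lcar B)) :=
  forall (T : lobj C) (g : 'Hom(lcar T, lcar A)), lmor (f \o g)%VF -> lmor g.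

Definition final_mor (A B : lobj C) (f : 'Hom(lcar A, lcar B)) :=
  forall (T : lobj C) (g : 'Hom(lcar B, lcar T)), lmor (g \o f)%VF -> lmor g.

Context (initial_inj : forall (A B : lobj C) (f : lhom A B),
  lker f = 0%VS -> initial_mor f).
Context (final_surj : forall (A B : lobj C) (f : lhom A B),
  limg f = fullv -> final_mor f).

Lemma lin_kernel_is_kernel A B (f : mor A B) X (i : mor X A) :
  is_lin_kernel (f : lhom A B) (i : lhom X A) -> is_kernel f i.
Proof.
case=> ker_i im_i; have iinj : injective (i : lhom X A) by apply/lker0P/eqP.
split.
  apply: lhom_eqP => x; rewrite lcompE lhom0E; apply/eqP.
  by rewrite -memv_ker -im_i limg_all.
move=> T g fg; pose h := ((i : lhom X A)^-1 \o (g : lhom T A))%VF.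
have ih x : (i : lhom X A) (h x) = (g : lhom T A) x.
  rewrite comp_lfunE limg_lfunVK // im_i memv_ker.
  by rewrite -[_ (_ x)]lcompE fg lhom0E.
have lmor_h : lmor h.
  apply: (initial_inj ker_i); have -> : ((i : lhom X A) \o h)%VF = (g : lhom T A).
    by apply/lfunP => x; rewrite comp_lfunE ih.
  exact: lhomP.
exists (LHom (asboolT lmor_h)); split; first by apply: lhom_eqP => x; rewrite lcompE ih.
move=> h' E; apply: lhom_eqP => x; apply: iinj.
by rewrite -[RHS]lcompE E ih.
Qed.

Lemma lin_cokernel_is_cokernel A B (f : mor A B) X (p : mor B X) :
  is_lin_cokernel (f : lhom A B) (p : lhom B X) -> is_cokernel f p.
Proof.
case=> im_p ker_p; split.
  apply: lhom_eqP => x; rewrite lcompE lhom0E; apply/eqP.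
  by rewrite -memv_ker ker_p limg_all.
move=> T g gf; pose h := ((g : lhom B T) \o (p : lhom B X)^-1)%VF.
have hp x : h ((p : lhom B X) x) = (g : lhom B T) x.
  rewrite comp_lfunE; apply/eqP; rewrite -subr_eq0 -linearB -memv_ker.
  suff /memv_imgP[y _ ->] : ((p : lhom B X)^-1)%VF ((p : lhom B X) x) - x \in limg (f : lhom A B).
    by rewrite memv_ker -[_ (_ y)]lcompE gf lhom0E.
  by rewrite -ker_p memv_ker linearB /= limg_lfunVK ?subrr // limg_all.
have lmor_h : lmor h.
  apply: (final_surj im_p); have -> : (h \o (p : lhom B X))%VF = (g : lhom B T).
    by apply/lfunP => x; rewrite comp_lfunE hp.
  exact: lhomP.
exists (LHom (asboolT lmor_h)); split; first by apply: lhom_eqP => x; rewrite lcompE hp.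
move=> h' E; apply: lhom_eqP => x; have [y ->] := surj_preimage im_p x.
by rewrite -[RHS]lcompE E hp.
Qed.

Context (lin_kernel : forall (A B : lobj C) (f : lhom A B),
  exists (X : lobj C) (i : lhom X A), is_lin_kernel f i).
Context (lin_cokernel : forall (A B : lobj C) (f : lhom A B),
  exists (X : lobj C) (p : lhom B X), is_lin_cokernel f p).

(** A linear kernel exists and is a kernel; all other kernels are isomorphic to
    it. *)
Lemma is_kernelP A B (f : mor A B) X (i : mor X A) :
  is_kernel f i <-> is_lin_kernel (f : lhom A B) (i : lhom X A).
Proof.
split; last exact: lin_kernel_is_kernel.
case=> fi univ; have [Y [k k_ker]] := lin_kernel f.
have [fk univk] := lin_kernel_is_kernel k_ker.
have [h [kh _]] := univk _ _ fi; have [h' [ih' _]] := univ _ _ fk.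
have h'h : Defs.comp h' h = idm X.
  have [u [_ uniq]] := univ _ _ fi.
  rewrite -(uniq (Defs.comp h' h)); last by rewrite Defs.compA ih' kh.
  by apply: uniq; rewrite Defs.compm1.
split.
  apply/eqP/lker0P => x y E.
  have H z : (h' : lhom Y X) ((h : lhom X Y) z) = z.
    by rewrite -[LHS]lcompE h'h /= id_lfunE.
  case: k_ker => /eqP/lker0P kinj _.
  by rewrite -[x]H -[y]H; congr (fun_of_lfun _ _);
    apply: kinj; rewrite -![(k : lhom Y A) _]lcompE kh.
case: k_ker => _ <-; apply/eqP; rewrite eqEsubv; apply/andP; split; apply/subvP=> _ /memv_imgP[x _ ->].
  by rewrite -kh lcompE limg_all.
by rewrite -ih' lcompE limg_all.
Qed.

Lemma is_cokernelP A B (f : mor A B) X (p : mor B X) :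
  is_cokernel f p <-> is_lin_cokernel (f : lhom A B) (p : lhom B X).
Proof.
split; last exact: lin_cokernel_is_cokernel.
case=> pf univ; have [Y [k k_coker]] := lin_cokernel f.
have [kf univk] := lin_cokernel_is_cokernel k_coker.
have [h [hk _]] := univk _ _ pf; have [h' [h'p _]] := univ _ _ kf.
have hh' : Defs.comp h h' = idm X.
  have [u [_ uniq]] := univ _ _ pf.
  rewrite -(uniq (Defs.comp h h')); last by rewrite -Defs.compA h'p hk.
  by apply: uniq; rewrite Defs.comp1m.
case: k_coker => im_k ker_k; split.
  apply/eqP; rewrite eqEsubv subvf; apply/subvP=> x _.
  have Ex : (h : lhom Y X) ((h' : lhom X Y) x) = x.
    by rewrite -[LHS]lcompE hh' /= id_lfunE.
  have [y Ey] := surj_preimage im_k ((h' : lhom X Y) x).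
  by rewrite -Ex Ey -[_ (_ y)]lcompE hk limg_all.
rewrite -ker_k; apply/eqP; rewrite eqEsubv; apply/andP; split; apply/subvP=> x;
  rewrite !memv_ker => /eqP E.
  by rewrite -h'p lcompE E linear0.
by rewrite -hk lcompE E linear0.
Qed.

Context (lin_zero : exists Z : lobj C, (fullv : {vspace lcar Z}) = 0%VS).
Context (lin_biproduct : forall A B : linCat_preaddCat C, exists T
  (i1 : mor A T) (i2 : mor B T) (p1 : mor T A) (p2 : mor T B),
  is_biproduct i1 i2 p1 p2).

(** Strictness, in the form of [initial_inj] and [final_surj], makes a
    monomorphism a kernel of its linear cokernel and an epimorphism a cokernel
    of its linear kernel. *)
Theorem lin_abelian : is_abelian (linCat_preaddCat C).
Proof.
split=> //.
- have [Z Z0] := lin_zero; exists Z => A.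
  have zero (z : lcar Z) : z = 0 by apply/eqP; rewrite -memv0 -Z0 memvf.
  split=> f g; apply: lhom_eqP => x; first by rewrite [LHS]zero [RHS]zero.
  by rewrite (zero x) !linear0.
- move=> A B f; have [X [i i_ker]] := lin_kernel f.
  by exists X, i; apply: lin_kernel_is_kernel.
- move=> A B f; have [X [p p_coker]] := lin_cokernel f.
  by exists X, p; apply: lin_cokernel_is_cokernel.
- move=> A B f fmono; have [X [i i_ker]] := lin_kernel f.
  have [Q [p p_coker]] := lin_cokernel f.
  have [fi _] := lin_kernel_is_kernel i_ker.
  exists Q, p; apply: lin_kernel_is_kernel; case: p_coker => _ ker_p; split=> //.
  case: i_ker => _ <-; have -> : i = 0 :> lhom X A.
    by apply: (fmono X i 0); rewrite fi; apply: lhom_eqP => x; rewrite lcompE !lhom0E linear0.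
  by apply/eqP; rewrite -subv0; apply/subvP=> _ /memv_imgP[x _ ->]; rewrite lhom0E mem0v.
- move=> A B f fepi; have [X [i i_ker]] := lin_kernel f.
  have [Q [p p_coker]] := lin_cokernel f.
  have [pf _] := lin_cokernel_is_cokernel p_coker.
  exists X, i; apply: lin_cokernel_is_cokernel; case: i_ker => _ im_i; split=> //.
  case: p_coker => _ <-; have -> : p = 0 :> lhom B Q.
    by apply: (fepi Q p 0); rewrite pf; apply: lhom_eqP => x; rewrite lcompE !lhom0E.
  by apply/eqP; rewrite eqEsubv subvf; apply/subvP=> x _; rewrite memv_ker lhom0E.
Qed.

End LinearCategory.

(** * Weight decompositions *)

Section WeightDecomposition.
Context (E : fieldType) (charE : [pchar E] =i pred0).
Context (V : vectType E) (alpha : E -> 'End(V)).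

Lemma pow2_inj (i j : int) : (2 : E) ^ i = 2 ^ j -> i = j.
Proof.
have nat_neq0 m : (0 < m)%N -> (m%:R : E) != 0.
  by move=> m0; rewrite ((pcharf0P E).1 charE) -lt0n.
have two0 : (2 : E) != 0 by apply: nat_neq0.
suff H (k l : int) : (k < l)%R -> (2 : E) ^ k <> 2 ^ l.
  by move=> Eij; case: (ltgtP i j) => // /H; [move/(_ Eij)|move/(_ (esym Eij))].
move=> kl Ekl; have [m El] : exists m : nat, l = k + m.+1%:Z.
  by exists (absz (l - k - 1)%R); ilia.
move: Ekl; rewrite El expfzDr // -[LHS]mulr1 => /mulfI.
rewrite expfz_eq0 negb_and two0 orbT => /(_ isT) /esym/eqP.
rewrite -exprnP -natrX -subr_eq0 -(natrB _ (expn_gt0 2 m.+1)).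
by apply/negP/nat_neq0; rewrite subn_gt0 -{1}(expn0 2) ltn_exp2l.
Qed.

Local Notation weight := (has_weight alpha).

Lemma weight0 k : weight k 0.
Proof. by move=> a _; rewrite linear0 scaler0. Qed.

Lemma weightD k x y : weight k x -> weight k y -> weight k (x + y).
Proof. by move=> Hx Hy a a0; rewrite linearD /= Hx // Hy // scalerDr. Qed.

Lemma weightZ k c x : weight k x -> weight k (c *: x).
Proof. by move=> Hx a a0; rewrite linearZ /= Hx // !scalerA mulrC. Qed.

Lemma weight_sum k (I : Type) (r : seq I) (P : pred I) (F : I -> V) :
  (forall i, P i -> weight k (F i)) -> weight k (\sum_(i <- r | P i) F i).
Proof.
move=> H; elim/big_rec: _ => [|i x Pi]; first exact: weight0.
by apply: weightD; apply: H.
Qed.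

(** The weight spaces are eigenspaces of [alpha 2], for eigenvalues that are
    distinct by [pow2_inj]: apply [alpha 2 - 2 ^ k] to remove the component of
    weight [k]. *)
Lemma weight_components (S : {vspace V}) (r : seq int) (c : int -> V) :
  stable (alpha 2) S -> uniq r -> (forall k, weight k (c k)) ->
  \sum_(k <- r) c k \in S -> forall k, k \in r -> c k \in S.
Proof.
have two0 : (2 : E) != 0 by rewrite ((pcharf0P E).1 charE).
move=> aS; elim: r c => // k r IH c /= /andP[kr ur] wc; rewrite big_cons => sumS.
have tailS l : l \in r -> c l \in S.
  move=> lr; pose c' l := ((2 : E) ^ l - 2 ^ k) *: c l.
  have c'lS : c' l \in S.
    apply: (IH c') => // [m|]; first exact: weightZ.
    have -> : \sum_(m <- r) c' m = alpha 2 (c k + \sum_(m <- r) c m)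
        - (2 : E) ^ k *: (c k + \sum_(m <- r) c m).
      rewrite linearD /= linear_sum /= scalerDr scaler_sumr (wc k 2 two0) opprD addrACA subrr add0r.
      by rewrite -sumrB; apply: eq_bigr => m _; rewrite wc // -scalerBl.
    by apply: memvB; [apply: aS|apply: memvZ].
  have : (2 : E) ^ l - 2 ^ k != 0.
    by rewrite subr_eq0; apply/eqP => /pow2_inj Elk; rewrite -Elk lr in kr.
  by move=> c0; rewrite -[c l](scalerK c0); apply: memvZ.
move=> l; rewrite inE => /orP[/eqP ->|]; last exact: tailS.
have -> : c k = (c k + \sum_(m <- r) c m) - \sum_(m <- r) c m by rewrite addrK.
apply: memvB => //; rewrite big_seq; apply: memv_suml => m; exact: tailS.
Qed.

(** The component of weight [k] of a sum of weight vectors, where weights may be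
    repeated *)
Definition wcomp (s : seq (int * V)) (k : int) : V := \sum_(t <- s | t.1 == k) t.2.

Lemma wcomp_weight s k :
  (forall t, t \in s -> weight t.1 t.2) -> weight k (wcomp s k).
Proof.
move=> H; rewrite /wcomp big_seq_cond; apply: weight_sum => t /andP[ts /eqP <-].
exact: H.
Qed.

Lemma sum_wcomp (s : seq (int * V)) (r : seq int) (P : pred int) :
  uniq r -> (forall t, t \in s -> t.1 \in r) ->
  \sum_(t <- s | P t.1) t.2 = \sum_(k <- r | P k) wcomp s k.
Proof.
move=> ur; elim: s => [_|t s IH sr].
  by rewrite big_nil big1 // => k _; rewrite /wcomp big_nil.
have tr : t.1 \in r by apply: sr; rewrite inE eqxx.
have -> : \sum_(k <- r | P k) wcomp (t :: s) k =
    \sum_(k <- r | P k) (if t.1 == k then t.2 else 0) + \sum_(k <- r | P k) wcomp s k.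
  rewrite -big_split; apply: eq_bigr => k _; rewrite /wcomp big_cons.
  by case: eqP => _ //=; rewrite add0r.
rewrite big_cons -IH => [|u us]; last by apply: sr; rewrite inE us orbT.
rewrite [X in _ = X + _]big_mkcond (bigD1_seq t.1) //= eqxx [X in _ + X + _]big1 => [|k /negPf kt]; last first.
  by rewrite eq_sym kt if_same.
by case: (P t.1); rewrite addr0 ?add0r.
Qed.

Lemma wcomp_mem (S : {vspace V}) (s : seq (int * V)) k :
  stable (alpha 2) S -> (forall t, t \in s -> weight t.1 t.2) ->
  \sum_(t <- s) t.2 \in S -> wcomp s k \in S.
Proof.
move=> aS ws; pose r := undup (k :: [seq t.1 | t <- s]).
have sr t : t \in s -> t.1 \in r.
  by move=> ts; rewrite mem_undup inE map_f ?orbT.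
rewrite (sum_wcomp xpredT (undup_uniq _) sr) => sumS.
apply: (weight_components (c := wcomp s) aS (undup_uniq _) _ sumS) => [l|].
  exact: wcomp_weight.
by rewrite mem_undup inE eqxx.
Qed.

Lemma weight_vanish (w : int) (s s' : seq (int * V)) :
  (forall t, t \in s -> w < t.1 /\ weight t.1 t.2) ->
  (forall t, t \in s' -> t.1 <= w /\ weight t.1 t.2) ->
  \sum_(t <- s) t.2 = \sum_(t <- s') t.2 -> \sum_(t <- s) t.2 = 0.
Proof.
move=> hs hs' eq_sum; pose s1 := s ++ [seq (t.1, - t.2) | t <- s'].
have ws1 t : t \in s1 -> weight t.1 t.2.
  rewrite mem_cat => /orP[/hs[] //|/mapP[u /hs'[_ wu] ->]] /=.
  by rewrite -scaleN1r; apply: weightZ.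
have comp0 k : w < k -> wcomp s k = 0.
  move=> wk; have : wcomp s1 k \in (0%VS : {vspace V}).
    apply: wcomp_mem => //; first by move=> x; rewrite !memv0 => /eqP ->; rewrite linear0.
    by rewrite big_cat big_map /= sumrN eq_sum subrr mem0v.
  rewrite memv0 /wcomp big_cat big_map /= [X in _ + X]big_seq_cond [X in _ + X]big1 ?addr0.
    by move/eqP.
  by move=> t /andP[/hs'[tw _] /eqP tk]; move: wk; rewrite -tk ltNge tw.
have ur := undup_uniq [seq t.1 | t <- s].
rewrite (sum_wcomp xpredT ur) => [|t ts]; last by rewrite mem_undup map_f.
rewrite big_seq big1 // => k; rewrite mem_undup => /mapP[t /hs[wt _] ->].
exact: comp0.
Qed.

(** Truncation of a weight decomposition at [w] preserves stable subspaces and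
    projects onto [M w]. *)
Lemma gm_strict_lattice (M : int -> {vspace V}) :
  finite_increasing M -> splits alpha M ->
  strict_lattice (fun S => forall a : E, a != 0 -> stable (alpha a) S) M.
Proof.
have two0 : (2 : E) != 0 by rewrite ((pcharf0P E).1 charE).
move=> Mf aM; have [k0 M1] := fil_full Mf; split.
- move=> S T LS LT a a0 x /memv_capP[xS xT].
  by apply/memv_capP; split; [apply: LS|apply: LT].
- move=> S T LS LT a a0 _ /memv_addP[x xS [y yT ->]]; rewrite linearD.
  by apply: memv_add; [apply: LS|apply: LT].
move=> w S T x y LS LT xS yT /aM[sz [hz Ez]].
have [sx [hx Ex]] := (aM k0 x).1 (M1 _ _ (lexx _)).
have [sy [hy Ey]] := (aM k0 y).1 (M1 _ _ (lexx _)).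
pose trunc (s : seq (int * V)) := \sum_(t <- s | t.1 <= w) t.2.
have truncM s : (forall t, t \in s -> t.1 <= k0 /\ weight t.1 t.2) -> trunc s \in M w.
  move=> hs; apply/aM; exists [seq t <- s | t.1 <= w]; rewrite big_filter; split=> // t.
  by rewrite mem_filter => /andP[tw /hs[]].
have truncS s (U : {vspace V}) : (forall t, t \in s -> t.1 <= k0 /\ weight t.1 t.2) ->
    stable (alpha 2) U -> \sum_(t <- s) t.2 \in U -> trunc s \in U.
  move=> hs aU sU; have ur := undup_uniq [seq t.1 | t <- s].
  rewrite /trunc (sum_wcomp (fun k => k <= w) ur) => [|t ts]; last by rewrite mem_undup map_f.
  by apply: memv_suml => k _; apply: wcomp_mem => // t /hs[].
have truncE s : \sum_(t <- s) t.2 = trunc s + \sum_(t <- [seq t <- s | w < t.1]) t.2.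
  rewrite big_filter /trunc (bigID (fun t => t.1 <= w)) /=; congr (_ + _).
  by apply: eq_bigl => t; rewrite ltNge.
have xyM : trunc sx + trunc sy \in M w by rewrite memvD // truncM.
exists (trunc sx), (trunc sy); split; rewrite ?truncM //.
- by apply: truncS => //; [apply: LS|rewrite -Ex].
- by apply: truncS => //; [apply: LT|rewrite -Ey].
have /aM[s' [hs' Es']] : x + y - (trunc sx + trunc sy) \in M w.
  by apply: memvB => //; apply/aM; exists sz.
pose s := [seq t <- sx | w < t.1] ++ [seq t <- sy | w < t.1].
have hs t : t \in s -> w < t.1 /\ weight t.1 t.2.
  by rewrite mem_cat !mem_filter => /orP[/andP[? /hx[]]|/andP[? /hy[]]].
have Es : \sum_(t <- s) t.2 = x + y - (trunc sx + trunc sy).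
  rewrite big_cat /=; apply: (addrI (trunc sx + trunc sy)).
  by rewrite addrACA -!truncE -Ex -Ey; zmod.
have := weight_vanish hs hs'; rewrite Es -Es' => /(_ erefl) xy0.
by apply/esym/eqP; rewrite -subr_eq0 xy0.
Qed.

End WeightDecomposition.

(** * Deligne systems on subspaces, quotients and direct sums *)

Section NilpotentCommuting.
Context (K : fieldType) (n : nat).

Definition nilpotent_commuting (V : vectType K) (N : 'I_n -> 'End(V)) :=
  (forall j, nilpotent_lfun (N j)) /\ (forall i j x, N i (N j x) = N j (N i x)).

Lemma admissible_operatorsE (V : vectType K) W (N : 'I_n -> 'End(V)) Wj :
  monodromy_tower W N Wj -> admissible_operators W N <-> nilpotent_commuting N.
Proof.
move=> t; split=> [[nilN commN _]|[nilN commN]]; split=> //.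
- by move=> i j x; have /lfunP/(_ x) := commN i j; rewrite !comp_lfunE.
- by move=> i j; apply/lfunP=> x; rewrite !comp_lfunE.
move=> j w; apply/stableP; case: (t) => [[_ <-] _ _ _ _].
exact: (tower_stable t).
Qed.

Lemma nilpotent_commuting_sub (V X : vectType K) (N : 'I_n -> 'End(V))
    (NX : 'I_n -> 'End(X)) (j : 'Hom(X, V)) :
  injective j -> (forall i x, j (NX i x) = N i (j x)) ->
  nilpotent_commuting N -> nilpotent_commuting NX.
Proof.
move=> jinj jN [nilN commN]; split=> [i|i i' x].
  have [m Nm] := nilN i; exists m; apply/lfunP=> x; apply: jinj.
  by rewrite (pullback_iter (jN i)) Nm !lfunE linear0.
by apply: jinj; rewrite !jN.
Qed.

Lemma nilpotent_commuting_quotient (V X : vectType K) (N : 'I_n -> 'End(V))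
    (NX : 'I_n -> 'End(X)) (q : 'Hom(V, X)) :
  limg q = fullv -> (forall i x, q (N i x) = NX i (q x)) ->
  nilpotent_commuting N -> nilpotent_commuting NX.
Proof.
move=> qsurj qN [nilN commN]; split=> [i|i i' x'].
  have [m Nm] := nilN i; exists m; apply/lfunP=> x'.
  have [x ->] := surj_preimage qsurj x'.
  by rewrite -(pullback_iter (qN i)) Nm !lfunE linear0.
by have [x ->] := surj_preimage qsurj x'; rewrite -!qN commN.
Qed.

Lemma nilpotent_commuting_prod (A B : vectType K) (NA : 'I_n -> 'End(A))
    (NB : 'I_n -> 'End(B)) :
  nilpotent_commuting NA -> nilpotent_commuting NB ->
  nilpotent_commuting (fun i => prod_lfun (NA i) (NB i)).
Proof.
move=> [nilA commA] [nilB commB]; split=> [i|i i' x].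
  have [a Na] := nilA i; have [b Nb] := nilB i; exists (a + b)%N.
  apply/lfunP=> x; rewrite prod_lfun_iter addnC lfun_iterD Na addnC lfun_iterD Nb.
  by rewrite !lfunE /= !linear0.
by rewrite !prod_lfunE /= commA commB.
Qed.

End NilpotentCommuting.

Section DeligneSystems.
Context (E : fieldType) (n : nat).

(** The filtrations are part of the data here; conjugation by [alpha a] is
    written without its inverse. *)
Record deligne_structure (V : vectType E) (N : 'I_n -> 'End(V))
    (Wj : nat -> int -> {vspace V}) (alpha : E -> 'End(V)) : Prop := {
  dst_tower : monodromy_tower (Wj 0%N) N Wj;
  dst_nil : nilpotent_commuting N;
  dst_gm : is_Gm_action alpha;
  dst_splits : splits alpha (Wj n);
  dst_stable : forall (j : nat) (w : int) (a : E), (j < n)%N -> a != 0 ->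
    stable (alpha a) (Wj j w);
  dst_conj : forall (a : E) i x, a != 0 ->
    alpha a (N i x) = a ^- 2 *: N i (alpha a x)
}.

Lemma gm_inverse (V : vectType E) (alpha : E -> 'End(V)) a :
  is_Gm_action alpha -> a != 0 ->
  (alpha a \o (alpha a)^-1 = \1)%VF /\ ((alpha a)^-1 \o alpha a = \1)%VF.
Proof.
move=> [a1 aM _] a0.
have ker0 : lker (alpha a) == 0%VS.
  apply/lker0P=> x y Exy.
  have H z : alpha a^-1 (alpha a z) = z.
    by rewrite -comp_lfunE -aM ?invr_eq0 // mulVf // a1 id_lfunE.
  by rewrite -[x]H Exy H.
by rewrite lker0_compfV // lker0_compVf.
Qed.

Lemma is_deligne_systemE (V : vectType E) W (N : 'I_n -> 'End(V)) alpha :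
  is_deligne_system W N alpha <->
  exists2 Wj, deligne_structure N Wj alpha & (forall w, Wj 0%N w = W w).
Proof.
split=> [[admN gm [Wj [t spl stab conj]]]|[Wj [t nc gm spl stab conj] W0]].
  have W0 : (fun w => Wj 0%N w) = W by apply/funext; case: t => [[]].
  exists Wj; last by move=> w; rewrite -W0.
  split=> //; first by rewrite -W0 in t.
  - exact/(admissible_operatorsE t).
  - by move=> j w a jn a0; apply/stableP/stab.
  move=> a i x a0; have := conj a i a0; have [_ inv] := gm_inverse gm a0.
  move/(congr1 (fun f => (f \o alpha a)%VF)); rewrite -!comp_lfunA inv comp_lfun1r.
  by move/lfunP/(_ x); rewrite -comp_lfunZl scale_lfunE !comp_lfunE.
have {}W0 : (fun w => Wj 0%N w) = W by apply/funext.
rewrite -W0; split=> //; first exact/(admissible_operatorsE t).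
exists Wj; split=> //.
  by move=> j w a jn a0; apply/stableP/stab.
move=> a i a0; have [inv _] := gm_inverse gm a0.
apply/lfunP=> x; rewrite !comp_lfunE conj // scale_lfunE.
by rewrite -[alpha a _]comp_lfunE inv id_lfunE.
Qed.

Lemma dst_is_deligne_system (V : vectType E) (N : 'I_n -> 'End(V)) Wj alpha :
  deligne_structure N Wj alpha -> is_deligne_system (Wj 0%N) N alpha.
Proof. by move=> H; apply/is_deligne_systemE; exists Wj. Qed.

Section Structures.
Context (charE : [pchar E] =i pred0).

Section Sub.
Context (V : vectType E) (N : 'I_n -> 'End(V)) (Wj : nat -> int -> {vspace V}).
Context (alpha : E -> 'End(V)) (dst : deligne_structure N Wj alpha).

Definition gm_stable (S : {vspace V}) := forall a : E, a != 0 -> stable (alpha a) S.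

Lemma dst_strict_lattice : strict_lattice gm_stable (Wj n).
Proof.
apply: gm_strict_lattice => //; last exact: dst_splits dst.
exact: (tower_increasing (dst_tower dst)).
Qed.

Lemma gm_stable_fil k w : (k < n)%N -> gm_stable (Wj k w).
Proof. by move=> kn a a0; apply: (dst_stable dst). Qed.

Lemma dst_tower_lattice k : (k <= n)%N ->
  strict_lattice (tower_lattice N Wj gm_stable k) (Wj k).
Proof.
apply: (tower_strict_lattice (dst_tower dst)).
- exact: dst_strict_lattice.
- exact: gm_stable_fil.
Qed.

Lemma deligne_structure_sub (X : vectType E) (j : 'Hom(X, V)) (NX : 'I_n -> 'End(X))
    (WX : nat -> int -> {vspace X}) (alphaX : E -> 'End(X)) :
  injective j -> tower_lattice N Wj gm_stable 0 (limg j) ->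
  (forall i x, j (NX i x) = N i (j x)) ->
  (forall k w x, (x \in WX k w) = (j x \in Wj k w)) ->
  (forall a x, a != 0 -> j (alphaX a x) = alpha a (j x)) ->
  deligne_structure NX WX alphaX.
Proof.
move=> jinj TLj jN jW ja; have [t nc [a1 aM [s aE]] spl stab conj] := dst.
have two0 : (2 : E) != 0 by rewrite ((pcharf0P E).1 charE).
have weightj k x : has_weight alphaX k x <-> has_weight alpha k (j x).
  split=> H a a0; first by rewrite -ja // H // linearZ.
  by apply: jinj; rewrite ja // H // linearZ.
split.
- by apply: (tower_sub t dst_strict_lattice) TLj jN jW => // k w; apply: gm_stable_fil.
- exact: (nilpotent_commuting_sub jinj jN nc).
- split.
  + by apply/lfunP=> x; apply: jinj; rewrite ja ?oner_eq0 // a1 !id_lfunE.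
  + move=> a b a0 b0; apply/lfunP=> x; apply: jinj.
    by rewrite comp_lfunE !ja ?mulf_neq0 // aM // comp_lfunE.
  exists [seq (u.1, (j^-1 \o u.2 \o j)%VF) | u <- s] => a a0; apply/lfunP=> x.
  have -> : alphaX a x = (j^-1)%VF (alpha a (j x)).
    by rewrite -ja // lker0_lfunK //; apply/lker0P.
  rewrite aE // big_map !sum_lfunE linear_sum; apply: eq_bigr => u _ /=.
  by rewrite !scale_lfunE linearZ !comp_lfunE.
- move=> w x; rewrite jW spl; split=> [[r [hr Ex]]|[r [hr Ex]]].
    exists [seq (k, (j^-1)%VF (wcomp r k)) | k <- undup [seq u.1 | u <- r]].
    have stj : stable (alpha 2) (limg j) by case: TLj => /(_ 2 two0).
    have jwc k : j ((j^-1)%VF (wcomp r k)) = wcomp r k.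
      rewrite limg_lfunVK //; apply: (@wcomp_mem _ charE _ alpha); first exact: stj.
        by move=> u /hr[].
      by rewrite -Ex limg_all.
    split=> [v0 /mapP[k]|].
      rewrite mem_undup => /mapP[u /hr[uw _] ->] ->; split=> //=.
      by apply/weightj; rewrite jwc; apply: wcomp_weight => v /hr[].
    apply: jinj; rewrite big_map linear_sum Ex (sum_wcomp xpredT (undup_uniq [seq u.1 | u <- r])).
      by apply: eq_bigr => k _; rewrite /= jwc.
    by move=> u ur; rewrite mem_undup map_f.
  exists [seq (u.1, j u.2) | u <- r]; split=> [_ /mapP[u /hr[uw /weightj wu] ->] //|].
  by rewrite big_map Ex linear_sum.
- by move=> k w a kn a0 x; rewrite !jW ja //; apply: stab.
by move=> a i x a0; apply: jinj; rewrite ja // jN conj // linearZ /= jN ja.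
Qed.

Lemma deligne_structure_quotient (X : vectType E) (q : 'Hom(V, X))
    (NX : 'I_n -> 'End(X)) (alphaX : E -> 'End(X)) :
  limg q = fullv -> tower_lattice N Wj gm_stable 0 (lker q) ->
  (forall i x, q (N i x) = NX i (q x)) ->
  (forall a x, a != 0 -> q (alpha a x) = alphaX a (q x)) ->
  deligne_structure NX (fun k w => q @: Wj k w)%VS alphaX.
Proof.
move=> qsurj TLq qN qa; have [t nc [a1 aM [s aE]] spl stab conj] := dst.
have two0 : (2 : E) != 0 by rewrite ((pcharf0P E).1 charE).
have weightq k x : has_weight alpha k x -> has_weight alphaX k (q x).
  by move=> H a a0; rewrite -qa // H // linearZ.
split.
- apply: (tower_quotient t dst_strict_lattice) TLq qN => //.
    by move=> k w; apply: gm_stable_fil.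
  by move=> a _ x _; rewrite memvf.
- exact: (nilpotent_commuting_quotient qsurj qN nc).
- split.
  + apply/lfunP=> x'; have [x ->] := surj_preimage qsurj x'.
    by rewrite -qa ?oner_eq0 // a1 !id_lfunE.
  + move=> a b a0 b0; apply/lfunP=> x'; have [x ->] := surj_preimage qsurj x'.
    by rewrite comp_lfunE -!qa ?mulf_neq0 // aM // comp_lfunE.
  exists [seq (u.1, (q \o u.2 \o q^-1)%VF) | u <- s] => a a0; apply/lfunP=> x'.
  have Ex : q ((q^-1)%VF x') = x' by rewrite limg_lfunVK // qsurj memvf.
  rewrite -[in LHS]Ex -qa // aE // big_map !sum_lfunE linear_sum.
  by apply: eq_bigr => u _ /=; rewrite !scale_lfunE linearZ !comp_lfunE.
- move=> w x'; split.
    case/memv_imgP=> x /spl[r [hr ->]] ->.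
    exists [seq (u.1, q u.2) | u <- r]; rewrite big_map linear_sum; split=> //.
    by move=> _ /mapP[u /hr[uw wu] ->]; split=> //; apply: weightq.
  case=> r [hr ->].
  suff H u : u \in r -> u.2 \in (q @: Wj n w)%VS by rewrite big_seq; apply: memv_suml.
  move=> /hr[uw wu]; have Wnf := tower_increasing t (leqnn n).
  have [k0 W1] := fil_full Wnf.
  have [x Ex] := surj_preimage qsurj u.2.
  have [sx [hx Esx]] := (spl k0 x).1 (W1 _ _ (lexx _)).
  (* the component of weight [u.1] of a preimage of [u.2] is a preimage *)
  have wy : has_weight alpha u.1 (wcomp sx u.1) by apply: wcomp_weight => v /hx[].
  have -> : u.2 = q (wcomp sx u.1); last first.
    apply: memv_img; apply/spl; exists [:: (u.1, wcomp sx u.1)].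
    by split=> [_ /predU1P[->|]//|]; rewrite big_seq1.
  pose sq := (u.1, - u.2) :: [seq (v.1, q v.2) | v <- sx].
  have : wcomp sq u.1 \in (0%VS : {vspace X}).
    apply: (@wcomp_mem _ charE _ alphaX).
    - by move=> z; rewrite !memv0 => /eqP ->; rewrite linear0.
    - move=> v; rewrite inE => /predU1P[->|/mapP[v' /hx[_ wv'] ->]] /=.
        by rewrite -scaleN1r; apply: weightZ.
      exact: weightq.
    by rewrite big_cons big_map /= -linear_sum -Esx /= -Ex addNr mem0v.
  rewrite memv0 /wcomp big_cons big_map /= eqxx -linear_sum -/(wcomp sx u.1).
  by rewrite addrC subr_eq0 => /eqP.
- move=> k w a kn a0 _ /memv_imgP[x xW ->]; rewrite -qa // memv_img //.
  exact: stab.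
move=> a i x' a0; have [x ->] := surj_preimage qsurj x'.
by rewrite -qN -!qa // conj // linearZ /= qN.
Qed.

End Sub.

Lemma deligne_structure_sum (A B : vectType E) NA NB WA WB alphaA alphaB :
  @deligne_structure A NA WA alphaA -> @deligne_structure B NB WB alphaB ->
  deligne_structure (fun i => prod_lfun (NA i) (NB i))
    (fun j w => prodv (WA j w) (WB j w)) (fun a => prod_lfun (alphaA a) (alphaB a)).
Proof.
move=> [tA ncA [a1 aM [s aE]] splA stabA conjA] [tB ncB [b1 bM [s' bE]] splB stabB conjB].
have fst_sum (I : Type) (r : seq I) (F : I -> (A * B)%type) :
    (\sum_(i <- r) F i).1 = \sum_(i <- r) (F i).1.
  by rewrite -fst_lfunE linear_sum; apply: eq_bigr => i _; rewrite /= fst_lfunE.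
have snd_sum (I : Type) (r : seq I) (F : I -> (A * B)%type) :
    (\sum_(i <- r) F i).2 = \sum_(i <- r) (F i).2.
  by rewrite -snd_lfunE linear_sum; apply: eq_bigr => i _; rewrite /= snd_lfunE.
have weightE k (x : (A * B)%type) : has_weight (fun a => prod_lfun (alphaA a) (alphaB a)) k x <->
    has_weight alphaA k x.1 /\ has_weight alphaB k x.2.
  split=> [H|[H1 H2] a a0]; last by rewrite prod_lfunE H1 ?H2.
  by split=> a a0; have := H a a0; rewrite prod_lfunE; case: x {H} => x y [].
split.
- exact: tower_sum.
- exact: nilpotent_commuting_prod.
- split.
  + by apply/lfunP=> -[x y]; rewrite prod_lfunE a1 b1 !id_lfunE.
  + move=> a b a0 b0; apply/lfunP=> x.
    by rewrite comp_lfunE !prod_lfunE aM // bM // !comp_lfunE.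
  exists ([seq (u.1, prod_lfun u.2 0) | u <- s] ++ [seq (u.1, prod_lfun 0 u.2) | u <- s']).
  move=> a a0; apply/lfunP=> x; rewrite prod_lfunE aE // bE // big_cat !big_map.
  rewrite lfunE /= !sum_lfunE [RHS]surjective_pairing /= !fst_sum !snd_sum; congr pair.
    rewrite [X in _ = _ + X]big1 => [|u _]; last by rewrite scale_lfunE prod_lfunE /= lfunE scaler0.
    by rewrite addr0; apply: eq_bigr => u _; rewrite !scale_lfunE prod_lfunE.
  rewrite [X in _ = X + _]big1 => [|u _]; last by rewrite scale_lfunE prod_lfunE /= lfunE scaler0.
  by rewrite add0r; apply: eq_bigr => u _; rewrite !scale_lfunE prod_lfunE.
- move=> w x; rewrite memv_prodv; split.
    case/andP=> /splA[r [hr Ex]] /splB[r' [hr' Ex']].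
    exists ([seq (u.1, (u.2, 0)) | u <- r] ++ [seq (u.1, (0, u.2)) | u <- r']); split.
      move=> u; rewrite mem_cat => /orP[/mapP[v /hr[vw wv] ->]|/mapP[v /hr'[vw wv] ->]].
        by split=> //; apply/weightE; split=> //; apply: weight0.
      by split=> //; apply/weightE; split=> //; apply: weight0.
    rewrite big_cat !big_map [RHS]surjective_pairing /= !fst_sum !snd_sum /= -Ex -Ex'.
    by rewrite !big1_eq addr0 add0r -surjective_pairing.
  case=> r [hr ->]; rewrite fst_sum snd_sum.
  apply/andP; split; [apply/splA|apply/splB].
    exists [seq (u.1, u.2.1) | u <- r]; rewrite big_map; split=> // _ /mapP[u /hr[uw /weightE[wu _]] ->].
    by [].
  exists [seq (u.1, u.2.2) | u <- r]; rewrite big_map; split=> // _ /mapP[u /hr[uw /weightE[_ wu]] ->].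
  by [].
- move=> j w a jn a0 x; rewrite prod_lfunE !memv_prodv => /andP[xA xB].
  by rewrite stabA ?stabB.
by move=> a i x a0; rewrite !prod_lfunE /= conjA // conjB.
Qed.

End Structures.
End DeligneSystems.

(** * The category of Deligne systems *)

Section Biproduct.
Context (K : fieldType) (A B : vectType K).

Lemma inl_lfunE a : pair_lfun \1 0 a = ((a, 0) : (A * B)%type).
Proof. by rewrite pair_lfunE zero_lfunE id_lfunE. Qed.

Lemma inr_lfunE b : pair_lfun 0 \1 b = ((0, b) : (A * B)%type).
Proof. by rewrite pair_lfunE zero_lfunE id_lfunE. Qed.

Lemma prod_biproduct (i1 := pair_lfun \1 0 : 'Hom(A, (A * B)%type))
    (i2 := pair_lfun 0 \1 : 'Hom(B, (A * B)%type))
    (p1 := fst_lfun A B) (p2 := snd_lfun A B) :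
  [/\ (p1 \o i1 = \1)%VF, (p2 \o i2 = \1)%VF, (p1 \o i2 = 0)%VF, (p2 \o i1 = 0)%VF
    & (i1 \o p1)%VF + (i2 \o p2)%VF = \1%VF].
Proof.
split; apply/lfunP=> x; rewrite ?add_lfunE !comp_lfunE ?inl_lfunE ?inr_lfunE
  ?fst_lfunE ?snd_lfunE ?id_lfunE ?zero_lfunE //.
by case: x => x y; congr pair; rewrite /= ?addr0 ?add0r.
Qed.

End Biproduct.

Section GraphTrick.
Context (K : fieldType) (A B : vectType K) (f : 'Hom(A, B)).

Let J0 := limg (graph (0 : 'Hom(A, B))).
Let Jf := limg (graph f).

Lemma graph_kernel :
  is_lin_kernel f (fst_lfun A B \o sub_incl (Jf :&: J0)%VS)%VF.
Proof.
have memJ x : (x \in (Jf :&: J0)%VS) = (x.2 == 0) && (f x.1 == 0).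
  rewrite memv_cap !memv_graph zero_lfunE [RHS]andbC.
  by case: (x.2 =P 0) => [->|_]; rewrite ?andbT ?andbF // eq_sym.
split.
  apply/eqP/lker0P=> x y; rewrite !comp_lfunE !fst_lfunE !sub_inclE => E.
  apply/subvs_inj; have := subvsP x; have := subvsP y; rewrite !memJ.
  case/andP=> /eqP y2 _ /andP[/eqP x2 _].
  by rewrite [LHS]surjective_pairing [RHS]surjective_pairing E x2 y2.
apply/vspaceP=> a; rewrite memv_ker; apply/memv_imgP/idP=> [[x _ ->]|fa].
  rewrite comp_lfunE fst_lfunE sub_inclE.
  by have := subvsP x; rewrite memJ => /andP[].
have aJ : ((a, 0) : (A * B)%type) \in (Jf :&: J0)%VS by rewrite memJ /= eqxx.
by exists (Subvs aJ); rewrite ?memvf // comp_lfunE fst_lfunE sub_inclE.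
Qed.

Lemma graph_cokernel (X : vectType K) (q : 'Hom((A * B)%type, X)) :
  limg q = fullv -> lker q = (Jf + J0)%VS ->
  is_lin_cokernel f (q \o pair_lfun 0 \1)%VF.
Proof.
move=> qsurj ker_q.
have J0q (a : A) : q (a, 0) = 0.
  apply/eqP; rewrite -memv_ker ker_q; apply: (subvP (addvSr _ _)).
  by rewrite memv_graph zero_lfunE.
have qE (a : A) (b : B) : q (a, b) = q (0, b).
  have -> : ((a, b) : (A * B)%type) = (a, 0) + (0, b) by congr pair; rewrite /= ?addr0 ?add0r.
  by rewrite linearD /= J0q add0r.
split.
  apply/eqP; rewrite eqEsubv subvf; apply/subvP=> x _.
  have [[a b] ->] := surj_preimage qsurj x.
  by rewrite qE -inr_lfunE -comp_lfunE limg_all.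
apply/vspaceP=> b; rewrite memv_ker comp_lfunE inr_lfunE -memv_ker ker_q.
apply/memv_addP/memv_imgP=> [[u]|[a _ ->]].
  rewrite memv_graph => /eqP u2 [v]; rewrite memv_graph zero_lfunE => /eqP v2.
  case/pair_equal_spec=> _ ->; exists u.1; rewrite ?memvf //.
  by change (u.2 + v.2 = f u.1); rewrite v2 addr0.
exists (a, f a); first by rewrite memv_graph.
exists (- a, 0); first by rewrite memv_graph zero_lfunE.
by congr pair; rewrite /= ?subrr ?addr0.
Qed.

(** Strictness of [f] is distributivity applied to the graphs of [f] and [0]. *)
Lemma graph_strict L (MA : int -> {vspace A}) (MB : int -> {vspace B}) w b :
  strict_lattice L (fun k => prodv (MA k) (MB k)) -> L Jf -> L J0 ->
  b \in limg f -> b \in MB w -> exists2 a, a \in MA w & b = f a.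
Proof.
move=> sl Lf L0 /memv_imgP[a _ ->] fM.
have aJf : ((a, f a) : (A * B)%type) \in Jf by rewrite memv_graph.
have aJ0 : ((- a, 0) : (A * B)%type) \in J0 by rewrite memv_graph zero_lfunE.
have sumM : ((a, f a) : (A * B)%type) + (- a, 0) \in prodv (MA w) (MB w).
  by rewrite memv_prodv /= subrr addr0 mem0v.
have [x [y [xJ yJ xM _ /(congr1 snd)/= E]]] := sl_dist (k := w) sl Lf L0 aJf aJ0 sumM.
exists x.1; first by move: xM; rewrite memv_prodv => /andP[].
move: xJ yJ; rewrite !memv_graph zero_lfunE => /eqP <- /eqP y0.
by move: E; rewrite y0 !addr0.
Qed.

End GraphTrick.

Section DeligneCategory.
Context (E : fieldType) (charE : [pchar E] =i pred0) (n : nat).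

Lemma ds_structure (A : deligneSystem E n) :
  exists2 Wj, deligne_structure (ds_N A) Wj (ds_alpha A) & Wj 0%N = ds_W A.
Proof.
have /is_deligne_systemE[Wj dst W0] := ds_axioms A.
by exists Wj => //; apply/funext.
Qed.

Lemma ds_morE (A B : deligneSystem E n) (f : 'Hom(A, B)) :
  ds_mor f <-> [/\ forall w x, x \in ds_W A w -> f x \in ds_W B w,
    forall i x, f (ds_N A i x) = ds_N B i (f x)
  & forall a x, a != 0 -> f (ds_alpha A a x) = ds_alpha B a (f x)].
Proof.
split=> [[fW fN fa]|[fW fN fa]]; split.
- by move=> w x xW; apply: (subvP (fW w)); apply: memv_img.
- by move=> i x; have /lfunP/(_ x) := fN i; rewrite !comp_lfunE.
- by move=> a x a0; have /lfunP/(_ x) := fa a a0; rewrite !comp_lfunE.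
- by move=> w; apply/subvP=> _ /memv_imgP[x xW ->]; apply: fW.
- by move=> i; apply/lfunP=> x; rewrite !comp_lfunE.
- by move=> a a0; apply/lfunP=> x; rewrite !comp_lfunE fa.
Qed.

Section Morphism.
Context (A B : deligneSystem E n) (WA : nat -> int -> {vspace A})
  (WB : nat -> int -> {vspace B}).
Context (dA : deligne_structure (ds_N A) WA (ds_alpha A)) (WA0 : WA 0%N = ds_W A).
Context (dB : deligne_structure (ds_N B) WB (ds_alpha B)) (WB0 : WB 0%N = ds_W B).

Let NC i := prod_lfun (ds_N A i) (ds_N B i).
Let WC j w := prodv (WA j w) (WB j w).
Let aC a := prod_lfun (ds_alpha A a) (ds_alpha B a).

Let dC : deligne_structure NC WC aC := deligne_structure_sum dA dB.

Local Notation TL := (tower_lattice NC WC (gm_stable aC) 0).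

Let slC : strict_lattice TL (WC 0).
Proof. exact: (dst_tower_lattice charE dC). Qed.

Lemma ds_graph_lattice (f : 'Hom(A, B)) : ds_mor f -> TL (limg (graph f)).
Proof.
case/ds_morE=> fW fN fa.
apply: (tower_lattice_limg (dst_tower dC) (dst_tower dA)).
- by move=> i x; rewrite !graphE prod_lfunE fN.
- move=> k w x kn; rewrite graphE memv_prodv /=; apply/idP/andP=> [xW|[]//]; split=> //.
  apply: (tower_functorial (dst_tower dA) (dst_tower dB) fN _ kn xW) => v y.
  by rewrite WA0 WB0; apply: fW.
move=> a a0 x; rewrite !memv_graph prod_lfunE /= => /eqP ->.
by rewrite fa.
Qed.

Let TL0 : TL (limg (graph (0 : 'Hom(A, B)))).
Proof. exact/ds_graph_lattice/ds_mor0. Qed.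

(** Strictness for [W] is the distributivity of the lowest filtration of the
    tower, at the end of the descent. *)
Lemma ds_strict_at (f : 'Hom(A, B)) w b : ds_mor f ->
  b \in limg f -> b \in ds_W B w -> exists2 a, a \in ds_W A w & b = f a.
Proof.
move=> hf bf; rewrite -WB0 -WA0 => bW.
exact: (graph_strict slC (ds_graph_lattice hf) TL0).
Qed.

Lemma ds_kernel_at (f : 'Hom(A, B)) : ds_mor f ->
  exists (X : deligneSystem E n) (i : 'Hom(X, A)), ds_mor i /\ is_lin_kernel f i.
Proof.
move=> hf; pose J := (limg (graph f) :&: limg (graph (0%R : 'Hom(A, B))))%VS.
have TLJ : TL J := sl_cap slC (ds_graph_lattice hf) TL0.
pose j := sub_incl J; have jinj := @sub_incl_inj _ _ J; have jJ := limg_sub_incl J.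
pose NX i := (j^-1 \o NC i \o j)%VF; pose aX a := (j^-1 \o aC a \o j)%VF.
have jN i x : j (NX i x) = NC i (j x).
  by apply: lift_injective => //; rewrite jJ; case: TLJ => _ /(_ i (leq0n i))[].
have ja a x : a != 0 -> j (aX a x) = aC a (j x).
  by move=> a0; apply: lift_injective => //; rewrite jJ; case: TLJ => /(_ a a0).
pose WX k w := (j @^-1: WC k w)%VS.
have dX : deligne_structure NX WX aX.
  apply: (deligne_structure_sub charE dC jinj _ jN _ ja); first by rewrite jJ.
  by move=> k w x; rewrite -memv_preim.
exists (DeligneSystem (dst_is_deligne_system dX)), (fst_lfun A B \o j)%VF.
split; last exact: graph_kernel.
have iE x : (fst_lfun A B \o j)%VF x = (j x).1 by rewrite comp_lfunE fst_lfunE.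
apply/ds_morE; split=> [w x|i x|a x a0] /=; rewrite !iE.
- by rewrite -memv_preim memv_prodv WA0 => /andP[].
- by rewrite jN prod_lfunE.
- by rewrite ja // prod_lfunE.
Qed.

Lemma ds_cokernel_at (f : 'Hom(A, B)) : ds_mor f ->
  exists (X : deligneSystem E n) (p : 'Hom(B, X)), ds_mor p /\ is_lin_cokernel f p.
Proof.
move=> hf; pose J := (limg (graph f) + limg (graph (0%R : 'Hom(A, B))))%VS.
have TLJ : TL J := sl_add slC (ds_graph_lattice hf) TL0.
have [X [q [qsurj qJ]]] := quotient_exists J.
pose NX i := (q \o NC i \o q^-1)%VF; pose aX a := (q \o aC a \o q^-1)%VF.
have qN i x : q (NC i x) = NX i (q x).
  by apply: lift_surjective => //; rewrite qJ; case: TLJ => _ /(_ i (leq0n i))[].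
have qa a x : a != 0 -> q (aC a x) = aX a (q x).
  by move=> a0; apply: lift_surjective => //; rewrite qJ; case: TLJ => /(_ a a0).
have dX : deligne_structure NX (fun k w => q @: WC k w)%VS aX.
  by apply: (deligne_structure_quotient charE dC qsurj _ qN qa); rewrite qJ.
exists (DeligneSystem (dst_is_deligne_system dX)), (q \o pair_lfun 0 \1)%VF.
split; last exact: graph_cokernel.
have qpE b : (q \o pair_lfun 0 \1)%VF b = q (0, b) by rewrite comp_lfunE inr_lfunE.
apply/ds_morE; split=> [w x|i x|a x a0] /=; rewrite !qpE.
- by move=> xW; apply: memv_img; rewrite memv_prodv mem0v WB0.
- by rewrite -qN prod_lfunE /= linear0.
- by rewrite -qa // prod_lfunE /= linear0.
Qed.

Lemma ds_sum_at : exists (T : deligneSystem E n) (i1 : 'Hom(A, T)) (i2 : 'Hom(B, T))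
    (p1 : 'Hom(T, A)) (p2 : 'Hom(T, B)),
  [/\ ds_mor i1, ds_mor i2, ds_mor p1 & ds_mor p2] /\
  [/\ (p1 \o i1 = \1)%VF, (p2 \o i2 = \1)%VF, (p1 \o i2 = 0)%VF, (p2 \o i1 = 0)%VF
    & (i1 \o p1)%VF + (i2 \o p2)%VF = \1%VF].
Proof.
exists (DeligneSystem (dst_is_deligne_system dC)), (pair_lfun \1 0), (pair_lfun 0 \1),
  (fst_lfun A B), (snd_lfun A B).
split; last exact: prod_biproduct.
split; apply/ds_morE; split=> [w x|i x|a x a0] /=.
- by rewrite inl_lfunE memv_prodv mem0v WA0 => ->.
- by rewrite !inl_lfunE prod_lfunE linear0.
- by rewrite !inl_lfunE prod_lfunE linear0.
- by rewrite inr_lfunE memv_prodv mem0v WB0 => ->.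
- by rewrite !inr_lfunE prod_lfunE linear0.
- by rewrite !inr_lfunE prod_lfunE linear0.
- by rewrite fst_lfunE memv_prodv WA0 => /andP[].
- by rewrite !fst_lfunE prod_lfunE.
- by rewrite !fst_lfunE prod_lfunE.
- by rewrite snd_lfunE memv_prodv WB0 => /andP[].
- by rewrite !snd_lfunE prod_lfunE.
- by rewrite !snd_lfunE prod_lfunE.
Qed.

End Morphism.

Lemma ds_strict (A B : deligneSystem E n) (f : 'Hom(A, B)) w b : ds_mor f ->
  b \in limg f -> b \in ds_W B w -> exists2 a, a \in ds_W A w & b = f a.
Proof.
have [WA dA WA0] := ds_structure A; have [WB dB WB0] := ds_structure B.
exact: (ds_strict_at dA WA0 dB WB0).
Qed.

Lemma ds_injective_W (A B : deligneSystem E n) (f : 'Hom(A, B)) w : ds_mor f ->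
  lker f = 0%VS -> ds_W A w = (f @^-1: ds_W B w)%VS.
Proof.
move=> hf /eqP/lker0P finj; apply/vspaceP=> x; rewrite -memv_preim.
apply/idP/idP=> [xW|fxW]; first by case/ds_morE: hf => fW _ _; apply: fW.
by have [a aW /finj ->] := ds_strict hf (limg_all f x) fxW.
Qed.

Lemma ds_surjective_W (A B : deligneSystem E n) (f : 'Hom(A, B)) w : ds_mor f ->
  limg f = fullv -> ds_W B w = (f @: ds_W A w)%VS.
Proof.
move=> hf fsurj; apply/vspaceP=> x; apply/idP/memv_imgP=> [xW|[a aW ->]].
  by apply: ds_strict => //; rewrite fsurj memvf.
by case/ds_morE: hf => fW _ _; apply: fW.
Qed.

Local Notation C := (deligne_linCat E n).

Lemma ds_initial (A B : deligneSystem E n) (f : lhom (C := C) A B) :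
  lker f = 0%VS -> initial_mor (C := C) f.
Proof.
move=> kerf T g /ds_morE[gW gN ga]; have hf := lhomP f.
have [_ fN fa] := (ds_morE _).1 hf; have /eqP/lker0P finj := kerf.
apply/ds_morE; split=> [w x xW|i x|a x a0].
- rewrite (ds_injective_W w hf kerf) -memv_preim -comp_lfunE; exact: gW.
- by have := gN i x; rewrite !comp_lfunE -fN => /finj.
- by have := ga a x a0; rewrite !comp_lfunE -fa // => /finj.
Qed.

Lemma ds_final (A B : deligneSystem E n) (f : lhom (C := C) A B) :
  limg f = fullv -> final_mor (C := C) f.
Proof.
move=> fsurj T g /ds_morE[gW gN ga]; have hf := lhomP f.
have [_ fN fa] := (ds_morE _).1 hf.
apply/ds_morE; split=> [w x|i x'|a x' a0].
- rewrite (ds_surjective_W w hf fsurj) => /memv_imgP[a aW ->].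
  by rewrite -comp_lfunE; apply: gW.
- by have [x ->] := surj_preimage fsurj x'; have := gN i x; rewrite !comp_lfunE fN.
- by have [x ->] := surj_preimage fsurj x'; have := ga a x a0; rewrite !comp_lfunE fa.
Qed.

End DeligneCategory.

Section ZeroSpace.
Context (K : fieldType).

Lemma zero_mem (V : vectType K) (U : {vspace V}) x : (forall y : V, y = 0) -> x \in U.
Proof. by move=> V0; rewrite (V0 x) mem0v. Qed.

Lemma zero_vspace (V : vectType K) (U U' : {vspace V}) : (forall x : V, x = 0) -> U = U'.
Proof. by move=> V0; apply/vspaceP=> x; rewrite !zero_mem. Qed.

Lemma zero_increasing (V : vectType K) (W : int -> {vspace V}) :
  (forall x : V, x = 0) -> finite_increasing W.
Proof.
move=> V0; split; [by move=> *; apply/subvP=> x _; apply: zero_mem| |];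
  by exists 0; apply: zero_vspace.
Qed.

Lemma zero_relative_monodromy (V : vectType K) (N : 'End(V)) W M :
  (forall x : V, x = 0) -> is_relative_monodromy N W M.
Proof.
move=> V0; split; first exact: zero_increasing.
  by move=> w; apply/subvP=> x _; apply: zero_mem.
move=> w m; split=> [||x _ _|y _]; try by apply/subvP=> x _; apply: zero_mem.
  exact: zero_mem.
by exists 0; rewrite zero_mem.
Qed.

Lemma zero_tower n (V : vectType K) W (N : 'I_n -> 'End(V)) Wj :
  (forall x : V, x = 0) -> monodromy_tower W N Wj.
Proof.
move=> V0; split.
- by split=> [|w]; [apply: zero_increasing|apply: zero_vspace].
- by move=> i; apply: zero_relative_monodromy.
- by move=> i k w _; apply: zero_relative_monodromy => x; apply/subvs_inj/V0.
- by move=> *; apply/subvP=> x _; apply: zero_mem.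
- by move=> *; apply/subvP=> x _; apply: zero_mem.
Qed.

Lemma zero_nilpotent_commuting n (V : vectType K) (N : 'I_n -> 'End(V)) :
  (forall x : V, x = 0) -> nilpotent_commuting N.
Proof.
move=> V0; split=> [i|i j x]; last by rewrite [LHS]V0 [RHS]V0.
by exists 0%N; apply/lfunP=> x; rewrite [LHS]V0 [RHS]V0.
Qed.

Lemma row0_eq0 (x : 'rV[K]_0) : x = 0.
Proof. by apply/rowP=> -[]. Qed.

End ZeroSpace.

Section DeligneAbelian.
Context (E : fieldType) (charE : [pchar E] =i pred0) (n : nat).

Lemma ds_zero : exists Z : deligneSystem E n, (fullv : {vspace Z}) = 0%VS.
Proof.
have V0 := @row0_eq0 E; pose one_action (a : E) : 'End('rV[E]_0) := \1%VF.
have dZ : deligne_structure (fun _ : 'I_n => 0) (fun _ _ => fullv) one_action.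
  split.
  - exact: zero_tower.
  - exact: zero_nilpotent_commuting.
  - split=> // [a b _ _|]; first by apply/lfunP=> x; rewrite [LHS]V0 [RHS]V0.
    by exists [::] => a _; apply/lfunP=> x; rewrite [LHS]V0 [RHS]V0.
  - move=> w v; split=> [_|_]; last exact: memvf.
    by exists [::]; split=> //; rewrite [LHS]V0 [RHS]V0.
  - by move=> j w a _ _ x _; apply: memvf.
  - by move=> a i x _; rewrite [LHS]V0 [RHS]V0.
by exists (DeligneSystem (dst_is_deligne_system dZ)); apply: zero_vspace.
Qed.

Local Notation C := (deligne_linCat E n).

Lemma ds_lin_kernel (A B : lobj C) (f : lhom A B) :
  exists (X : lobj C) (i : lhom X A), is_lin_kernel f i.
Proof.
have [WA dA WA0] := ds_structure A; have [WB dB WB0] := ds_structure B.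
have [X [i [hi ker_i]]] := ds_kernel_at charE dA WA0 dB WB0 (lhomP f).
by exists X, (LHom (asboolT (hi : lmor (l := C) i))).
Qed.

Lemma ds_lin_cokernel (A B : lobj C) (f : lhom A B) :
  exists (X : lobj C) (p : lhom B X), is_lin_cokernel f p.
Proof.
have [WA dA WA0] := ds_structure A; have [WB dB WB0] := ds_structure B.
have [X [p [hp coker_p]]] := ds_cokernel_at charE dA WA0 dB WB0 (lhomP f).
by exists X, (LHom (asboolT (hp : lmor (l := C) p))).
Qed.

Lemma ds_biproduct (A B : deligneCat E n) : exists T
  (i1 : mor A T) (i2 : mor B T) (p1 : mor T A) (p2 : mor T B),
  is_biproduct i1 i2 p1 p2.
Proof.
have [WA dA WA0] := ds_structure A; have [WB dB WB0] := ds_structure B.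
have [T [i1 [i2 [p1 [p2 [[h1 h2 h3 h4] [e1 e2 e3 e4 e5]]]]]]] := ds_sum_at dA WA0 dB WB0.
exists T, (LHom (asboolT (h1 : lmor (l := C) i1))), (LHom (asboolT (h2 : lmor (l := C) i2))).
exists (LHom (asboolT (h3 : lmor (l := C) p1))), (LHom (asboolT (h4 : lmor (l := C) p2))).
by split; apply/val_inj.
Qed.

Theorem deligne_abelian :
  is_abelian (deligneCat E n) /\
  forall (A B : deligneCat E n) (f : mor A B),
    (forall (X : deligneCat E n) (i : mor X A), is_kernel f i <-> ds_kernel f i) /\
    (forall (X : deligneCat E n) (p : mor B X), is_cokernel f p <-> ds_cokernel f p).
Proof.
have ini := @ds_initial E charE n; have fin := @ds_final E charE n.
split.
  exact: (@lin_abelian _ C ini fin ds_lin_kernel ds_lin_cokernel ds_zero ds_biproduct).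
move=> A B f; split=> X g; have hg : ds_mor g := lhomP g; have [_ gN ga] := hg.
  apply: (iff_trans (is_kernelP (C := C) ini ds_lin_kernel f g)); split=> [ker_g|[]//].
  split=> // w; case: ker_g => ker_g _.
  exact: (ds_injective_W charE w hg ker_g).
apply: (iff_trans (is_cokernelP (C := C) fin ds_lin_cokernel f g)); split=> [coker_g|[]//].
split=> //; first by case: coker_g => im_g _ w; apply: (ds_surjective_W charE w hg im_g).
by move=> a a0; rewrite ga.
Qed.

End DeligneAbelian.

(** * Opposed filtrations *)

Section OpposedFiltrations.
Context (K : fieldType).

Section OneSpace.
Context (V : vectType K).
Implicit Types (W F G : int -> {vspace V}) (S T : {vspace V}).

(** The two halves of the condition that [F] and [G] are opposed of weight [w]
    on the graded piece of weight [w]: there, the steps [p] and [w + 1 - p] span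
    everything and meet in zero. A subspace [S] inherits the second half but
    not the first one. *)
Definition opp_sur W F G S := forall (w p : int) x, x \in S -> x \in W w ->
  exists f g, [/\ f \in S, f \in F p, f \in W w & g \in S] /\
    [/\ g \in G (w + 1 - p), g \in W w & x - f - g \in W (w - 1)].

Definition opp_inj W F G := forall (w p : int) f g,
  f \in F p -> f \in W w -> g \in G (w + 1 - p) -> g \in W w ->
  f + g \in W (w - 1) -> f \in W (w - 1).

Lemma opp_sur_sym W F G S : opp_sur W F G S -> opp_sur W G F S.
Proof.
move=> H w p x xS xW.
have [f [g [[fS fF fW gS] [gG gW E]]]] := H w (w + 1 - p) x xS xW.
exists g, f; split; split=> //.
  by move: gG; congr (_ \in G _); ilia.
by have -> : x - g - f = x - f - g by zmod.
Qed.

Lemma opp_inj_sym W F G : opp_inj W F G -> opp_inj W G F.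
Proof.
move=> H w p g f gG gW fF fW E.
suff fW' : f \in W (w - 1) by rewrite -[g](addrK f); memvs.
apply: (H w (w + 1 - p) f g) => //; last by rewrite addrC.
by move: gG; congr (_ \in G _); ilia.
Qed.

Context (W F G : int -> {vspace V}).
Context (Wf : finite_increasing W) (Ff : finite_decreasing F) (Gf : finite_decreasing G).
Context (inj : opp_inj W F G).

Let W_le u v x : u <= v -> x \in W u -> x \in W v.
Proof. exact: fil_incr. Qed.

Lemma opp_sur_fil S u : opp_sur W F G S -> opp_sur W F G (S :&: W u)%VS.
Proof.
move=> sS w p x /memv_capP[xS xu] xw; case: (leP w u) => [wu|uw].
  have [f [g [[fS fF fW gS] [gG gW E]]]] := sS w p x xS xw.
  by exists f, g; split; split=> //; apply/memv_capP; split=> //; apply: (W_le wu).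
exists 0, 0; rewrite !mem0v !subr0; split; split=> //.
by apply: (W_le _ xu); ilia.
Qed.

Section Pair.
Context (S T : {vspace V}) (sS : opp_sur W F G S) (sT : opp_sur W F G T).

Let split2 w p s t : s \in S -> s \in W w -> t \in T -> t \in W w ->
  exists f1 f2 g1 g2, [/\ f1 \in S, f2 \in T, g1 \in S & g2 \in T] /\
    [/\ f1 \in W w, f2 \in W w, g1 \in W w & g2 \in W w] /\
    [/\ f1 \in F p, f2 \in F p, g1 \in G (w + 1 - p) & g2 \in G (w + 1 - p)] /\
    s - f1 - g1 \in W (w - 1) /\ t - f2 - g2 \in W (w - 1).
Proof.
move=> sS' sw tT' tw.
have [f1 [g1 [[? ? ? ?] [? ? ?]]]] := sS p sS' sw.
have [f2 [g2 [[? ? ? ?] [? ? ?]]]] := sT p tT' tw.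
by exists f1, f2, g1, g2; do !split.
Qed.

Section Level.
Context (u : int) (IHu : forall v, v <= u - 1 -> dist_at W S T v).

Let Q := (S :&: W (u - 1) + T :&: W (u - 1))%VS.

(* The quotient of [W (u - 1)] by [Q] has weights below [u], so it has no
   nonzero element of type [(p, u - p)]. *)
Let no_type p v a b : v <= u - 1 -> a \in F p -> a \in W v ->
  b \in G (u - p) -> b \in W v -> a - b \in Q -> a \in Q.
Proof.
move: v a b; have [i0 W0] := fil_zero Wf.
apply: (@int_ind_up _ i0) => [v vi a b _ _ /(W0 _ _ vi) -> _ _ _|v IH a b vu aF aW bG bW].
  exact: mem0v.
have inQ x y : x \in S -> x \in W v -> y \in T -> y \in W v -> x + y \in Q.
  by move=> *; apply/cap_addP; exists x, y; split=> //; apply: (W_le vu).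
move=> abQ; have /cap_addP[s [t [sS' sW tT' tW E]]] : a - b \in (S :&: W v + T :&: W v)%VS.
  case/cap_addP: abQ (memvB aW bW) => s [t [? ? ? ? ->]] stW.
  exact: (dist_below Wf IHu).
have [f1 [f2 [g1 [g2 [[f1S f2T g1S g2T] [[f1W f2W g1W g2W] [[f1F f2F g1G g2G] [E1 E2]]]]]]]] :=
  split2 p sS' sW tT' tW.
have Es : s = a - b - t by rewrite E; zmod.
have bG' : b \in G (v + 1 - p) by apply: (fil_decr Gf _ bG); ilia.
have aF' : a \in F (v + 1 - (u - p)) by apply: (fil_decr Ff _ aF); ilia.
have a1W : a - f1 - f2 \in W (v - 1).
  apply: (inj (w := v) (p := p) (g := - (b + g1 + g2))); memvs.
  have -> : a - f1 - f2 - (b + g1 + g2) = (s - f1 - g1) + (t - f2 - g2).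
    by rewrite Es; zmod.
  by memvs.
have [h1 [h2 [k1 [k2 [[h1S h2T k1S k2T] [[h1W h2W k1W k2W] [[h1F h2F k1G k2G] [E3 E4]]]]]]]] :=
  split2 (v + 1 - (u - p)) sS' sW tT' tW.
have Ev : v + 1 - (v + 1 - (u - p)) = u - p by ilia.
rewrite Ev in k1G k2G.
have Eab : (a - h1 - h2) - (b + k1 + k2) = (s - h1 - k1) + (t - h2 - k2).
  by rewrite Es; zmod.
have E34 : (a - h1 - h2) - (b + k1 + k2) \in W (v - 1) by rewrite Eab; memvs.
have b1W : b + k1 + k2 \in W (v - 1).
  suff hW : a - h1 - h2 \in W (v - 1).
    have -> : b + k1 + k2 = (a - h1 - h2) - (a - h1 - h2 - (b + k1 + k2)) by zmod.
    by apply: memvB.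
  apply: (inj (w := v) (p := v + 1 - (u - p)) (g := - (b + k1 + k2))) => //; rewrite ?Ev; memvs.
have a1Q : a - f1 - f2 \in Q.
  apply: (IH _ (b + k1 + k2)) => //; [ilia|memvs|memvs|].
  have -> : a - f1 - f2 - (b + k1 + k2) = (a - b) - (f1 + f2) - (k1 + k2) by zmod.
  by apply: memvB; [apply: memvB => //|]; apply: inQ.
have -> : a = (a - f1 - f2) + (f1 + f2) by zmod.
by apply: memvD => //; apply: inQ.
Qed.

(** Descending induction on [p] shows that the connecting map kills [F p]: by
    [opp_sur], [F p] is spanned by [F (p + 1)] and by elements of type
    [(p, u - p)], which the target lacks. *)
Lemma opposed_dist_step : dist_at W S T u.
Proof.
suff H p x y : x \in S -> y \in T -> x \in W u -> y \in W u -> x \in F p -> y \in F p ->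
    x + y \in W (u - 1) -> x + y \in Q.
  have [_ [p Fp] _] := Ff => x y xS yT xW yW.
  by apply: (H p); rewrite ?Fp ?memvf.
have [Fdec _ [p0 Fp0]] := Ff.
move: p x y; apply: (@int_ind_down _ p0) => [p pp x y _ _ _ _|p IH x y xS yT xW yW xF yF xyW].
  move=> /(subvP (Fdec _ _ pp)) xF /(subvP (Fdec _ _ pp)) yF _; move: xF yF.
  by rewrite Fp0 !memv0 => /eqP -> /eqP ->; rewrite addr0 mem0v.
have [f1 [f2 [g1 [g2 [[f1S f2T g1S g2T] [[f1W f2W g1W g2W] [[f1F f2F g1G g2G] [E1 E2]]]]]]]] :=
  split2 (p + 1) xS xW yT yW.
have Eu : u + 1 - (p + 1) = u - p by ilia.
have wQ : (x - f1 - g1) + (y - f2 - g2) \in Q.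
  by apply/cap_addP; exists (x - f1 - g1), (y - f2 - g2); split=> //; memvs.
have fW : f1 + f2 \in W (u - 1).
  apply: (inj (w := u) (p := p + 1) (g := g1 + g2)); memvs.
  have -> : f1 + f2 + (g1 + g2) = x + y - (x - f1 - g1) - (y - f2 - g2) by zmod.
  by apply: memvB => //; apply: memvB.
have fQ : f1 + f2 \in Q by apply: IH.
rewrite Eu in g1G g2G.
have -> : x + y = (x + y - (f1 + f2)) + (f1 + f2) by zmod.
apply: memvD => //.
have EF : forall z, z \in F (p + 1) -> z \in F p by move=> z; apply: fil_decr Ff _; ilia.
apply: (no_type (p := p) (v := u - 1) (b := g1 + g2)) => //; try by memv; exact: EF.
- have -> : g1 + g2 = x + y - (f1 + f2) - ((x - f1 - g1) + (y - f2 - g2)) by zmod.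
  by apply: memvB; [apply: memvB|apply: memvD].
by have -> : x + y - (f1 + f2) - (g1 + g2) = (x - f1 - g1) + (y - f2 - g2) by zmod.
Qed.

End Level.

Lemma opposed_dist_at u : dist_at W S T u.
Proof. by move: u; apply: (dist_ind Wf) => u; apply: opposed_dist_step. Qed.

Lemma opposed_distW k x y : x \in S -> y \in T -> x + y \in W k ->
  exists x' y', [/\ x' \in S, y' \in T, x' \in W k, y' \in W k & x' + y' = x + y].
Proof. exact: (dist_all Wf opposed_dist_at). Qed.

(** On the graded piece of weight [w], an element of [F p] of the form [f + g]
    with [f], [g] in [F p], [G (w + 1 - p)] equals [f]: replace each summand by
    its [F] part. *)
Lemma opposed_distF p x y : x \in S -> y \in T -> x + y \in F p ->
  exists x' y', [/\ x' \in S, y' \in T, x' \in F p, y' \in F p & x' + y' = x + y].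
Proof.
have [k0 W1] := fil_full Wf; move=> xS yT xyF.
have : x + y \in (S :&: F p + T :&: F p)%VS; last first.
  by case/cap_addP=> s [t [? ? ? ? ->]]; exists s, t.
have : x + y \in W k0 by exact: W1.
move: k0 x y xS yT xyF {W1}; have [i0 W0] := fil_zero Wf.
apply: (@int_ind_up _ i0) => [w wi x y _ _ _ /(W0 _ _ wi) ->|w IH x y xS yT xyF xyW].
  exact: mem0v.
have [s [t [sS' tT' sW tW Est]]] := opposed_distW xS yT xyW.
have [f1 [f2 [g1 [g2 [[f1S f2T g1S g2T] [[f1W f2W g1W g2W] [[f1F f2F g1G g2G] [E1 E2]]]]]]]] :=
  split2 p sS' sW tT' tW.
have E : (s - f1) + (t - f2) = x + y - f1 - f2 by rewrite -Est; zmod.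
have stW : (s - f1) + (t - f2) \in W (w - 1).
  rewrite E; apply: (inj (w := w) (p := p) (g := - (g1 + g2))); memvs.
  have -> : x + y - f1 - f2 - (g1 + g2) = (s - f1 - g1) + (t - f2 - g2).
    by rewrite -Est; zmod.
  by memvs.
have -> : x + y = ((s - f1) + (t - f2)) + (f1 + f2) by rewrite E; zmod.
apply: memvD; last by apply/cap_addP; exists f1, f2.
by apply: IH => //; [memvs|memvs|rewrite E; memvs].
Qed.

Lemma opposed_add : opp_sur W F G (S + T)%VS.
Proof.
move=> w p _ /memv_addP[x xS [y yT ->]] xyW.
have [s [t [sS' tT' sW tW <-]]] := opposed_distW xS yT xyW.
have [f1 [f2 [g1 [g2 [[f1S f2T g1S g2T] [[f1W f2W g1W g2W] [[f1F f2F g1G g2G] [E1 E2]]]]]]]] :=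
  split2 p sS' sW tT' tW.
exists (f1 + f2), (g1 + g2); split; split; memvs; try exact: memv_add.
have -> : s + t - (f1 + f2) - (g1 + g2) = (s - f1 - g1) + (t - f2 - g2) by zmod.
by memvs.
Qed.

End Pair.
End OneSpace.

Section Closure.
Context (V : vectType K) (W F G : int -> {vspace V}).
Context (Wf : finite_increasing W) (Ff : finite_decreasing F) (Gf : finite_decreasing G).
Context (inj : opp_inj W F G).

(** The decompositions of [x] in [S] and in [T] differ by elements of
    [W (w - 1)], which are distributed over [S] and [T] within [F] and [G]. *)
Lemma opposed_cap S T : opp_sur W F G S -> opp_sur W F G T -> opp_sur W F G (S :&: T)%VS.
Proof.
move=> sS sT w p x /memv_capP[xS xT] xW.
have [f1 [g1 [[f1S f1F f1W g1S] [g1G g1W E1]]]] := sS w p x xS xW.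
have [f2 [g2 [[f2T f2F f2W g2T] [g2G g2W E2]]]] := sT w p x xT xW.
have dW : (f1 - f2) + (g1 - g2) \in W (w - 1).
  have -> : (f1 - f2) + (g1 - g2) = (x - f2 - g2) - (x - f1 - g1) by zmod.
  exact: memvB.
have fW : f1 - f2 \in W (w - 1).
  by apply: (inj (w := w) (p := p) (g := g1 - g2)) => //; memvs.
have gW : g1 - g2 \in W (w - 1).
  have -> : g1 - g2 = ((f1 - f2) + (g1 - g2)) - (f1 - f2) by zmod.
  exact: memvB.
have W_le z : z \in W (w - 1) -> z \in W w by apply: fil_incr Wf _; ilia.
have common (F' G' : int -> {vspace V}) q a b :
    finite_decreasing F' -> finite_decreasing G' -> opp_inj W F' G' ->
    opp_sur W F' G' S -> opp_sur W F' G' T ->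
    a \in S -> b \in T -> a \in F' q -> b \in F' q -> a - b \in W (w - 1) ->
    exists c, [/\ c \in S, c \in T, c \in F' q & a - c \in W (w - 1)].
  move=> Ff' Gf' inj' sS' sT' aS bT aF bF abW.
  have [|s [t [sS1 tT1 sW tW E]]] := opposed_distW (S := S) (T := T) (k := w - 1)
    Wf Ff' Gf' inj' sS' sT' aS (y := - b) _ abW; first by rewrite memvN.
  have s1 : s \in (S :&: W (w - 1))%VS by memvs.
  have t1 : t \in (T :&: W (w - 1))%VS by memvs.
  have stF : s + t \in F' q by rewrite E; memvs.
  have [s' [t' [/memv_capP[s'S s'W] /memv_capP[t'T t'W] s'F t'F E']]] :=
    opposed_distF Wf Ff' Gf' inj' (opp_sur_fil Wf sS') (opp_sur_fil Wf sT') s1 t1 stF.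
  have E2' : a - s' = b + t'.
    by apply: (addIr (s' - b)); transitivity (s' + t'); [rewrite E' E|]; zmod.
  exists (a - s'); split; memvs.
    by rewrite E2'; memvs.
  by have -> : a - (a - s') = s' by zmod.
have [f [fS fT fF Ef]] := common _ _ p _ _ Ff Gf inj sS sT f1S f2T f1F f2F fW.
have [g [gS gT gG Eg]] := common _ _ (w + 1 - p) _ _ Gf Ff (opp_inj_sym inj)
  (opp_sur_sym sS) (opp_sur_sym sT) g1S g2T g1G g2G gW.
exists f, g; split; split; memvs.
- have -> : f = f1 - (f1 - f) by zmod.
  by apply: memvB => //; apply: W_le.
- have -> : g = g1 - (g1 - g) by zmod.
  by apply: memvB => //; apply: W_le.
have -> : x - f - g = (x - f1 - g1) + (f1 - f) + (g1 - g) by zmod.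
by apply: memvD => //; apply: memvD.
Qed.

End Closure.

Section Pullback.
Context (V X : vectType K) (j : 'Hom(X, V)) (j_inj : injective j).
Context (W F G : int -> {vspace V}) (WX FX GX : int -> {vspace X}).
Context (jW : forall k x, (x \in WX k) = (j x \in W k)).
Context (jF : forall k x, (x \in FX k) = (j x \in F k)).
Context (jG : forall k x, (x \in GX k) = (j x \in G k)).

Lemma opp_sur_pullback S : opp_sur WX FX GX S <-> opp_sur W F G (j @: S)%VS.
Proof.
have memj x : (j x \in (j @: S)%VS) = (x \in S).
  by apply/memv_imgP/idP=> [[y yS /j_inj ->] //|xS]; exists x.
split=> H w p x xS xW.
  case/memv_imgP: xS xW => y yS ->; rewrite -jW => yW.
  have [f [g [[fS fF fW gS] [gG gW E]]]] := H w p y yS yW.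
  by exists (j f), (j g); rewrite !memj -!linearB -jF -jG -!jW.
rewrite jW in xW; rewrite -memj in xS.
have [f' [g' [[/memv_imgP[f fS ->] fF fW /memv_imgP[g gS ->]] [gG gW E]]]] := H w p (j x) xS xW.
by exists f, g; rewrite jF jG !jW !linearB.
Qed.

Lemma opp_inj_pullback : opp_inj W F G -> opp_inj WX FX GX.
Proof.
by move=> H w p f g; rewrite jF jG !jW linearD; apply: H.
Qed.

Lemma pullback_decreasing : finite_decreasing F -> finite_decreasing FX.
Proof.
case=> dec [a Fa] [b Fb]; split.
- by move=> c d cd; apply/subvP=> x; rewrite !jF; apply: (subvP (dec _ _ cd)).
- by exists a; apply/vspaceP=> x; rewrite jF Fa !memvf.
exists b; apply/vspaceP=> x; rewrite jF Fb !memv0.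
by rewrite -(linear0 j) (inj_eq j_inj).
Qed.

End Pullback.

Section Quotient.
Context (V X : vectType K) (q : 'Hom(V, X)) (q_surj : limg q = fullv).
Context (W F G : int -> {vspace V}).
Context (Wf : finite_increasing W) (Ff : finite_decreasing F) (Gf : finite_decreasing G).
Context (inj : opp_inj W F G) (sV : opp_sur W F G fullv) (sJ : opp_sur W F G (lker q)).

Local Notation qf M := (fun k => q @: M k)%VS.

Let sW w : opp_sur W F G (W w).
Proof. by have := opp_sur_fil (u := w) Wf sV; rewrite capfv. Qed.

Let lift F' G' w p x : finite_decreasing F' -> finite_decreasing G' ->
  opp_inj W F' G' -> opp_sur W F' G' (W w) -> opp_sur W F' G' (lker q) ->
  x \in qf F' p -> x \in qf W w ->
  exists v, [/\ v \in F' p, v \in W w & x = q v].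
Proof.
move=> Ff' Gf' inj' sW' sJ' /memv_imgP[f fF ->] /memv_imgP[v vW E].
have dJ : f - v \in lker q by rewrite memv_ker linearB /= E subrr.
have [|a [b [aW bJ aF bF E']]] := opposed_distF (S := W w) (T := lker q) (p := p)
    Wf Ff' Gf' inj' sW' sJ' vW dJ.
  by have -> : v + (f - v) = f by zmod.
exists a; split=> //; move: bJ; rewrite memv_ker => /eqP qb.
have <- : v + (f - v) = f by zmod.
by rewrite -E' linearD /= qb addr0.
Qed.

Lemma opp_inj_quotient : opp_inj (qf W) (qf F) (qf G).
Proof.
move=> w p f' g' f'F f'W g'G g'W.
have [f [fF fW Ef]] := lift Ff Gf inj (sW (w:=w)) sJ f'F f'W.
have [g [gG gW Eg]] := lift Gf Ff (opp_inj_sym inj) (opp_sur_sym (sW (w:=w)))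
  (opp_sur_sym sJ) g'G g'W.
rewrite {f' f'F f'W}Ef {g' g'G g'W}Eg -linearD => /memv_imgP[c cW E].
have W_le z : z \in W (w - 1) -> z \in W w by apply: fil_incr Wf _; ilia.
have dJ : f + g - c \in lker q by rewrite memv_ker linearB /= E subrr.
have dW : f + g - c \in W w by memv; exact: W_le.
have [a [b [[aJ aF aW bJ] [bG bW E']]]] := sJ p dJ dW.
have faW : f - a \in W (w - 1).
  apply: (inj (w := w) (p := p) (g := g - b)); memvs.
  have -> : f - a + (g - b) = (f + g - c - a - b) + c by zmod.
  by apply: memvD.
have -> : q f = q (f - a).
  by move: aJ; rewrite memv_ker => /eqP qa; rewrite linearB /= qa subr0.
exact: memv_img.
Qed.

Lemma opp_sur_quotient S : opp_sur W F G (q @^-1: S)%VS -> opp_sur (qf W) (qf F) (qf G) S.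
Proof.
move=> sS w p x xS /memv_imgP[v vW E]; rewrite {x}E memv_preim in xS *.
have [f [g [[fS fF fW gS] [gG gW E]]]] := sS w p v xS vW.
exists (q f), (q g); rewrite !memv_preim; split; split; rewrite -?memv_preim ?memv_img //.
  by rewrite memv_preim.
  by rewrite memv_preim.
by rewrite -!linearB memv_img.
Qed.

Lemma image_decreasing : finite_decreasing F -> finite_decreasing (qf F).
Proof.
case=> dec [a Fa] [b Fb]; split.
- by move=> c d cd; apply/limgS/dec.
- by exists a; rewrite Fa.
- by exists b; rewrite Fb limg0.
Qed.

End Quotient.
End OpposedFiltrations.

(** * Mixed Hodge structures *)

Section MixedHodge.
Context (R : rcfType).
Implicit Types V X A B : vectType R.

Lemma cplx_map_conj V X (f : 'Hom(V, X)) u :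
  cplx_map f (cplx_conj u) = cplx_conj (cplx_map f u).
Proof. by rewrite !cplx_mapE; congr pair; rewrite /= linearN. Qed.

Lemma conjv_cap V (U U' : {vspace cplx V}) : conjv (U :&: U')%VS = (conjv U :&: conjv U')%VS.
Proof. by apply/vspaceP=> u; rewrite memv_conjv !memv_cap !memv_conjv. Qed.

Lemma conjv_add V (U U' : {vspace cplx V}) : conjv (U + U')%VS = (conjv U + conjv U')%VS.
Proof.
apply/vspaceP=> u; rewrite memv_conjv; apply/memv_addP/memv_addP.
  case=> a aU [b bU E]; exists (cplx_conj a); first by rewrite memv_conjv cplx_conjK.
  by exists (cplx_conj b); rewrite ?memv_conjv ?cplx_conjK // -cplx_conjD -E cplx_conjK.
case=> a; rewrite memv_conjv => aU [b]; rewrite memv_conjv => bU ->.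
by exists (cplx_conj a) => //; exists (cplx_conj b) => //; rewrite cplx_conjD.
Qed.

Lemma conjv_cplx_sub V (S : {vspace V}) : conjv (cplx_sub S) = cplx_sub S.
Proof. by apply/vspaceP=> u; rewrite memv_conjv !memv_cplx_sub /= memvN. Qed.

Lemma cplx_sub_cap V (S T : {vspace V}) : cplx_sub (S :&: T)%VS = (cplx_sub S :&: cplx_sub T)%VS.
Proof. by apply/vspaceP=> u; rewrite memv_cap !memv_cplx_sub !memv_cap andbACA. Qed.

Lemma cplx_sub_add V (S T : {vspace V}) : cplx_sub (S + T)%VS = (cplx_sub S + cplx_sub T)%VS.
Proof.
apply/vspaceP=> u; rewrite memv_cplx_sub; apply/andP/memv_addP.
  case=> /memv_addP[a aS [b bT E1]] /memv_addP[a' aS' [b' bT' E2]].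
  exists ((a, a') : cplx V); first by rewrite memv_cplx_sub aS.
  exists ((b, b') : cplx V); first by rewrite memv_cplx_sub bT.
  by rewrite [u]surjective_pairing E1 E2.
case=> a; rewrite memv_cplx_sub => /andP[a1 a2] [b]; rewrite memv_cplx_sub => /andP[b1 b2] ->.
by split; apply: memv_add.
Qed.

Lemma cplx_sub_increasing V (W : int -> {vspace V}) :
  finite_increasing W -> finite_increasing (fun w => cplx_sub (W w)).
Proof.
case=> incr [a Wa] [b Wb]; split.
- move=> c d cd; apply/subvP=> u; rewrite !memv_cplx_sub => /andP[u1 u2].
  by rewrite !(subvP (incr _ _ cd)).
- exists a; apply/vspaceP=> u; rewrite memv_cplx_sub Wa !memv0.
  by case: u => x y; rewrite -[RHS]xpair_eqE.
- by exists b; apply/vspaceP=> u; rewrite memv_cplx_sub Wb !memvf.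
Qed.

Lemma conjv_decreasing V (F : int -> {vspace cplx V}) :
  finite_decreasing F -> finite_decreasing (fun p => conjv (F p)).
Proof.
case=> dec [a Fa] [b Fb]; split.
- by move=> c d cd; apply/subvP=> u; rewrite !memv_conjv; apply: (subvP (dec _ _ cd)).
- by exists a; apply/vspaceP=> u; rewrite memv_conjv Fa !memvf.
exists b; apply/vspaceP=> u; rewrite memv_conjv Fb !memv0.
apply/eqP/eqP=> [E|->]; last by congr pair; rewrite /= oppr0.
by rewrite -[u]cplx_conjK E; congr pair; rewrite /= oppr0.
Qed.

(** By [mixed_hodge_pullback], a mixed Hodge structure induces one on exactly
    the subspaces [S] that satisfy this condition. *)
Definition hodge_sur V (W : int -> {vspace V}) (F : int -> {vspace cplx V}) S :=
  opp_sur (fun w => cplx_sub (W w)) F (fun p => conjv (F p)) (cplx_sub S).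

Definition hodge_inj V (W : int -> {vspace V}) (F : int -> {vspace cplx V}) :=
  opp_inj (fun w => cplx_sub (W w)) F (fun p => conjv (F p)).

Lemma cplx_subf V : cplx_sub (fullv : {vspace V}) = fullv.
Proof. by apply/vspaceP=> u; rewrite memv_cplx_sub !memvf. Qed.

Lemma is_mixed_hodgeE V (W : int -> {vspace V}) (F : int -> {vspace cplx V}) :
  is_mixed_hodge W F <->
  [/\ finite_increasing W, finite_decreasing F, hodge_sur W F fullv & hodge_inj W F].
Proof.
have conjE w p : conjv (hodge_gr_fil W F w p) =
    (conjv (F p) :&: cplx_sub (W w) + cplx_sub (W (w - 1)))%VS.
  by rewrite conjv_add conjv_cap !conjv_cplx_sub.
rewrite /hodge_sur cplx_subf; split=> [[Wf Ff H]|[Wf Ff sur inj]]; split=> //.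
- move=> w p x _; have [EW _] := H w p; rewrite -{1}EW conjE.
  case/memv_addP=> _ /memv_addP[f /memv_capP[fF fW] [a aW ->]].
  case=> _ /memv_addP[g /memv_capP[gG gW] [b bW ->]] ->.
  exists f, g; rewrite !memvf; split; split=> //.
  have -> : f + a + (g + b) - f - g = a + b by zmod.
  exact: memvD.
- move=> w p f g fF fW gG gW fgW; have [_ <-] := H w p; rewrite conjE.
  apply/memv_capP; split; apply/memv_addP.
    by exists f; [apply/memv_capP|exists 0; rewrite ?mem0v ?addr0].
  exists (- g); first by apply/memv_capP; rewrite !memvN.
  by exists (f + g) => //; zmod.
move=> w p; rewrite conjE; have WCf := cplx_sub_increasing Wf.
have W_le z : z \in cplx_sub (W (w - 1)) -> z \in cplx_sub (W w).
  by apply: (fil_incr WCf); ilia.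
split; apply/eqP; rewrite eqEsubv; apply/andP; split; apply/subvP=> x.
- case/memv_addP=> _ /memv_addP[f /memv_capP[_ fW] [a /W_le aW ->]].
  by case=> _ /memv_addP[g /memv_capP[_ gW] [b /W_le bW ->]] ->; rewrite !memvD.
- move=> xW; have [f [g [[_ fF fW _] [gG gW E]]]] := sur w p x (memvf x) xW.
  apply/memv_addP; exists (f + 0).
    by apply: memv_add; [apply/memv_capP|apply: mem0v].
  exists (g + (x - f - g)); last by zmod.
  by apply: memv_add => //; apply/memv_capP.
- case/memv_capP=> /memv_addP[f /memv_capP[fF fW] [a aW Ef]].
  case/memv_addP=> g /memv_capP[gG gW] [b bW Eg].
  have f1W : f \in cplx_sub (W (w - 1)).
    apply: (inj w p f (- g)); rewrite ?memvN //.
    have -> : f - g = b - a by apply: (addrI (a + g)); transitivity x; [rewrite Ef|rewrite Eg]; zmod.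
    exact: memvB.
  by rewrite Ef memvD.
- move=> xW; apply/memv_capP.
  by split; apply: (subvP (addvSr _ _)).
Qed.

Lemma cplx_sub_img V X (f : 'Hom(V, X)) (S : {vspace V}) :
  (cplx_map f @: cplx_sub S)%VS = cplx_sub (f @: S)%VS.
Proof.
apply/vspaceP=> u; rewrite memv_cplx_sub; apply/memv_imgP/andP.
  by case=> v; rewrite memv_cplx_sub => /andP[v1 v2] ->; rewrite cplx_mapE !memv_img.
case=> /memv_imgP[a aS E1] /memv_imgP[b bS E2].
exists ((a, b) : cplx V); first by rewrite memv_cplx_sub aS.
by rewrite cplx_mapE [u]surjective_pairing E1 E2.
Qed.

Section OneMHS.
Context V (W : int -> {vspace V}) (F : int -> {vspace cplx V}) (mhs : is_mixed_hodge W F).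

Let Wf : finite_increasing W. Proof. by case/is_mixed_hodgeE: mhs. Qed.
Let WCf : finite_increasing (fun w => cplx_sub (W w)).
Proof. exact: cplx_sub_increasing. Qed.
Let Ff : finite_decreasing F. Proof. by case/is_mixed_hodgeE: mhs. Qed.
Let Gf : finite_decreasing (fun p => conjv (F p)). Proof. exact: conjv_decreasing. Qed.
Let sV : hodge_sur W F fullv. Proof. by case/is_mixed_hodgeE: mhs. Qed.
Let inj : hodge_inj W F. Proof. by case/is_mixed_hodgeE: mhs. Qed.

(** Distributivity descends from the complexification, where a real vector [x]
    becomes [(x, 0)]. *)
Lemma hodge_strict_lattice : strict_lattice (hodge_sur W F) W.
Proof.
split=> [S T LS LT|S T LS LT|k S T x y LS LT xS yT xyW].
- by rewrite /hodge_sur cplx_sub_cap; apply: opposed_cap.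
- by rewrite /hodge_sur cplx_sub_add; apply: opposed_add.
have xC : ((x, 0) : cplx V) \in cplx_sub S by rewrite memv_cplx_sub xS mem0v.
have yC : ((y, 0) : cplx V) \in cplx_sub T by rewrite memv_cplx_sub yT mem0v.
have xyC : ((x, 0) : cplx V) + (y, 0) \in cplx_sub (W k).
  by rewrite memv_cplx_sub /= xyW addr0 mem0v.
have [x' [y' []]] := opposed_distW WCf Ff Gf inj LS LT xC yC xyC.
rewrite !memv_cplx_sub => /andP[? _] /andP[? _] /andP[? _] /andP[? _] E.
by exists x'.1, y'.1; split=> //; have := congr1 fst E.
Qed.

Lemma hodge_distF p S T u v : hodge_sur W F S -> hodge_sur W F T ->
  u \in cplx_sub S -> v \in cplx_sub T -> u + v \in F p ->
  exists u' v', [/\ u' \in cplx_sub S, v' \in cplx_sub T, u' \in F p, v' \in F p & u' + v' = u + v].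
Proof. by move=> LS LT; apply: (opposed_distF WCf Ff Gf inj). Qed.

Section Pullback.
Context X (j : 'Hom(X, V)) (j_inj : injective j).
Context (WX : int -> {vspace X}) (FX : int -> {vspace cplx X}).
Context (jW : forall k x, (x \in WX k) = (j x \in W k)).
Context (jF : forall k u, (u \in FX k) = (cplx_map j u \in F k)).

Let jC_inj : injective (cplx_map j).
Proof. by move=> [a b] [c d]; rewrite !cplx_mapE /= => -[/j_inj -> /j_inj ->]. Qed.

Let jC_W k u : (u \in cplx_sub (WX k)) = (cplx_map j u \in cplx_sub (W k)).
Proof. by rewrite !memv_cplx_sub cplx_mapE !jW. Qed.

Let jC_G k u : (u \in conjv (FX k)) = (cplx_map j u \in conjv (F k)).
Proof. by rewrite !memv_conjv jF cplx_map_conj. Qed.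

Lemma hodge_sur_pullback S : hodge_sur WX FX S <-> hodge_sur W F (j @: S)%VS.
Proof. by rewrite /hodge_sur -cplx_sub_img; apply: opp_sur_pullback. Qed.

Lemma mixed_hodge_pullback : is_mixed_hodge WX FX <-> hodge_sur W F (limg j).
Proof.
rewrite is_mixed_hodgeE; split=> [[_ _ /hodge_sur_pullback] //|/hodge_sur_pullback H].
split=> //.
- exact: (pullback_increasing j_inj jW).
- exact: (pullback_decreasing jC_inj jF).
- exact: (opp_inj_pullback jC_W jF jC_G).
Qed.

End Pullback.

Section Quotient.
Context X (q : 'Hom(V, X)) (q_surj : limg q = fullv) (LJ : hodge_sur W F (lker q)).

Let qC_surj : limg (cplx_map q) = fullv.
Proof.
apply/eqP; rewrite eqEsubv subvf; apply/subvP=> -[x y] _.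
have [a ->] := surj_preimage q_surj x; have [b ->] := surj_preimage q_surj y.
by apply/memv_imgP; exists ((a, b) : cplx V); rewrite ?memvf // cplx_mapE.
Qed.

Let qC_ker : lker (cplx_map q) = cplx_sub (lker q).
Proof.
apply/vspaceP=> u; rewrite memv_cplx_sub !memv_ker cplx_mapE.
by rewrite -[LHS]xpair_eqE.
Qed.

Let qC_W : (fun w => cplx_sub (q @: W w)%VS) = (fun w => cplx_map q @: cplx_sub (W w))%VS.
Proof.
by apply/funext=> w; rewrite cplx_sub_img.
Qed.

Let qC_G : (fun p => conjv (cplx_map q @: F p)%VS) = (fun p => cplx_map q @: conjv (F p))%VS.
Proof.
apply/funext=> p; apply/vspaceP=> u; rewrite memv_conjv; apply/memv_imgP/memv_imgP.
  case=> v vF E; exists (cplx_conj v); first by rewrite memv_conjv cplx_conjK.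
  by rewrite cplx_map_conj -E cplx_conjK.
case=> v; rewrite memv_conjv => vF ->; exists (cplx_conj v) => //.
by rewrite cplx_map_conj.
Qed.

Lemma hodge_sur_quotient S : hodge_sur W F (q @^-1: S)%VS ->
  hodge_sur (fun w => q @: W w)%VS (fun p => cplx_map q @: F p)%VS S.
Proof.
rewrite /hodge_sur qC_W qC_G => H; apply: opp_sur_quotient.
have -> : (cplx_map q @^-1: cplx_sub S)%VS = cplx_sub (q @^-1: S)%VS; last by [].
by apply/vspaceP=> u; rewrite -memv_preim !memv_cplx_sub -!memv_preim cplx_mapE.
Qed.

Lemma mixed_hodge_quotient :
  is_mixed_hodge (fun w => q @: W w)%VS (fun p => cplx_map q @: F p)%VS.
Proof.
apply/is_mixed_hodgeE; split.
- case: Wf => incr [a Wa] [b Wb]; split.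
  + by move=> c d cd; apply/limgS/incr.
  + by exists a; rewrite Wa limg0.
  + by exists b; rewrite Wb q_surj.
- exact: image_decreasing.
- apply: hodge_sur_quotient; have -> : (q @^-1: fullv)%VS = fullv; last exact: sV.
  by apply/vspaceP=> x; rewrite -memv_preim !memvf.
rewrite /hodge_inj qC_W qC_G; apply: opp_inj_quotient => //.
  by have := sV; rewrite /hodge_sur cplx_subf.
by rewrite qC_ker.
Qed.

End Quotient.
End OneMHS.

Section Sum.
Context A B (WA : int -> {vspace A}) (WB : int -> {vspace B}).
Context (FA : int -> {vspace cplx A}) (FB : int -> {vspace cplx B}).

Definition prod_hodge (p : int) : {vspace cplx (A * B)%type} :=
  (cplx_map (fst_lfun A B) @^-1: FA p :&: cplx_map (snd_lfun A B) @^-1: FB p)%VS.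

Definition cplx_fst (u : cplx (A * B)%type) : cplx A := (u.1.1, u.2.1).
Definition cplx_snd (u : cplx (A * B)%type) : cplx B := (u.1.2, u.2.2).

Lemma memv_prod_hodge p (u : cplx (A * B)%type) :
  (u \in prod_hodge p) = (cplx_fst u \in FA p) && (cplx_snd u \in FB p).
Proof.
have E1 : cplx_map (fst_lfun A B) u = cplx_fst u by rewrite cplx_mapE !fst_lfunE.
have E2 : cplx_map (snd_lfun A B) u = cplx_snd u by rewrite cplx_mapE !snd_lfunE.
by rewrite -E1 -E2 [in RHS]memv_preim [X in _ = _ && X]memv_preim -memv_cap.
Qed.

Lemma memv_prod_conj p (u : cplx (A * B)%type) : (u \in conjv (prod_hodge p)) =
  (cplx_fst u \in conjv (FA p)) && (cplx_snd u \in conjv (FB p)).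
Proof. by rewrite !memv_conjv memv_prod_hodge. Qed.

Lemma memv_cplx_sub_prod (S : {vspace A}) (T : {vspace B}) (u : cplx (A * B)%type) :
  (u \in cplx_sub (prodv S T)) = (cplx_fst u \in cplx_sub S) && (cplx_snd u \in cplx_sub T).
Proof. by rewrite !memv_cplx_sub !memv_prodv /= andbACA. Qed.

Lemma hodge_sur_prod S T : hodge_sur WA FA S -> hodge_sur WB FB T ->
  hodge_sur (fun w => prodv (WA w) (WB w)) prod_hodge (prodv S T).
Proof.
move=> HS HT w p u; rewrite !memv_cplx_sub_prod => /andP[uS uT] /andP[uA uB].
have [f1 [g1 [[f1S f1F f1W g1S] [g1G g1W E1]]]] := HS w p _ uS uA.
have [f2 [g2 [[f2T f2F f2W g2T] [g2G g2W E2]]]] := HT w p _ uT uB.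
pose mk (a : cplx A) (b : cplx B) : cplx (A * B)%type := ((a.1, b.1), (a.2, b.2)).
have mk1 a b : cplx_fst (mk a b) = a by case: a.
have mk2 a b : cplx_snd (mk a b) = b by case: b.
have sub1 (x y : cplx (A * B)%type) : cplx_fst (x - y) = cplx_fst x - cplx_fst y by [].
have sub2 (x y : cplx (A * B)%type) : cplx_snd (x - y) = cplx_snd x - cplx_snd y by [].
exists (mk f1 f2), (mk g1 g2).
rewrite !memv_cplx_sub_prod memv_prod_hodge memv_prod_conj !sub1 !sub2 !mk1 !mk2.
by rewrite f1S f2T f1F f2F f1W f2W g1S g2T g1G g2G g1W g2W E1 E2.
Qed.

Lemma mixed_hodge_prod : is_mixed_hodge WA FA -> is_mixed_hodge WB FB ->
  is_mixed_hodge (fun w => prodv (WA w) (WB w)) prod_hodge.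
Proof.
move=> /is_mixed_hodgeE[WAf FAf surA injA] /is_mixed_hodgeE[WBf FBf surB injB].
apply/is_mixed_hodgeE; split.
- exact: finite_increasing_prod.
- have dec_le (V : vectType R) (F : int -> {vspace cplx V}) : finite_decreasing F ->
      forall a b u, a <= b -> u \in F b -> u \in F a.
    by case=> H _ _ a b u ab; apply: (subvP (H _ _ ab)).
  split.
  + move=> a b ab; apply/subvP=> u; rewrite !memv_prod_hodge => /andP[u1 u2].
    by rewrite (dec_le _ _ FAf _ _ _ ab u1) (dec_le _ _ FBf _ _ _ ab u2).
  + have [_ [a Fa] _] := FAf; have [_ [b Fb] _] := FBf.
    exists (Num.min a b); apply/vspaceP=> u; rewrite memv_prod_hodge memvf.
    rewrite (dec_le _ _ FAf _ a) ?ge_min ?lexx ?Fa ?memvf //.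
    by rewrite (dec_le _ _ FBf _ b) ?ge_min ?lexx ?orbT ?Fb ?memvf.
  have [_ _ [a Fa]] := FAf; have [_ _ [b Fb]] := FBf.
  exists (Num.max a b); apply/eqP; rewrite -subv0; apply/subvP=> u.
  rewrite memv_prod_hodge memv0 => /andP[u1 u2].
  have : cplx_fst u \in FA a by apply: (dec_le _ _ FAf _ _ _ _ u1); rewrite le_max lexx.
  have : cplx_snd u \in FB b by apply: (dec_le _ _ FBf _ _ _ _ u2); rewrite le_max lexx orbT.
  rewrite Fa Fb !memv0; case: u {u1 u2} => [[x y] [x' y']] /eqP[-> ->] /eqP[-> ->].
  by apply/eqP.
- by rewrite -prodvf; apply: hodge_sur_prod.
move=> w p f g; rewrite !memv_cplx_sub_prod memv_prod_hodge memv_prod_conj.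
move=> /andP[f1 f2] /andP[f3 f4] /andP[g1 g2] /andP[g3 g4] /andP[h1 h2].
have add1 (x y : cplx (A * B)%type) : cplx_fst (x + y) = cplx_fst x + cplx_fst y by [].
have add2 (x y : cplx (A * B)%type) : cplx_snd (x + y) = cplx_snd x + cplx_snd y by [].
rewrite add1 in h1; rewrite add2 in h2.
by apply/andP; split; [exact: injA f1 f3 g1 g3 h1|exact: injB f2 f4 g2 g4 h2].
Qed.

End Sum.
End MixedHodge.

(** * The category of Deligne-Hodge systems *)

Section HodgeStructures.
Context (R : rcfType) (n : nat).

Lemma cplx_map_comp (A B C : vectType R) (g : 'Hom(B, C)) (f : 'Hom(A, B)) u :
  cplx_map (g \o f)%VF u = cplx_map g (cplx_map f u).
Proof. by rewrite !cplx_mapE !comp_lfunE. Qed.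

(** The filtrations are part of the data here; [hst_sub] says that the
    restrictions to the steps of the tower are mixed Hodge structures, see
    [restr_mixed_hodge]. *)
Record hodge_structure (V : vectType R) (N : 'I_n -> 'End(V))
    (Wj : nat -> int -> {vspace V}) (F : int -> {vspace cplx V}) : Prop := {
  hst_tower : monodromy_tower (Wj 0%N) N Wj;
  hst_nil : nilpotent_commuting N;
  hst_shift : forall i p u, u \in F p -> cplx_map (N i) u \in F (p - 1);
  hst_mhs : is_mixed_hodge (Wj n) F;
  hst_sub : forall (k : nat) (w : int), (k < n)%N -> hodge_sur (Wj n) F (Wj k w)
}.

Lemma restr_mixed_hodge (V : vectType R) (U : {vspace V}) W F :
  is_mixed_hodge W F ->
  is_mixed_hodge (restr_fil U W) (restr_hodge U F) <-> hodge_sur W F U.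
Proof.
move=> mhs; rewrite -[in X in _ <-> X](limg_sub_incl U).
apply: mixed_hodge_pullback => //.
- exact: sub_incl_inj.
- exact: restr_filE.
- by move=> k u; rewrite -memv_preim.
Qed.

Lemma is_deligne_hodge_systemE (V : vectType R) W (N : 'I_n -> 'End(V)) F :
  is_deligne_hodge_system W N F <->
  exists2 Wj, hodge_structure N Wj F & (forall w, Wj 0%N w = W w).
Proof.
split=> [[admN Ff NF [Wj [t mhs sub]]]|[Wj [t nc NF mhs sub] W0]].
  have W0 : (fun w => Wj 0%N w) = W by apply/funext; case: t => [[]].
  exists Wj; last by move=> w; rewrite -W0.
  split=> //; first by rewrite -W0 in t.
  - exact/(admissible_operatorsE t).
  - by move=> i p u uF; apply: (subvP (NF i p)); apply: memv_img.
  by move=> k w kn; apply/restr_mixed_hodge => //; apply: sub.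
have {}W0 : (fun w => Wj 0%N w) = W by apply/funext.
rewrite -W0; split=> //; first exact/(admissible_operatorsE t).
- by case: mhs.
- by move=> i p; apply/subvP=> _ /memv_imgP[u uF ->]; apply: NF.
exists Wj; split=> // k w kn.
by apply/restr_mixed_hodge => //; apply: sub.
Qed.

Lemma hst_is_deligne_hodge_system (V : vectType R) (N : 'I_n -> 'End(V)) Wj F :
  hodge_structure N Wj F -> is_deligne_hodge_system (Wj 0%N) N F.
Proof. by move=> H; apply/is_deligne_hodge_systemE; exists Wj. Qed.

Section Sub.
Context (V : vectType R) (N : 'I_n -> 'End(V)) (Wj : nat -> int -> {vspace V}).
Context (F : int -> {vspace cplx V}) (hst : hodge_structure N Wj F).

Local Notation L := (hodge_sur (Wj n) F).

Lemma hst_strict_lattice : strict_lattice L (Wj n).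
Proof. by apply: hodge_strict_lattice; case: hst. Qed.

Lemma hst_tower_lattice k : (k <= n)%N ->
  strict_lattice (tower_lattice N Wj L k) (Wj k).
Proof.
apply: (tower_strict_lattice (hst_tower hst)).
- exact: hst_strict_lattice.
- exact: (hst_sub hst).
Qed.

Lemma hodge_structure_sub (X : vectType R) (j : 'Hom(X, V)) (NX : 'I_n -> 'End(X))
    (WX : nat -> int -> {vspace X}) (FX : int -> {vspace cplx X}) :
  injective j -> tower_lattice N Wj L 0 (limg j) ->
  (forall i x, j (NX i x) = N i (j x)) ->
  (forall k w x, (x \in WX k w) = (j x \in Wj k w)) ->
  (forall p u, (u \in FX p) = (cplx_map j u \in F p)) ->
  hodge_structure NX WX FX.
Proof.
move=> jinj TLj jN jW jF; have [t nc NF mhs sub] := hst; have [Lj _] := TLj.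
split.
- exact: (tower_sub t hst_strict_lattice) TLj jN jW.
- exact: (nilpotent_commuting_sub jinj jN nc).
- move=> i p u; rewrite !jF => /(NF i); congr (is_true (_ \in F _)).
  by rewrite !cplx_mapE /= !jN.
- exact/(mixed_hodge_pullback mhs jinj (jW n) jF).
move=> k w kn; apply/(hodge_sur_pullback jinj (jW n) jF).
have -> : (j @: WX k w)%VS = (limg j :&: Wj k w)%VS.
  apply/vspaceP=> v; apply/memv_imgP/memv_capP=> [[x xW ->]|[/memv_imgP[x _ ->]]].
    by rewrite -jW limg_all.
  by rewrite -jW => xW; exists x.
by apply: (sl_cap hst_strict_lattice) => //; apply: sub.
Qed.

Lemma hodge_structure_quotient (X : vectType R) (q : 'Hom(V, X)) (NX : 'I_n -> 'End(X)) :
  limg q = fullv -> tower_lattice N Wj L 0 (lker q) ->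
  (forall i x, q (N i x) = NX i (q x)) ->
  hodge_structure NX (fun k w => q @: Wj k w)%VS (fun p => cplx_map q @: F p)%VS.
Proof.
move=> qsurj TLq qN; have [t nc NF mhs sub] := hst; have [Lq _] := TLq.
split.
- apply: (tower_quotient t hst_strict_lattice) TLq qN => //.
  by case/is_mixed_hodgeE: mhs.
- exact: (nilpotent_commuting_quotient qsurj qN nc).
- move=> i p _ /memv_imgP[u uF ->].
  have -> : cplx_map (NX i) (cplx_map q u) = cplx_map q (cplx_map (N i) u).
    by rewrite !cplx_mapE /= !qN.
  by apply: memv_img; apply: NF.
- exact: mixed_hodge_quotient.
move=> k w kn; apply: hodge_sur_quotient => //.
by rewrite preim_img; apply: (sl_add hst_strict_lattice) => //; apply: sub.
Qed.

End Sub.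

Lemma hodge_structure_sum (A B : vectType R) NA NB WA WB FA FB :
  @hodge_structure A NA WA FA -> @hodge_structure B NB WB FB ->
  hodge_structure (fun i => prod_lfun (NA i) (NB i))
    (fun j w => prodv (WA j w) (WB j w)) (prod_hodge FA FB).
Proof.
move=> [tA ncA NFA mhsA subA] [tB ncB NFB mhsB subB]; split.
- exact: tower_sum.
- exact: nilpotent_commuting_prod.
- move=> i p u; rewrite !memv_prod_hodge => /andP[/(NFA i) u1 /(NFB i) u2].
  have E1 : cplx_fst (cplx_map (prod_lfun (NA i) (NB i)) u) = cplx_map (NA i) (cplx_fst u).
    by rewrite !cplx_mapE !prod_lfunE.
  have E2 : cplx_snd (cplx_map (prod_lfun (NA i) (NB i)) u) = cplx_map (NB i) (cplx_snd u).
    by rewrite !cplx_mapE !prod_lfunE.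
  by rewrite E1 E2 u1.
- exact: mixed_hodge_prod.
by move=> k w kn; apply: hodge_sur_prod; [apply: subA|apply: subB].
Qed.

End HodgeStructures.

Section DeligneHodgeCategory.
Context (R : rcfType) (n : nat).

Lemma dh_structure (A : deligneHodgeSystem R n) :
  exists2 Wj, hodge_structure (dh_N A) Wj (dh_F A) & Wj 0%N = dh_W A.
Proof.
have /is_deligne_hodge_systemE[Wj hst W0] := dh_axioms A.
by exists Wj => //; apply/funext.
Qed.

Lemma dh_morE (A B : deligneHodgeSystem R n) (f : 'Hom(A, B)) :
  dh_mor f <-> [/\ forall w x, x \in dh_W A w -> f x \in dh_W B w,
    forall i x, f (dh_N A i x) = dh_N B i (f x)
  & forall p u, u \in dh_F A p -> cplx_map f u \in dh_F B p].
Proof.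
split=> [[fW fN fF]|[fW fN fF]]; split.
- by move=> w x xW; apply: (subvP (fW w)); apply: memv_img.
- by move=> i x; have /lfunP/(_ x) := fN i; rewrite !comp_lfunE.
- by move=> p u uF; apply: (subvP (fF p)); apply: memv_img.
- by move=> w; apply/subvP=> _ /memv_imgP[x xW ->]; apply: fW.
- by move=> i; apply/lfunP=> x; rewrite !comp_lfunE.
- by move=> p; apply/subvP=> _ /memv_imgP[u uF ->]; apply: fF.
Qed.

Section Morphism.
Context (A B : deligneHodgeSystem R n) (WA : nat -> int -> {vspace A})
  (WB : nat -> int -> {vspace B}).
Context (hA : hodge_structure (dh_N A) WA (dh_F A)) (WA0 : WA 0%N = dh_W A).
Context (hB : hodge_structure (dh_N B) WB (dh_F B)) (WB0 : WB 0%N = dh_W B).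

Let NC i := prod_lfun (dh_N A i) (dh_N B i).
Let WC j w := prodv (WA j w) (WB j w).
Let FC := prod_hodge (dh_F A) (dh_F B).

Let hC : hodge_structure NC WC FC := hodge_structure_sum hA hB.

Local Notation TL := (tower_lattice NC WC (hodge_sur (WC n) FC) 0).

Let slC : strict_lattice TL (WC 0).
Proof. exact: (hst_tower_lattice hC). Qed.

Lemma dh_graph_lattice (f : 'Hom(A, B)) : dh_mor f -> TL (limg (graph f)).
Proof.
case/dh_morE=> fW fN fF.
have jW k w x : (k <= n)%N -> (x \in WA k w) = (graph f x \in WC k w).
  move=> kn; rewrite graphE memv_prodv /=; apply/idP/andP=> [xW|[]//]; split=> //.
  apply: (tower_functorial (hst_tower hA) (hst_tower hB) fN _ kn xW) => v y.
  by rewrite WA0 WB0; apply: fW.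
apply: (tower_lattice_limg (hst_tower hC) (hst_tower hA)) => //.
  by move=> i x; rewrite !graphE prod_lfunE fN.
have jinj : injective (graph f) by move=> x y; rewrite !graphE => -[].
have jF p u : (u \in dh_F A p) = (cplx_map (graph f) u \in FC p).
  have E1 : cplx_fst (cplx_map (graph f) u) = u by rewrite cplx_mapE !graphE; case: u.
  have E2 : cplx_snd (cplx_map (graph f) u) = cplx_map f u by rewrite !cplx_mapE !graphE.
  by rewrite memv_prod_hodge E1 E2; apply/idP/andP=> [uF|[]//]; split=> //; apply: fF.
apply/(mixed_hodge_pullback (hst_mhs hC) jinj _ jF); last exact: hst_mhs hA.
by move=> k x; apply: jW.
Qed.

Let TL0 : TL (limg (graph (0 : 'Hom(A, B)))).
Proof. exact/dh_graph_lattice/dh_mor0. Qed.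

Lemma dh_strict_at (f : 'Hom(A, B)) w b : dh_mor f ->
  b \in limg f -> b \in dh_W B w -> exists2 a, a \in dh_W A w & b = f a.
Proof.
move=> hf bf; rewrite -WB0 -WA0 => bW.
exact: (graph_strict slC (dh_graph_lattice hf) TL0).
Qed.

(** As in [graph_strict], now in the complexification and for [F] *)
Lemma dh_strictF_at (f : 'Hom(A, B)) p v : dh_mor f ->
  v \in dh_F B p -> (exists u, v = cplx_map f u) ->
  exists2 u, u \in dh_F A p & v = cplx_map f u.
Proof.
move=> hf vF [u0 Ev]; have [Lf _] := dh_graph_lattice hf; have [L0 _] := TL0.
pose u : cplx (A * B)%type := ((u0.1, f u0.1), (u0.2, f u0.2)).
pose u' : cplx (A * B)%type := ((- u0.1, 0), (- u0.2, 0)).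
have uS : u \in cplx_sub (limg (graph f)) by rewrite memv_cplx_sub !memv_graph !eqxx.
have u'S : u' \in cplx_sub (limg (graph (0 : 'Hom(A, B)))).
  by rewrite memv_cplx_sub !memv_graph !zero_lfunE !eqxx.
have snd_uu' : cplx_snd (u + u') = v.
  by rewrite Ev cplx_mapE; congr pair; rewrite /= addr0.
have uu'F : u + u' \in FC p.
  rewrite memv_prod_hodge snd_uu' vF andbT.
  have -> : cplx_fst (u + u') = 0 by congr pair; rewrite /= subrr.
  exact: mem0v.
have [x [y [xS yS xF _ E]]] := hodge_distF (hst_mhs hC) Lf L0 uS u'S uu'F.
exists (cplx_fst x); first by move: xF; rewrite memv_prod_hodge => /andP[].
move: xS yS; rewrite !memv_cplx_sub !memv_graph !zero_lfunE.
move=> /andP[/eqP x1 /eqP x2] /andP[/eqP y1 /eqP y2].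
rewrite -snd_uu' -E cplx_mapE; congr pair; rewrite /=; first by rewrite x1 y1 addr0.
by rewrite x2 y2 addr0.
Qed.

Lemma dh_kernel_at (f : 'Hom(A, B)) : dh_mor f ->
  exists (X : deligneHodgeSystem R n) (i : 'Hom(X, A)), dh_mor i /\ is_lin_kernel f i.
Proof.
move=> hf; pose J := (limg (graph f) :&: limg (graph (0%R : 'Hom(A, B))))%VS.
have TLJ : TL J := sl_cap slC (dh_graph_lattice hf) TL0.
pose j := sub_incl J; have jinj := @sub_incl_inj _ _ J; have jJ := limg_sub_incl J.
pose NX i := (j^-1 \o NC i \o j)%VF.
have jN i x : j (NX i x) = NC i (j x).
  by apply: lift_injective => //; rewrite jJ; case: TLJ => _ /(_ i (leq0n i))[].
pose WX k w := (j @^-1: WC k w)%VS; pose FX p := (cplx_map j @^-1: FC p)%VS.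
have hX : hodge_structure NX WX FX.
  apply: (hodge_structure_sub hC jinj _ jN); first by rewrite jJ.
    by move=> k w x; rewrite -memv_preim.
  by move=> p u; rewrite -memv_preim.
exists (DeligneHodgeSystem (hst_is_deligne_hodge_system hX)), (fst_lfun A B \o j)%VF.
split; last exact: graph_kernel.
have iE x : (fst_lfun A B \o j)%VF x = (j x).1 by rewrite comp_lfunE fst_lfunE.
apply/dh_morE; split=> [w x|i x|p u] /=; rewrite ?iE.
- by rewrite -memv_preim memv_prodv WA0 => /andP[].
- by rewrite jN prod_lfunE.
rewrite -memv_preim memv_prod_hodge => /andP[uF _].
by rewrite cplx_map_comp cplx_mapE !fst_lfunE.
Qed.

Lemma dh_cokernel_at (f : 'Hom(A, B)) : dh_mor f ->
  exists (X : deligneHodgeSystem R n) (p : 'Hom(B, X)), dh_mor p /\ is_lin_cokernel f p.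
Proof.
move=> hf; pose J := (limg (graph f) + limg (graph (0%R : 'Hom(A, B))))%VS.
have TLJ : TL J := sl_add slC (dh_graph_lattice hf) TL0.
have [X [q [qsurj qJ]]] := quotient_exists J.
pose NX i := (q \o NC i \o q^-1)%VF.
have qN i x : q (NC i x) = NX i (q x).
  by apply: lift_surjective => //; rewrite qJ; case: TLJ => _ /(_ i (leq0n i))[].
have hX : hodge_structure NX (fun k w => q @: WC k w)%VS (fun p => cplx_map q @: FC p)%VS.
  by apply: (hodge_structure_quotient hC qsurj _ qN); rewrite qJ.
exists (DeligneHodgeSystem (hst_is_deligne_hodge_system hX)), (q \o pair_lfun 0 \1)%VF.
split; last exact: graph_cokernel.
have qpE b : (q \o pair_lfun 0 \1)%VF b = q (0, b) by rewrite comp_lfunE inr_lfunE.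
apply/dh_morE; split=> [w x|i x|p u uF] /=; rewrite ?qpE.
- by move=> xW; apply: memv_img; rewrite memv_prodv mem0v WB0.
- by rewrite -qN prod_lfunE /= linear0.
rewrite cplx_map_comp; apply: memv_img.
have E1 : cplx_fst (cplx_map (pair_lfun 0 \1) u : cplx (A * B)%type) = 0.
  by rewrite cplx_mapE !inr_lfunE.
have E2 : cplx_snd (cplx_map (pair_lfun 0 \1) u : cplx (A * B)%type) = u.
  by rewrite cplx_mapE !inr_lfunE; case: u {uF E1}.
by rewrite memv_prod_hodge E1 E2 uF mem0v.
Qed.

Lemma dh_sum_at : exists (T : deligneHodgeSystem R n) (i1 : 'Hom(A, T)) (i2 : 'Hom(B, T))
    (p1 : 'Hom(T, A)) (p2 : 'Hom(T, B)),
  [/\ dh_mor i1, dh_mor i2, dh_mor p1 & dh_mor p2] /\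
  [/\ (p1 \o i1 = \1)%VF, (p2 \o i2 = \1)%VF, (p1 \o i2 = 0)%VF, (p2 \o i1 = 0)%VF
    & (i1 \o p1)%VF + (i2 \o p2)%VF = \1%VF].
Proof.
exists (DeligneHodgeSystem (hst_is_deligne_hodge_system hC)), (pair_lfun \1 0), (pair_lfun 0 \1),
  (fst_lfun A B), (snd_lfun A B).
split; last exact: prod_biproduct.
split; apply/dh_morE; split=> [w x|i x|p u] /=.
- by rewrite inl_lfunE memv_prodv mem0v WA0 => ->.
- by rewrite !inl_lfunE prod_lfunE linear0.
- by rewrite memv_prod_hodge cplx_mapE !inl_lfunE (mem0v (dh_F B p)) andbT; case: u.
- by rewrite inr_lfunE memv_prodv mem0v WB0 => ->.
- by rewrite !inr_lfunE prod_lfunE linear0.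
- by rewrite memv_prod_hodge cplx_mapE !inr_lfunE (mem0v (dh_F A p)); case: u.
- by rewrite fst_lfunE memv_prodv WA0 => /andP[].
- by rewrite !fst_lfunE prod_lfunE.
- by rewrite memv_prod_hodge cplx_mapE !fst_lfunE => /andP[].
- by rewrite snd_lfunE memv_prodv WB0 => /andP[].
- by rewrite !snd_lfunE prod_lfunE.
- by rewrite memv_prod_hodge cplx_mapE !snd_lfunE => /andP[].
Qed.

End Morphism.

Lemma dh_strict (A B : deligneHodgeSystem R n) (f : 'Hom(A, B)) w b : dh_mor f ->
  b \in limg f -> b \in dh_W B w -> exists2 a, a \in dh_W A w & b = f a.
Proof.
have [WA hA WA0] := dh_structure A; have [WB hB WB0] := dh_structure B.
exact: (dh_strict_at hA WA0 hB WB0).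
Qed.

Lemma dh_strictF (A B : deligneHodgeSystem R n) (f : 'Hom(A, B)) p v : dh_mor f ->
  v \in dh_F B p -> (exists u, v = cplx_map f u) ->
  exists2 u, u \in dh_F A p & v = cplx_map f u.
Proof.
have [WA hA WA0] := dh_structure A; have [WB hB WB0] := dh_structure B.
exact: (dh_strictF_at hA WA0 hB WB0).
Qed.

Lemma dh_injective_W (A B : deligneHodgeSystem R n) (f : 'Hom(A, B)) w : dh_mor f ->
  lker f = 0%VS -> dh_W A w = (f @^-1: dh_W B w)%VS.
Proof.
move=> hf /eqP/lker0P finj; apply/vspaceP=> x; rewrite -memv_preim.
apply/idP/idP=> [xW|fxW]; first by case/dh_morE: hf => fW _ _; apply: fW.
by have [a aW /finj ->] := dh_strict hf (limg_all f x) fxW.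
Qed.

Lemma dh_injective_F (A B : deligneHodgeSystem R n) (f : 'Hom(A, B)) p : dh_mor f ->
  lker f = 0%VS -> dh_F A p = (cplx_map f @^-1: dh_F B p)%VS.
Proof.
move=> hf /eqP/lker0P finj; apply/vspaceP=> u; rewrite -memv_preim.
apply/idP/idP=> [uF|fuF]; first by case/dh_morE: hf => _ _ fF; apply: fF.
have [v vF] := dh_strictF hf fuF (ex_intro _ u erefl).
by rewrite !cplx_mapE; case: u v vF {fuF} => [a b] [c d] vF /= [/finj -> /finj ->].
Qed.

Lemma dh_surjective_W (A B : deligneHodgeSystem R n) (f : 'Hom(A, B)) w : dh_mor f ->
  limg f = fullv -> dh_W B w = (f @: dh_W A w)%VS.
Proof.
move=> hf fsurj; apply/vspaceP=> x; apply/idP/memv_imgP=> [xW|[a aW ->]].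
  by apply: dh_strict => //; rewrite fsurj memvf.
by case/dh_morE: hf => fW _ _; apply: fW.
Qed.

Lemma dh_surjective_F (A B : deligneHodgeSystem R n) (f : 'Hom(A, B)) p : dh_mor f ->
  limg f = fullv -> dh_F B p = (cplx_map f @: dh_F A p)%VS.
Proof.
move=> hf fsurj; apply/vspaceP=> v; apply/idP/memv_imgP=> [vF|[u uF ->]].
  apply: dh_strictF => //; have [a Ea] := surj_preimage fsurj v.1.
  have [b Eb] := surj_preimage fsurj v.2; exists ((a, b) : cplx A).
  by rewrite cplx_mapE -Ea -Eb; case: v {vF Ea Eb}.
by case/dh_morE: hf => _ _ fF; apply: fF.
Qed.

Local Notation C := (deligneHodge_linCat R n).

Lemma dh_initial (A B : deligneHodgeSystem R n) (f : lhom (C := C) A B) :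
  lker f = 0%VS -> initial_mor (C := C) f.
Proof.
move=> kerf T g /dh_morE[gW gN gF]; have hf : dh_mor f := lhomP f.
have [_ fN _] := (dh_morE _).1 hf; have /eqP/lker0P finj := kerf.
apply/dh_morE; split=> [w x xW|i x|p u uF].
- rewrite (dh_injective_W w hf kerf) -memv_preim -comp_lfunE; exact: gW.
- by have := gN i x; rewrite !comp_lfunE -fN => /finj.
- rewrite (dh_injective_F p hf kerf) -memv_preim -cplx_map_comp; exact: gF.
Qed.

Lemma dh_final (A B : deligneHodgeSystem R n) (f : lhom (C := C) A B) :
  limg f = fullv -> final_mor (C := C) f.
Proof.
move=> fsurj T g /dh_morE[gW gN gF]; have hf : dh_mor f := lhomP f.
have [_ fN _] := (dh_morE _).1 hf.
apply/dh_morE; split=> [w x|i x'|p u].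
- rewrite (dh_surjective_W w hf fsurj) => /memv_imgP[a aW ->].
  by rewrite -comp_lfunE; apply: gW.
- by have [x ->] := surj_preimage fsurj x'; have := gN i x; rewrite !comp_lfunE fN.
rewrite (dh_surjective_F p hf fsurj) => /memv_imgP[v vF ->].
by rewrite -cplx_map_comp; apply: gF.
Qed.

Lemma dh_zero : exists Z : deligneHodgeSystem R n, (fullv : {vspace Z}) = 0%VS.
Proof.
have V0 := @row0_eq0 R.
have C0 (u : cplx 'rV[R]_0) : u = 0.
  by case: u => a b; congr pair; [apply: V0|apply: V0].
have eqC (U U' : {vspace cplx 'rV[R]_0}) : U = U' by apply: zero_vspace.
have hZ : hodge_structure (fun _ : 'I_n => 0) (fun _ _ => fullv)
    (fun _ : int => fullv : {vspace cplx 'rV[R]_0}).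
  split.
  - exact: zero_tower.
  - exact: zero_nilpotent_commuting.
  - by move=> *; apply: memvf.
  - split=> [||w p]; [exact: zero_increasing| |by split; apply: eqC].
    by split; [move=> *; apply: subvf|exists 0; apply: eqC|exists 0; apply: eqC].
  move=> k w kn v p x _ _; exists 0, 0; rewrite !mem0v subr0 subr0 zero_mem //.
by exists (DeligneHodgeSystem (hst_is_deligne_hodge_system hZ)); apply: zero_vspace.
Qed.

Lemma dh_lin_kernel (A B : lobj C) (f : lhom A B) :
  exists (X : lobj C) (i : lhom X A), is_lin_kernel f i.
Proof.
have [WA hA WA0] := dh_structure A; have [WB hB WB0] := dh_structure B.
have [X [i [hi ker_i]]] := dh_kernel_at hA WA0 hB WB0 (lhomP f).
by exists X, (LHom (asboolT (hi : lmor (l := C) i))).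
Qed.

Lemma dh_lin_cokernel (A B : lobj C) (f : lhom A B) :
  exists (X : lobj C) (p : lhom B X), is_lin_cokernel f p.
Proof.
have [WA hA WA0] := dh_structure A; have [WB hB WB0] := dh_structure B.
have [X [p [hp coker_p]]] := dh_cokernel_at hA WA0 hB WB0 (lhomP f).
by exists X, (LHom (asboolT (hp : lmor (l := C) p))).
Qed.

Lemma dh_biproduct (A B : deligneHodgeCat R n) : exists T
  (i1 : mor A T) (i2 : mor B T) (p1 : mor T A) (p2 : mor T B),
  is_biproduct i1 i2 p1 p2.
Proof.
have [WA hA WA0] := dh_structure A; have [WB hB WB0] := dh_structure B.
have [T [i1 [i2 [p1 [p2 [[h1 h2 h3 h4] [e1 e2 e3 e4 e5]]]]]]] := dh_sum_at hA WA0 hB WB0.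
exists T, (LHom (asboolT (h1 : lmor (l := C) i1))), (LHom (asboolT (h2 : lmor (l := C) i2))).
exists (LHom (asboolT (h3 : lmor (l := C) p1))), (LHom (asboolT (h4 : lmor (l := C) p2))).
by split; apply/val_inj.
Qed.

Theorem deligneHodge_abelian :
  is_abelian (deligneHodgeCat R n) /\
  forall (A B : deligneHodgeCat R n) (f : mor A B),
    (forall (X : deligneHodgeCat R n) (i : mor X A), is_kernel f i <-> dh_kernel f i) /\
    (forall (X : deligneHodgeCat R n) (p : mor B X), is_cokernel f p <-> dh_cokernel f p).
Proof.
split.
  exact: (@lin_abelian _ C dh_initial dh_final dh_lin_kernel dh_lin_cokernel dh_zero dh_biproduct).
move=> A B f; split=> X g; have hg : dh_mor g := lhomP g; have [_ gN _] := hg.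
  apply: (iff_trans (is_kernelP (C := C) dh_initial dh_lin_kernel f g)); split=> [ker_g|[]//].
  have [ker0 _] := ker_g.
  by split=> // [w|p]; [apply: (dh_injective_W w hg)|apply: (dh_injective_F p hg)].
apply: (iff_trans (is_cokernelP (C := C) dh_final dh_lin_cokernel f g)); split=> [coker_g|[]//].
have [im_g _] := coker_g.
by split=> // [w|p]; [apply: (dh_surjective_W w hg)|apply: (dh_surjective_F p hg)].
Qed.

End DeligneHodgeCategory.

(** * The theorem *)

Theorem theorem1p8 (n : nat) :
  (forall E : fieldType, [pchar E] =i pred0 ->
     is_abelian (deligneCat E n) /\
     forall (A B : deligneCat E n) (f : mor A B),
       (forall (X : deligneCat E n) (i : mor X A),
          is_kernel f i <-> ds_kernel f i) /\
       (forall (X : deligneCat E n) (p : mor B X),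
          is_cokernel f p <-> ds_cokernel f p)) /\
  (forall R : realType,
     is_abelian (deligneHodgeCat R n) /\
     forall (A B : deligneHodgeCat R n) (f : mor A B),
       (forall (X : deligneHodgeCat R n) (i : mor X A),
          is_kernel f i <-> dh_kernel f i) /\
       (forall (X : deligneHodgeCat R n) (p : mor B X),
          is_cokernel f p <-> dh_cokernel f p)).
Proof.
split=> [E charE|R]; first exact: deligne_abelian.
exact: deligneHodge_abelian.
Qed.
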